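(* Work in Case B ($t_N=t^m$, $m\in\mathbb N_+$) with sign $\epsilon=-$. For all $\alpha\le\beta$ in $\mathcal P_N=\{1,2\}^N$, $$\mathbf t^{|\alpha|-|\beta|}Q^{B,II,-}_{\alpha,\beta}=\mathbf t^{|\alpha|-|\beta|}P^{B,-}_{\alpha,\beta},$$ and for $\alpha\in F^B(\beta)$ this common value is, up to sign, a monomial in $t^{-1}$, namely $(-1)^{\sigma'}t^{-d}$, where $$\sigma'=\sum_{p=1}^m(m-p)\,d^B_p(\alpha,\beta),\qquad d=d^B(\alpha,\beta)+\sum_{p=1}^m p\,d^B_p(\alpha,\beta).$$
   Context: Order and length: $\alpha\le\beta$ (Bruhat order) iff every prefix of $\alpha$ contains at least as many $1$'s as the prefix of $\beta$ of the same length. If $p_1<\dots<p_r$ are the positions of the $2$'s in $\alpha$, put $\mathbf t^{|\alpha|}=t^{\sum_k(N-p_k)+mr}$ and $\mathbf t^{|\alpha|-|\beta|}=\mathbf t^{|\alpha|}/\mathbf t^{|\beta|}$. Flips. In $\beta$, repeatedly pair an adjacent $2$ and $1$ (in this order) and remove them, until a string $1\cdots12\cdots2$ remains; the remaining letters are unpaired. Number the unpaired $2$'s from the right. The $j$-th one, $1\le j\le m$, is marked with the integer $p=m+1-j$. For each $j\ge m+1$ with $j-m+1$ even such that a $(j+1)$-th unpaired $2$ exists, the $j$-th and $(j+1)$-th unpaired $2$'s form a $22$-pair. (At most one unpaired $2$ remains unclassified; it is not flipped.) $F^B(\beta)$ is the set of strings obtained from $\beta$ by flipping some (possibly none) of these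 objects, where flipping a $21$ pair exchanges its $2$ and $1$, flipping an unpaired $2$ marked with an integer changes it to $1$, and flipping a $22$-pair changes both its $2$'s to $1$'s. For $\alpha\in F^B(\beta)$, $d^B(\alpha,\beta)$ is the number of flipped $21$ pairs and $22$-pairs, and $d^B_p(\alpha,\beta)\in\{0,1\}$ is the number of flipped unpaired $2$'s marked $p$. Kazhdan–Lusztig polynomials. The Iwahori–Hecke algebra $\mathcal H$ of type $B_N$ over $\mathbb C[t^{\pm1}]$ has generators $T_1,\dots,T_N$, the type $B_N$ braid relations (bond of order 4 between $N-1$ and $N$), $(T_i-t)(T_i+t^{-1})=0$ for $i<N$ and $(T_N-t_N)(T_N+t_N^{-1})=0$. Bar involution: $T_i\mapsto T_i^{-1}$, $t\mapsto t^{-1}$. The module $\mathcal M^-$ has basis $\{m_\alpha:\alpha\in\mathcal P_N\}$ with, for $i<N$: $T_im_\alpha=-t^{-1}m_\alpha$ if $\alpha_i=\alpha_{i+1}$; $m_{s_i\cdot\alpha}$ if $\alpha_i<\alpha_{i+1}$; $m_{s_i\cdot\alpha}+(t-t^{-1})m_\alpha$ if $\alpha_i>\alpha_{i+1}$; and $T_Nm_\alpha=m_{s_N\cdot\alpha}$ if $\alpha_N=1$, $m_{s_N\cdot\alpha}+(t_N-t_N^{-1})m_\alpha$ if $\alpha_N=2$ ($s_i$ exchanges $\alpha_i,\alpha_{i+1}$; $s_N$ replaces $\alpha_N$ by $3-\alpha_N$). The bar involution on $\mathcal M^-$ is semilinear with $\overline{m_{1\ldots1}}=m_{1\ldots1}$,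 $\overline{hv}=\bar h\bar v$. There is a unique bar-invariant basis $C^{B,-}_\beta=\sum_{\alpha\le\beta}\mathbf t^{|\alpha|-|\beta|}P^{B,-}_{\alpha,\beta}m_\alpha$ with $P^{B,-}_{\beta,\beta}=1$ and $\mathbf t^{|\alpha|-|\beta|}P^{B,-}_{\alpha,\beta}\in t^{-1}\mathbb Z[t^{-1}]$ for $\alpha<\beta$. Generating function $Q^{B,II,-}$. A string $\alpha$ is identified with the lattice path from $(0,0)$ whose $i$-th step is $(1,-1)$ if $\alpha_i=1$ and $(1,1)$ if $\alpha_i=2$; $\alpha\le\beta$ iff path $\alpha$ is weakly below path $\beta$. A box $(i,j)$ is the 45-degree rotated square centred at $(i,j)$ with vertices $(i\pm1,j),(i,j\pm1)$. $\lambda^-(\alpha)$ is the set of boxes $(i,j)$ with $0<i\le N$, $|j|\le i$, $i+j-1$ even, below the path $\alpha$. The region for $\alpha\le\beta$ is $\lambda^-(\beta)/\lambda^-(\alpha)$; its boxes $(N,j)$ are anchor boxes. For a box $(x,y)$: NE is $(x+1,y+1)$, NW is $(x-1,y+1)$, just above is $(x,y+2)$, just below is $(x,y-2)$. A ballot path of length $(l,l')\in\mathbb N^2$ is a path with steps $(1,\pm1)$ from some $(x,y)$ to $(x+2l+l',y+l')$ staying weakly above height $y$; a ballot strip of length $(l,l')$ is the set of boxes centred at its vertices. $\mathrm{Conf}^{II}(\alpha,\beta)$ is the set of partitions of the boxes of the region into ballot strips such that: (Rule 0) the rightmost box of a strip with $l'\ge1$ is an anchor box; (Rule IIa) for strips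 $\mathcal D,\mathcal D'$, if some box of $\mathcal D'$ is just above, NW or NE of a box of $\mathcal D$, then all boxes just above, NW and NE of a box of $\mathcal D$ belong to $\mathcal D$ or $\mathcal D'$ (positions with first coordinate $>N$ are disregarded); (Rule IIb) if there is a strip $\mathcal D$ of length $(l,l')$ with $l'\ge m$ and $l'-m$ even (resp. odd), then there is a strip of length $(l'',l'+1)$ with $l''\ge l$ just above $\mathcal D$ (resp. of length $(l'',l'-1)$ with $l''\le l$ just below $\mathcal D$). The weight of a strip of length $(l,l')$ is $(-1)^{l'}t^{2l+2l'}$ if $0\le l'\le m-1$, $t^{m+l'+2l}$ if $l'\ge m$ and $l'-m$ even, $t^{m+l'+2l-1}$ if $l'\ge m$ and $l'-m$ odd. $Q^{B,II,-}_{\alpha,\beta}$ is the sum over $\mathrm{Conf}^{II}(\alpha,\beta)$ of the product of the weights of the strips. *)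

(* Defs.v *)
From HB Require Import structures.
From mathcomp Require Import all_boot all_order all_algebra finmap.
From mathcomp Require Import boolp classical_sets reals complex.
From mathcomp.multinomials Require Import monalg.

Set Implicit Arguments.
Unset Strict Implicit.
Unset Printing Implicit Defensive.

Import Order.TTheory GRing.Theory Num.Theory.
Local Open Scope fset_scope.
Local Open Scope ring_scope.

(* Laurent polynomials C[t, t^-1]: finitely supported functions int -> C with *)
(* the convolution product.  [{malg C[int]}] carries no ring structure in the *)
(* library because the exponents there must form a monoid without units.      *)
Definition laurent (C : comNzRingType) : Type := {malg C[int]}.

HB.instance Definition _ (C : comNzRingType) :=
  GRing.Zmodule.on (laurent C).

Section LaurentRing.
Variable C : comNzRingType.
Implicit Types f g : {malg C[int]}.

Definition lmono (c : C) (k : int) : {malg C[int]} := mkmalgU k c.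

Definition lmul f g : {malg C[int]} :=
  \sum_(i <- msupp f) \sum_(j <- msupp g) lmono (f@_i * g@_j) (i + j).

Lemma lmulw (d1 d2 : {fset int}) f g :
    msupp f `<=` d1 -> msupp g `<=` d2 ->
  lmul f g = \sum_(i <- d1) \sum_(j <- d2) lmono (f@_i * g@_j) (i + j).
Proof.
move=> s1 s2; rewrite /lmul (big_fset_incl _ s1) /=; last first.
  move=> i _ /mcoeff_outdom fi; rewrite big1 // => j _.
  by rewrite /lmono fi mul0r monalgU0.
apply: eq_bigr => i _; apply: big_fset_incl => // j _ /mcoeff_outdom ->.
by rewrite /lmono mulr0 monalgU0.
Qed.

Lemma lmulC : commutative lmul.
Proof.
move=> f g; rewrite /lmul exchange_big /=; apply: eq_bigr => j _.
by apply: eq_bigr => i _; rewrite mulrC addrC.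
Qed.

Lemma lmulUU a b i j : lmul (lmono a i) (lmono b j) = lmono (a * b) (i + j).
Proof.
by rewrite (lmulw msuppU_le msuppU_le) !big_seq_fset1 /lmono !mcoeffUU.
Qed.

Lemma lmulDl : left_distributive lmul +%R.
Proof.
move=> f1 f2 g.
rewrite [in RHS](lmulw (fsubsetUl _ (msupp f2)) (fsubset_refl _)).
rewrite [in RHS](lmulw (fsubsetUr (msupp f1) _) (fsubset_refl _)).
rewrite (lmulw (msuppD_le _ _) (fsubset_refl _)) -big_split /=.
apply: eq_bigr => i _; rewrite -big_split /=; apply: eq_bigr => j _.
by rewrite /lmono mcoeffD mulrDl monalgUD.
Qed.

Lemma lmul0 : left_zero 0 lmul.
Proof. by move=> g; rewrite /lmul msupp0 big_seq_fset0. Qed.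

Lemma lmul_suml (I : Type) (r : seq I) (F : I -> {malg C[int]}) g :
  lmul (\sum_(i <- r) F i) g = \sum_(i <- r) lmul (F i) g.
Proof. by apply: (big_morph (lmul^~ g)) => [x y|]; rewrite ?lmulDl ?lmul0. Qed.

Lemma lmul_sumr (I : Type) (r : seq I) (F : I -> {malg C[int]}) g :
  lmul g (\sum_(i <- r) F i) = \sum_(i <- r) lmul g (F i).
Proof. by rewrite lmulC lmul_suml; apply: eq_bigr => i _; rewrite lmulC. Qed.

Lemma lmulA : associative lmul.
Proof.
move=> f g h; rewrite [f]monalgE !lmul_suml; apply: eq_bigr => i _.
rewrite -/(lmono _ _) [g]monalgE lmul_suml !lmul_sumr lmul_suml.
apply: eq_bigr => j _; rewrite -/(lmono _ _) [h]monalgE !lmul_sumr.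
by apply: eq_bigr => k _; rewrite -/(lmono _ _) !lmulUU mulrA addrA.
Qed.

Lemma lmul1 : left_id (lmono 1 0) lmul.
Proof.
move=> g; rewrite [g in LHS]monalgE [RHS]monalgE lmul_sumr.
by apply: eq_bigr => i _; rewrite lmulUU mul1r add0r.
Qed.

Lemma lone_neq0 : lmono 1 0 != 0.
Proof. by rewrite monalgU_eq0 oner_eq0. Qed.

HB.instance Definition _ := GRing.Zmodule_isComNzRing.Build (laurent C)
  lmulA lmulC lmul1 lmulDl lone_neq0.

Definition tpow (k : int) : laurent C := lmono 1 k.

Definition lbar (x : laurent C) : laurent C :=
  \sum_(k <- msupp x) (lmono x@_k (- k) : laurent C).

(* Membership in t^-1 Z[t^-1]. *)
Definition neg_int_laurent (x : laurent C) : Prop :=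
  forall k : int,
    (exists z : int, x@_k = z%:~R) /\ (0 <= k -> x@_k = 0).

End LaurentRing.

Section Words.
Variable N : nat.

(* A string over {1,2}: [false] is the letter 1 and [true] the letter 2.  The *)
(* letter in position i (1 <= i <= N) is stored at index i - 1.               *)
Definition word := N.-tuple bool.
Implicit Types alpha beta : word.

Definition letter alpha (k : nat) : bool := nth false alpha k.

Definition bruhat alpha beta : bool :=
  [forall k : 'I_N.+1,
    (count_mem false (take k beta) <= count_mem false (take k alpha))%N].

(* The exponent of t in t^|alpha|, for t_N = t^m. *)
Definition wt_word (m : nat) alpha : nat :=
  (\sum_(k < N | letter alpha k) (N - k.+1 + m))%N.

(* Index i stands for the generator s_{i+1}. *)
Definition s_act (i : 'I_N) alpha : word :=
  [tuple
    if (i.+1 < N)%N then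
      if k == i :> nat then letter alpha i.+1
      else if k == i.+1 :> nat then letter alpha i
      else letter alpha k
    else if k == i :> nat then ~~ letter alpha k else letter alpha k
  | k < N].

Section Flips.
Variable m : nat.

(* One step of the matching: remove the first adjacent 2 1 from a list of     *)
(* (index, letter) and return the indices of this pair.                       *)
Fixpoint find_pair (s : seq (nat * bool)) :
    option ((nat * nat) * seq (nat * bool)) :=
  match s with
  | x :: ((y :: s2) as s1) =>
      if x.2 && ~~ y.2 then Some ((x.1, y.1), s2)
      else if find_pair s1 is Some (p, r) then Some (p, x :: r) else None
  | _ => None
  end.

Fixpoint pair_up (fuel : nat) (s : seq (nat * bool)) :
    seq (nat * nat) * seq (nat * bool) :=
  if fuel is n.+1 then
    if find_pair s is Some (p, r) then
      let: (ps, u) := pair_up n r in (p :: ps, u)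
    else ([::], s)
  else ([::], s).

Definition matching beta := pair_up N (zip (iota 0 N) beta).

Definition pairs21 beta : seq (nat * nat) := (matching beta).1.

(* Indices of the unpaired 2's, from right to left: the j-th unpaired 2 is    *)
(* the item of rank j - 1.                                                    *)
Definition unpaired2 beta : seq nat :=
  rev [seq x.1 | x <- (matching beta).2 & x.2].

Inductive flip_object :=
  | Flip21 of nat & nat       (* indices of the two letters *)
  | FlipMarked of nat & nat   (* mark p, index of the letter *)
  | Flip22 of nat & nat.      (* indices of the two letters *)

Definition flip_indices (o : flip_object) : seq nat :=
  match o with
  | Flip21 i j => [:: i; j]
  | FlipMarked _ i => [:: i]
  | Flip22 i j => [:: i; j]
  end.

Definition flip_objects beta : seq flip_object :=
  let u := unpaired2 beta in
  [seq Flip21 x.1 x.2 | x <- pairs21 beta]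
  ++ [seq FlipMarked (m + 1 - j)%N (nth 0%N u j.-1)
       | j <- iota 1 (size u) & (j <= m)%N]
  ++ [seq Flip22 (nth 0%N u j.-1) (nth 0%N u j)
       | j <- iota 1 (size u)
       & [&& (m + 1 <= j)%N, ~~ odd (j - m + 1)%N & (j.+1 <= size u)%N]].

(* Every kind of flip replaces each of the letters involved by the other one. *)
Definition change_letters (idx : seq nat) beta : word :=
  [tuple (if (k : nat) \in idx then ~~ letter beta k else letter beta k)
  | k < N].

(* alpha \in F^B(beta); the bits of sel tell which objects are flipped. *)
Definition FB alpha beta : bool :=
  [exists sel : (size (flip_objects beta)).-tuple bool,
    alpha == change_letters
      (flatten [seq flip_indices o | o <- mask sel (flip_objects beta)]) beta].

(* The objects have disjoint sets of letters, so alpha determines which       *)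
(* objects have been flipped.                                                 *)
Definition flipped alpha beta (o : flip_object) : bool :=
  all (fun i => letter alpha i != letter beta i) (flip_indices o).

Definition dB alpha beta : nat :=
  count (fun o => flipped alpha beta o &&
           match o with FlipMarked _ _ => false | _ => true end)
    (flip_objects beta).

Definition dBp (p : nat) alpha beta : nat :=
  count (fun o => flipped alpha beta o &&
           match o with FlipMarked q _ => q == p | _ => false end)
    (flip_objects beta).

Definition flip_sign_exp alpha beta : nat :=
  (\sum_(1 <= p < m.+1) (m - p) * dBp p alpha beta)%N.

Definition flip_deg alpha beta : nat :=
  (dB alpha beta + \sum_(1 <= p < m.+1) p * dBp p alpha beta)%N.

End Flips.
End Words.

Section KazhdanLusztig.
Variables (C : comNzRingType) (N m : nat).
Local Notation L := (laurent C).
Local Notation tq := (@tpow C).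

(* Exponent e such that the parameter of T_{i+1} is t^e: 1 for i + 1 < N, and *)
(* m for the last generator, as t_N = t^m.                                    *)
Definition param_exp (i : 'I_N) : int := if (i.+1 < N)%N then 1 else m%:Z.

Definition hecke_relations (A : algType L) (T : 'I_N -> A) : Prop :=
  [/\ forall i : 'I_N,
        (T i - (tq (param_exp i))%:A) * (T i + (tq (- param_exp i))%:A) = 0,
      forall i j : 'I_N, (i.+1 < j)%N -> T i * T j = T j * T i,
      forall i j : 'I_N, j = i.+1 :> nat -> (j.+1 < N)%N ->
        T i * T j * T i = T j * T i * T j
    & forall i j : 'I_N, j = i.+1 :> nat -> j.+1 = N ->
        T i * T j * T i * T j = T j * T i * T j * T i].

(* H is the algebra presented by the generators T and the above relations. *)
Definition is_hecke_algebra (H : algType L) (T : 'I_N -> H) : Prop :=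
  hecke_relations T /\
  forall (A : algType L) (a : 'I_N -> A), hecke_relations a ->
    exists2 f : {lrmorphism H -> A},
      (forall i, f (T i) = a i) &
      forall g : {lrmorphism H -> A}, (forall i, g (T i) = a i) -> g =1 f.

Definition is_hecke_bar (H : algType L) (T : 'I_N -> H)
    (barH : {rmorphism H -> H}) : Prop :=
  (forall c : L, barH c%:A = (lbar c)%:A) /\
  (forall i, barH (T i) * T i = 1 /\ T i * barH (T i) = 1).

Section Module.
Variables (H : algType L) (T : 'I_N -> H) (M : lmodType H).
Variable mb : word N -> M.

(* T_{i+1} m_alpha in M^-. *)
Definition minus_action (i : 'I_N) (alpha : word N) : M :=
  let s_m := mb (s_act i alpha) in
  if (i.+1 < N)%N then
    if letter alpha i == letter alpha i.+1 then
      - ((tq (-1))%:A *: mb alpha)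
    else if letter alpha i.+1 then s_m
    else s_m + (tq 1 - tq (-1))%:A *: mb alpha
  else if letter alpha i then
    s_m + (tq m%:Z - tq (- m%:Z))%:A *: mb alpha
  else s_m.

(* M^- as a left H-module: L acts on it through the scalars c%:A of H. *)
Definition is_module_minus : Prop :=
  (forall v : M, exists! c : {ffun word N -> L},
     v = \sum_alpha (c alpha)%:A *: mb alpha) /\
  (forall i alpha, T i *: mb alpha = minus_action i alpha).

Definition is_module_bar (barH : {rmorphism H -> H})
    (barM : {additive M -> M}) : Prop :=
  barM (mb [tuple false | _ < N]) = mb [tuple false | _ < N] /\
  (forall h v, barM (h *: v) = barH h *: barM v).

(* t^(|alpha| - |beta|) *)
Definition tdiff (alpha beta : word N) : L :=
  tq ((wt_word m alpha)%:Z - (wt_word m beta)%:Z).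

Definition kl_element (P : word N -> word N -> L) (beta : word N) : M :=
  \sum_(alpha | bruhat alpha beta)
    (tdiff alpha beta * P alpha beta)%:A *: mb alpha.

(* These conditions characterize P alpha beta = P^{B,-}_{alpha,beta} for      *)
(* alpha <= beta; the other values of P are unconstrained.                    *)
Definition is_kl_family (barM : {additive M -> M})
    (P : word N -> word N -> L) : Prop :=
  [/\ forall beta, barM (kl_element P beta) = kl_element P beta,
      forall beta, P beta beta = 1
    & forall alpha beta, bruhat alpha beta -> alpha != beta ->
        neg_int_laurent (tdiff alpha beta * P alpha beta)].

End Module.
End KazhdanLusztig.

Section BallotStrips.

Definition box : Type := (int * int)%type.

Definition box_above (b : box) : box := (b.1, b.2 + 2).
Definition box_below (b : box) : box := (b.1, b.2 - 2).
Definition box_NE (b : box) : box := (b.1 + 1, b.2 + 1).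
Definition box_NW (b : box) : box := (b.1 - 1, b.2 + 1).

Definition ballot_step (b c : box) : bool :=
  (c.1 == b.1 + 1) && ((c.2 == b.2 + 1) || (c.2 == b.2 - 1)).

Definition ballot_strip (D : {fset box}) (l l' : nat) : Prop :=
  exists (b : box) (s : seq box),
    [/\ path ballot_step b s,
        last b s = (b.1 + (2 * l + l')%N%:Z, b.2 + l'%:Z),
        all (fun c : box => b.2 <= c.2) s
      & D = [fset c in b :: s]].

(* The length (l, l') of a ballot strip, which is determined by its boxes. *)
Definition strip_length (D : {fset box}) : nat * nat :=
  xget (0%N, 0%N) [set ll | ballot_strip D ll.1 ll.2]%classic.

Variables (N m : nat).

Definition path_height (alpha : word N) (i : nat) : int :=
  (count_mem true (take i alpha))%:Z - (count_mem false (take i alpha))%:Z.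

Definition lambda_minus (alpha : word N) : {fset box} :=
  [fset b in [seq ((i%:Z, j%:Z - N%:Z) : box)
               | i <- iota 1 N, j <- iota 0 (2 * N).+1]
  | [&& `|b.2| <= b.1, (2 %| b.1 + b.2 - 1)%Z
      & b.2 < path_height alpha `|b.1|%N]].

Definition region (alpha beta : word N) : {fset box} :=
  lambda_minus beta `\` lambda_minus alpha.

(* Positions outside the region count too, except those with c.1 > N. *)
Definition over_strip (D : {fset box}) (c : box) : Prop :=
  c.1 <= N%:Z /\
  exists2 b : box, b \in D & c \in [:: box_above b; box_NW b; box_NE b].

Definition rule0 (pi : {fset {fset box}}) : Prop :=
  forall (D : {fset box}) (l l' : nat),
    D \in pi -> ballot_strip D l l' -> (1 <= l')%N ->
    forall c : box, c \in D -> (forall b : box, b \in D -> b.1 <= c.1) -> c.1 = N%:Z.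

Definition ruleIIa (pi : {fset {fset box}}) : Prop :=
  forall D D' : {fset box}, D \in pi -> D' \in pi -> D' != D ->
    (exists2 c : box, c \in D' & over_strip D c) ->
    forall c : box, over_strip D c -> c \in D `|` D'.

(* "Just above" ("just below") for two strips: some box of one is just above   *)
(* (just below) a box of the other.                                           *)
Definition ruleIIb (pi : {fset {fset box}}) : Prop :=
  forall (D : {fset box}) (l l' : nat),
    D \in pi -> ballot_strip D l l' -> (m <= l')%N ->
    if ~~ odd (l' - m)%N then
      exists (D' : {fset box}) (l'' : nat),
        [/\ D' \in pi, ballot_strip D' l'' (l' + 1)%N, (l <= l'')%N
          & exists2 b : box, b \in D & box_above b \in D']
    else
      exists (D' : {fset box}) (l'' : nat),
        [/\ D' \in pi, ballot_strip D' l'' (l' - 1)%N, (l'' <= l)%N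
          & exists2 b : box, b \in D & box_below b \in D'].

Definition confII (alpha beta : word N) (pi : {fset {fset box}}) : Prop :=
  [/\ fcover pi = region alpha beta /\ trivIfset pi,
      forall D : {fset box}, D \in pi -> exists l l', ballot_strip D l l',
      rule0 pi, ruleIIa pi & ruleIIb pi].

Variable C : comNzRingType.

Definition strip_weight (l l' : nat) : laurent C :=
  if (l' < m)%N then (-1) ^+ l' * tpow C (2 * l + 2 * l')%N
  else if ~~ odd (l' - m)%N then tpow C (m + l' + 2 * l)%N
  else tpow C (m + l' + 2 * l - 1)%N.

Definition Q_minus (alpha beta : word N) : laurent C :=
  \sum_(pi <- fpowerset (fpowerset (region alpha beta))
       | `[< confII alpha beta pi >])
    \prod_(D <- pi) strip_weight (strip_length D).1 (strip_length D).2.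

End BallotStrips.

(* Main.v *)
(** The Hecke side: T_i + t_i^-1 is bar invariant, and for i < N it maps everything
    into the line spanned by m_21 + t^-1 m_12 in the letters i, i+1, as in the
    Temperley-Lieb algebra.  Let C_beta be the product vector in which a 21 pair
    contributes m_21 + t^-1 m_12, an unpaired 2 marked p contributes
    m_2 + (-1)^(m-p) t^-p m_1, and a 22-pair contributes m_22 + t^-1 m_11.  Since
    T_i + t^-1 moves adjacent pairs past a letter, bar invariance of C_beta reduces to
    beta = 2...2 preceded by pairs and 1's; there the images under T_i + t_i^-1 are
    known to be invariant, and a vector killed by them is determined by its leading
    coefficients.  By uniqueness of the Kazhdan-Lusztig basis, t^(|alpha|-|beta|) P is
    the coefficient of m_alpha in C_beta.

    The tiling side: measure the depth of a box from the path beta.  Rule IIa forces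
    every strip to have constant depth and to be strictly contained, horizontally, in
    the strip just above it, so that it lies below a paired 21 or below an unpaired 2
    of beta.  Hence a configuration has exactly one strip for each 2 of beta that is a 1
    in alpha, and it exists if and only if paired letters are flipped together, no
    unpaired 1 is flipped, and (Rule IIb) the 2's of a 22-pair are flipped together and
    an unclassified 2 is not flipped.
    Its weight times t^(|alpha|-|beta|) is again the coefficient of m_alpha in C_beta. *)

Require Import Defs.
From mathcomp Require Import all_boot all_order all_algebra finmap.
From mathcomp Require Import boolp classical_sets reals complex.
From mathcomp.multinomials Require Import monalg.
From mathcomp Require Import zify ring.

Set Implicit Arguments.
Unset Strict Implicit.
Unset Printing Implicit Defensive.

Import Order.TTheory GRing.Theory Num.Theory.
Local Open Scope ring_scope.

(** * Laurent polynomials *)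

(** The constants are forced by the generators. The rightmost factor m_2 + t^-m m_1 is an
    eigenvector of T_N + t_N^-1. The product of neighbouring factors (m_2 + c m_1)(m_2 + c' m_1) is
    killed by T_i + t^-1 iff c = -t c', so that marks decrease by one with alternating sign, down to
    1. From there on m_22 + t^-1 m_11 is killed inside a pair, and across the border of two factors
    the image is, up to sign, a product vector with a 21 pair, invariant by induction. This
    induction shortens the word, whereas the module and its bar involution belong to a fixed N.
    Removed pairs and leading 1's are therefore kept as a prefix with an arbitrary coefficient
    function [u], of which only the invariance of [u] tensored with m_1...1 is assumed. Three
    descriptions of the matching meet: repeated removal (F^B), heights of the path (tilings), and a
    left-to-right stack ([scan]). The stack mediates: it is unaffected by removing an adjacent 21,
    and a position in it is a height of the path. *)

Section Laurent.
Variable C : comNzRingType.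
Local Notation L := (laurent C).
Local Notation tq := (@tpow C).

Lemma tpow0 : tq 0 = 1.
Proof. by []. Qed.

Lemma tpowD j k : tq (j + k) = tq j * tq k.
Proof. by rewrite /tpow -[RHS]/(lmul _ _) lmulUU mulr1. Qed.

Lemma tpowK k : tq k * tq (- k) = 1.
Proof. by rewrite -tpowD subrr. Qed.

Lemma tpow_sum (I : Type) (r : seq I) (p : pred I) (F : I -> int) :
  tq (\sum_(i <- r | p i) F i) = \prod_(i <- r | p i) tq (F i).
Proof. by apply: (big_morph _ tpowD tpow0). Qed.

Lemma lmonoE (c : C) k j : (lmono c k)@_j = if j == k then c else 0.
Proof. by rewrite /lmono mcoeffU eq_sym; case: eqP => //= _; rewrite ?mulr1n ?mulr0n. Qed.

Lemma tpowE k j : (tq k)@_j = if j == k then 1 else 0.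
Proof. exact: lmonoE. Qed.

Lemma lbarE (x : L) k : (lbar x)@_k = x@_(- k).
Proof.
rewrite /lbar raddf_sum /=.
under eq_bigr => j _ do rewrite lmonoE.
have [xk|xk] := boolP (- k \in msupp x); last first.
  rewrite big_seq big1 ?(mcoeff_outdom xk) // => j jx; case: eqP => // E.
  by rewrite E opprK jx in xk.
rewrite (big_fsetD1 _ xk) /= opprK eqxx big_seq big1 ?addr0 // => j.
by rewrite !inE => /andP[jk _]; case: eqP => // E; rewrite E opprK eqxx in jk.
Qed.

Lemma lbar_tpow k : lbar (tq k) = tq (- k).
Proof. by apply/malgP => j; rewrite lbarE !tpowE eqr_oppLR. Qed.

Lemma lbarN1 : lbar (-1 : L) = -1.
Proof.
apply/malgP => k; rewrite lbarE !mcoeffN; congr (- _).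
by rewrite -[1]/(tq 0) !tpowE oppr_eq0.
Qed.

Lemma lbar1 : lbar (1 : L) = 1.
Proof. by rewrite -[1 in LHS]/(tq 0) lbar_tpow oppr0. Qed.

End Laurent.

(** * Paths and archs *)

Fixpoint height (w : nat -> bool) (k : nat) : int :=
  if k is k'.+1 then height w k' + (if w k' then 1 else -1) else 0.

Lemma heightS w k : height w k.+1 = height w k + (if w k then 1 else -1).
Proof. by []. Qed.

Section Heights.
Variables (N : nat) (a b : nat -> bool).

(** Half the height difference of the two paths, hence the number of boxes of the region in column
    [k]. *)
Fixpoint gap (k : nat) : int :=
  if k is k'.+1 then gap k' + (b k')%:Z - (a k')%:Z else 0.

Local Notation ht := (height b).

Lemma height_gap k : ht k - height a k = 2 * gap k.
Proof. by elim: k => //= k IH; case: (b k) (a k) => [] []; lia. Qed.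

Lemma gapS_up i : b i -> gap i.+1 = gap i + (~~ a i)%:Z.
Proof. by move=> /= ->; case: (a i); lia. Qed.

Lemma gapS_down i : ~~ b i -> gap i.+1 = gap i - (a i)%:Z.
Proof. by move=> /= /negbTE ->; case: (a i); lia. Qed.

Lemma heightS_up i : b i -> ht i.+1 = ht i + 1.
Proof. by move=> /= ->. Qed.

Lemma heightS_down i : ~~ b i -> ht i.+1 = ht i - 1.
Proof. by move=> /= /negbTE ->. Qed.

(* The columns reached by the strip below the 2 with index [i]: the 2 is       *)
(* paired with the 1 of index [e], or it is unpaired and [e = N].              *)
Definition arch (i e : nat) : Prop :=
  [/\ b i, (i < e <= N)%N, forall k, (i < k <= e)%N -> ht i < ht k
    & (e < N)%N -> ht e.+1 = ht i].

Lemma arch_lt i e : arch i e -> (i < e)%N.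
Proof. by case=> _ /andP[]. Qed.

Lemma arch_le i e : arch i e -> (e <= N)%N.
Proof. by case=> _ /andP[]. Qed.

Lemma arch_gt i e k : arch i e -> (i < k <= e)%N -> ht i < ht k.
Proof. by case=> _ _ H _; apply: H. Qed.

Lemma arch_down i e : arch i e -> (e < N)%N -> ~~ b e.
Proof.
case=> _ /andP[lt_ie _] /(_ e); rewrite lt_ie leqnn => /(_ isT) + + eN => + /(_ eN).
by case: (boolP (b e)) => // be; rewrite (heightS_up be); lia.
Qed.

Lemma arch_end_height i e : arch i e -> (e < N)%N -> ht e = ht i + 1.
Proof.
move=> A eN; have := arch_down A eN => /heightS_down.
by case: A => _ _ _ /(_ eN) ->; lia.
Qed.

Lemma arch_uniq i e e' : arch i e -> arch i e' -> e = e'.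
Proof.
wlog le_ee' : e e' / (e <= e')%N.
  by move=> IH A A'; case/orP: (leq_total e e') => h; [|symmetry]; apply: IH.
move=> A A'; apply/eqP; rewrite eqn_leq le_ee' leqNgt; apply/negP => lt_ee'.
have eN : (e < N)%N by have := arch_le A'; lia.
case: (A) => _ /andP[lt_ie _] _ /(_ eN) E.
by have := arch_gt (k := e.+1) A'; rewrite E ltxx; lia.
Qed.

Lemma arch_ex i : b i -> (i < N)%N -> exists e, arch i e.
Proof.
move=> bi iN.
(* The first return to height at most [ht i] is [e.+1]; without any return the 2 is unpaired and the
   arch runs to [N]. *)
pose p k := [&& (i < k)%N, (k <= N)%N & ht k <= ht i].
have [[k pk]|no] := pselect (exists k, p k); last first.
  exists N; split=> //; rewrite ?iN ?leqnn ?ltnn // => k /andP[ik kN].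
  by rewrite ltNge; apply/negP => h; apply: no; exists k; rewrite /p ik kN.
have [k0 /and3P[ik kN hk] mink] := ex_minnP (ex_intro _ k pk).
case: k0 ik kN hk mink => // e ie eN he mine.
have ht1 k1 : (i < k1 <= e)%N -> ht i < ht k1.
  move=> /andP[ik1 k1e]; rewrite ltNge; apply/negP => h.
  have /mine : p k1 by rewrite /p ik1 h andbT /=; lia.
  by lia.
have [E|ne] := eqVneq i e; first by move: he; rewrite -E (heightS_up bi); lia.
have lt_ie : (i < e)%N by lia.
exists e; split=> //; first by rewrite lt_ie; lia.
move=> _; have := ht1 e; rewrite lt_ie leqnn => /(_ isT).
by move: he => /=; case: (b e); lia.
Qed.

Lemma arch_inj i i' e : arch i e -> arch i' e -> (e < N)%N -> i = i'.
Proof.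
wlog le_ii' : i i' / (i <= i')%N.
  by move=> IH A A' eN; case/orP: (leq_total i i') => h; [|symmetry]; apply: IH.
move=> A A' eN; apply/eqP; rewrite eqn_leq le_ii' leqNgt; apply/negP => lt_ii'.
have := arch_gt (k := i') A; have := arch_lt A'.
by case: A A' => _ _ _ /(_ eN) + [_ _ _ /(_ eN)]; lia.
Qed.

Lemma arch_order i i' : arch i N -> arch i' N -> ht i < ht i' -> (i < i')%N.
Proof.
move=> A A' lt; rewrite ltnNge leq_eqVlt; apply/negP => /orP[/eqP E|lt2].
  by move: lt; rewrite E ltxx.
by have := arch_gt (k := i) A'; have := arch_lt A; lia.
Qed.

(** The partner of the 1 at [j] is the last index up to [j] of height at most [ht j.+1]; [k]
    witnesses that there is one. *)
Lemma arch_match j k : ~~ b j -> (j < N)%N -> (k <= j)%N -> ht k <= ht j.+1 ->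
  exists i, arch i j.
Proof.
move=> bj jN kj hk.
pose p k := (k <= j)%N && (ht k <= ht j.+1).
have pk : p k by rewrite /p kj.
have ub k' : p k' -> (k' <= j)%N by case/andP.
have [i /andP[ij hi] maxi] := ex_maxnP (ex_intro _ k pk) ub.
have gt k' : (i < k' <= j)%N -> ht j.+1 < ht k'.
  move=> /andP[ik' k'j]; rewrite ltNge; apply/negP => h.
  have /maxi : p k' by rewrite /p k'j.
  by lia.
have ne : i != j by apply/eqP => E; move: hi; rewrite E (heightS_down bj); lia.
have lt_ij : (i < j)%N by lia.
have := gt i.+1; rewrite lt_ij ltnSn => /(_ isT) g1.
have bi : b i by apply: contraT => /heightS_down; lia.
have E := heightS_up bi.
exists i; split=> //; first by rewrite lt_ij; lia.
  by move=> k' /gt; lia.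
by move=> _; lia.
Qed.

(** Archs do not cross: an end [e' <= e] would have height [ht i' + 1], which is at most [ht i],
    while inside the arch of [i] heights exceed [ht i]. *)
Lemma arch_nested i e i' e' :
  arch i e -> arch i' e' -> (i' < i)%N -> (i < e')%N ->
  (e' = N) \/ (e < e')%N.
Proof.
move=> A A' lt_i'i lt_ie'; have [E|ne] := eqVneq e' N; [by left|right].
have e'N : (e' < N)%N by have := arch_le A'; lia.
have hi : ht i' < ht i by apply: (arch_gt A'); lia.
rewrite ltnNge; apply/negP => le_e'e.
have : ht i < ht e' by apply: (arch_gt A); lia.
by rewrite (arch_end_height A' e'N); lia.
Qed.

Hypothesis flip_pair : forall i e, arch i e -> (e < N)%N -> (~~ a i) = a e.

(** While the path stays above its starting level every 1 is paired inside the interval, so by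
    [flip_pair] its flip cancels that of its 2. The remaining 2's can only raise the gap, and at
    equal heights none remains. *)
Lemma gap_mono k0 k1 : (k0 <= k1)%N -> (k1 <= N)%N ->
  (forall k, (k0 <= k <= k1)%N -> ht k0 <= ht k) ->
  gap k0 <= gap k1 /\ (ht k1 = ht k0 -> gap k0 = gap k1).
Proof.
elim/ltn_ind: k1 k0 => -[|k] IH k0 le01 k1N H.
  by have -> : k0 = 0%N by lia.
have [->//|ne] := eqVneq k0 k.+1.
have le0 : (k0 <= k)%N by lia.
have [bk|bk] := boolP (b k).
  have [||||g _] := IH k _ k0; rewrite ?ltnSn //; try lia.
    by move=> k'; move=> ?; apply: H; lia.
  split; first by rewrite (gapS_up bk); case: (a k); lia.
  by rewrite (heightS_up bk); have := H k; rewrite le0 leqnSn => /(_ isT); lia.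
have hk1 : ht k0 <= ht k.+1 by apply: H; lia.
(* The last letter is a 1: cut out its arch, and use induction before [i] and strictly inside the
   arch. *)
have [//|i Ai] := arch_match bk _ le0 hk1.
have [_ /andP[ik _] gti /(_ k1N) E] := Ai.
have le0i : (k0 <= i)%N.
  rewrite leqNgt; apply/negP => lt; have := gti k0; rewrite lt le0 => /(_ isT).
  by lia.
have bi : b i by case: Ai.
have [||||g1 e1] := IH i _ k0; try lia.
  by move=> k' ?; apply: H; lia.
have [||||g2 e2] := IH k _ i.+1; try lia.
  move=> k' ?; rewrite (heightS_up bi).
  by have := gti k'; have -> : (i < k' <= k)%N; [lia|move=> /(_ isT); lia].
have F := flip_pair Ai k1N.
have gk : gap k.+1 = gap k - (a k)%:Z by apply: gapS_down.
have gi : gap i.+1 = gap i + (a k)%:Z by rewrite gapS_up // F.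
split; first by lia.
have Ek := arch_end_height Ai k1N; have Ei := heightS_up bi.
by move=> E1; have := e1; have := e2; lia.
Qed.

Lemma arch_gap i e k : arch i e -> (i < k <= e)%N -> gap i.+1 <= gap k.
Proof.
move=> A /andP[ik ke].
have bi : b i by case: A.
have [|||//] := @gap_mono i.+1 k; [lia|by have := arch_le A; lia|].
move=> k' ?; rewrite (heightS_up bi).
by have := arch_gt (k := k') A; have -> : (i < k' <= e)%N; [lia|move=> /(_ isT); lia].
Qed.

Lemma arch_gap_end i e : arch i e -> (e < N)%N -> gap e.+1 = gap i.
Proof.
move=> A eN; have bi : b i by case: A.
have lt_ie := arch_lt A; have le_eN := arch_le A.
have [|||_] := @gap_mono i.+1 e; [lia|lia| |].
  move=> k' ?; rewrite (heightS_up bi).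
  by have := arch_gt (k := k') A; have -> : (i < k' <= e)%N; [lia|move=> /(_ isT); lia].
rewrite (arch_end_height A eN) heightS_up // => /(_ erefl).
by rewrite (gapS_down (arch_down A eN)) -(flip_pair A eN) (gapS_up bi); lia.
Qed.

End Heights.

(** * Ballot strips *)

Definition strip_shape (D : {fset box}) (x : int) (f : nat -> int) (l l' : nat) : Prop :=
  [/\ forall j, (j < 2 * l + l')%N -> f j.+1 = f j + 1 \/ f j.+1 = f j - 1,
      forall j, (j <= 2 * l + l')%N -> f 0%N <= f j,
      f (2 * l + l')%N = f 0%N + l'%:Z
    & forall c : box, (c \in D) <-> exists2 j : nat, (j <= 2 * l + l')%N & c = (x + j%:Z, f j)].

Lemma ballot_step_nth (b : box) s j : path ballot_step b s -> (j < size s)%N ->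
  (nth b (b :: s) j.+1).1 = (nth b (b :: s) j).1 + 1 /\
  ((nth b (b :: s) j.+1).2 = (nth b (b :: s) j).2 + 1 \/
   (nth b (b :: s) j.+1).2 = (nth b (b :: s) j).2 - 1).
Proof.
move=> /(pathP b) H /H /= /andP[/eqP -> /orP[/eqP ->|/eqP ->]]; split=> //; by [left|right].
Qed.

Lemma ballot_stripE D l l' :
  ballot_strip D l l' <-> exists x f, strip_shape D x f l l'.
Proof.
split=> [[b [s [pth lst hge ->]]]|[x [f [st ge0 fend mem]]]].
  have col j : (j <= size s)%N -> (nth b (b :: s) j).1 = b.1 + j%:Z.
    elim: j => [|j IH] js /=; first by rewrite addr0.
    have [/= -> _] := ballot_step_nth pth js; rewrite IH; [lia|exact: ltnW].
  have sz : size s = (2 * l + l')%N.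
    have := col (size s) (leqnn _); rewrite -last_nth lst /=; lia.
  exists b.1, (fun j => (nth b (b :: s) j).2); split.
  - by move=> j js; have [_] := ballot_step_nth pth (eq_rect_r (fun n => (j < n)%N) js sz).
  - move=> -[//|j] js /=; by have /(all_nthP b) /(_ j) := hge; apply; rewrite sz.
  - by rewrite -sz -last_nth lst.
  move=> c; split.
    rewrite in_fset => /(nthP b) [j js <-]; exists j; first by rewrite -sz.
    by rewrite -col //; case: (nth _ _ _).
  case=> j js ->; rewrite in_fset; apply/(nthP b); exists j; rewrite /= ?sz //.
  by rewrite -col ?sz //; case: (nth _ _ _).
set n := (2 * l + l')%N in st ge0 fend mem.
pose g j : box := (x + j%:Z, f j).
have E j : (j <= n)%N -> nth (g 0%N) (g 0%N :: [seq g j0 | j0 <- iota 1 n]) j = g j.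
  case: j => // j jn; rewrite [LHS]/= (nth_map 0%N) ?size_iota //.
  by rewrite nth_iota ?add1n.
exists (g 0%N), [seq g j | j <- iota 1 n]; split.
- apply/(pathP (g 0%N)) => j; rewrite size_map size_iota => jn.
  rewrite E; last exact: ltnW.
  rewrite (nth_map 0%N) ?size_iota // nth_iota // add1n /ballot_step /=.
  apply/andP; split; first by apply/eqP; lia.
  by case: (st j jn) => ->; rewrite eqxx ?orbT.
- by rewrite (last_nth (g 0%N)) size_map size_iota E // /g /= addr0 fend.
- apply/allP => c /mapP [j]; rewrite mem_iota => jn -> /=; apply: ge0; lia.
apply/fsetP => c; apply/idP/idP.
  case/mem => j jn ->; rewrite in_fset inE; case: j jn => [|j] jn; first by rewrite /g addr0 eqxx.
  by apply/orP; right; apply/mapP; exists j.+1 => //; rewrite mem_iota; lia.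
rewrite in_fset inE => H; apply/mem.
by case/orP: H => [/eqP ->|/mapP[j]]; [exists 0%N|rewrite mem_iota => jn ->; exists j => //; lia].
Qed.

(* Leftmost and rightmost boxes determine the length. *)
Lemma strip_shape_uniq D x f l l' x1 f1 l1 l1' :
  strip_shape D x f l l' -> strip_shape D x1 f1 l1 l1' ->
  [/\ x = x1, l = l1 & l' = l1'].
Proof.
move=> [s1 g1 e1 m1] [s2 g2 e2 m2].
have [j1 j1n] : exists2 j : nat, (j <= 2 * l1 + l1')%N & (x + 0%:Z, f 0%N) = (x1 + j%:Z, f1 j).
  by apply/m2/m1; exists 0%N.
have [j2 j2n] : exists2 j : nat, (j <= 2 * l + l')%N & (x1 + 0%:Z, f1 0%N) = (x + j%:Z, f j).
  by apply/m1/m2; exists 0%N.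
have [j3 j3n] : exists2 j : nat, (j <= 2 * l1 + l1')%N &
    (x + (2 * l + l')%:Z, f (2 * l + l')%N) = (x1 + j%:Z, f1 j).
  by apply/m2/m1; exists (2 * l + l')%N.
have [j4 j4n] : exists2 j : nat, (j <= 2 * l + l')%N &
    (x1 + (2 * l1 + l1')%:Z, f1 (2 * l1 + l1')%N) = (x + j%:Z, f j).
  by apply/m1/m2; exists (2 * l1 + l1')%N.
move=> [a1 a2] [b1 b2] [c1 c2] [d1 d2].
have E1 : j1 = 0%N by lia.
have E2 : j3 = (2 * l1 + l1')%N by lia.
by subst j1 j3; split; lia.
Qed.

Lemma strip_lengthE D x f l l' :
  strip_shape D x f l l' -> strip_length D = (l, l').
Proof.
move=> sh; rewrite /strip_length.
have : ballot_strip D l l' by apply/ballot_stripE; exists x, f.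
case: xgetP => [[l1 l1'] _ /= /ballot_stripE [x1 [f1 sh1]] _|/(_ (l, l'))] //.
by have [_ -> ->] := strip_shape_uniq sh sh1.
Qed.

Lemma path_heightE N (w : word N) k : (k <= N)%N -> path_height w k = height (letter w) k.
Proof.
elim: k => [|k IH] kN; first by rewrite /path_height take0.
rewrite /= -IH; last exact: ltnW.
rewrite /path_height (take_nth false) ?size_tuple // -cats1 !count_cat /letter.
by case: (nth _ _ _) => /=; lia.
Qed.

Lemma height_bound w k : `|height w k| <= k%:Z.
Proof. by elim: k => //= k; case: (w k); lia. Qed.

Lemma height_parity w k : exists z : int, k%:Z + height w k = 2 * z.
Proof.
elim: k => [|k [z E]] /=; first by exists 0.
by case: (w k); [exists (z + 1)|exists z]; lia.
Qed.

(** * Configurations *)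

Section Region.
Variables (N m : nat) (alpha beta : word N).
Local Notation a := (letter alpha).
Local Notation b := (letter beta).
Local Notation ht := (height b).
Local Notation gp := (gap a b).
Local Notation rg := (region alpha beta).

(* The box of column [k] lying [d]-th from the top below the path [beta]. *)
Definition depth_box (k : nat) (d : int) : box := (k%:Z, ht k + 1 - 2 * d).

Lemma dbox_inj k d k1 d1 : depth_box k d = depth_box k1 d1 -> k = k1 /\ d = d1.
Proof. by case=> [E]; subst k1; lia. Qed.

(** In a column the boxes are two units apart, so a height difference of [2 * gp k] leaves room for
    exactly the depths 1 to [gp k]. *)
Lemma mem_region (c : box) :
  c \in rg <-> exists (k : nat) (d : int), [/\ (0 < k <= N)%N, 0 < d <= gp k & c = depth_box k d].
Proof.
have mem_lambda (w : word N) (k : nat) (y : int) : (0 < k <= N)%N ->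
    ((k%:Z, y) \in lambda_minus w) =
    [&& `|y| <= k%:Z, (2 %| k%:Z + y - 1)%Z & y < height (letter w) k].
  move=> kN; rewrite /lambda_minus !inE [X in _ && X]/= path_heightE; last by lia.
  apply/andP/idP => [[]//|H]; split=> //.
  apply/allpairsP; exists (k, absz (y + N%:Z)).
  case/and3P: H => ? ? ?; split; rewrite ?mem_iota; [simpl; lia|simpl; lia|].
  by rewrite [(k, _).1]/= [(k, _).2]/=; congr pair; lia.
rewrite /region inE; split.
  move=> /andP[nA B].
  have [k kN ck] : exists2 k : nat, (0 < k <= N)%N & c.1 = k%:Z.
    move: B; rewrite /lambda_minus !inE => /andP[/allpairsP [[i j] [/= + _ ->]] _].
    by rewrite mem_iota => ?; exists i => //; lia.
  move: nA B; rewrite [c]surjective_pairing ck !mem_lambda //.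
  move=> nA /and3P[B1 B2 B3]; have := height_gap a b k.
  have [z Ez] := height_parity b k.
  move: nA; rewrite B1 B2 /= -leNgt => nA E.
  have [q Eq] : exists q : int, k%:Z + c.2 - 1 = 2 * q.
    by case/dvdzP: B2 => q ->; exists q; lia.
  exists k, (z - q); split=> //; [lia|].
  by rewrite /depth_box; congr pair; lia.
move=> [k [d [kN dk ->]]]; have := height_gap a b k.
have := height_bound a k; have := height_bound b k.
have [z Ez] := height_parity b k => h1 h2 E.
rewrite /depth_box !mem_lambda //; apply/andP; split.
  by rewrite !negb_and -!leNgt; apply/orP; right; apply/orP; right; lia.
apply/and3P; split; [lia| |lia].
by apply/dvdzP; exists (z - d); lia.
Qed.

Lemma dbox_region k d : (depth_box k d \in rg) <-> (0 < k <= N)%N /\ 0 < d <= gp k.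
Proof.
split=> [/mem_region [k1 [d1 [? ? /dbox_inj[-> ->]]]]|[? ?]] //.
by apply/mem_region; exists k, d.
Qed.

Definition is_layer (D : {fset box}) (i e : nat) (n : int) : Prop :=
  arch N b i e /\
  forall c, c \in D <-> exists2 k : nat, (i < k <= e)%N & c = depth_box k n.

Lemma over_above D k d : depth_box k d \in D -> (k <= N)%N ->
  over_strip N D (depth_box k (d - 1)).
Proof.
move=> kD kN; split; first by rewrite /depth_box /=; lia.
by exists (depth_box k d) => //; rewrite !inE /box_above /depth_box /=; apply/orP; left;
  apply/eqP; congr pair; lia.
Qed.

Lemma over_NW D k d d1 : depth_box k.+1 d \in D -> (k <= N)%N ->
  ht k + 1 - 2 * d1 = ht k.+1 + 2 - 2 * d -> over_strip N D (depth_box k d1).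
Proof.
move=> kD kN E; split; first by rewrite /depth_box /=; lia.
exists (depth_box k.+1 d) => //; rewrite !inE /box_NW /depth_box.
by apply/orP; right; apply/orP; left; apply/eqP; congr pair; rewrite ?E //=; lia.
Qed.

Lemma over_NE D k d d1 : depth_box k d \in D -> (k < N)%N ->
  ht k.+1 + 1 - 2 * d1 = ht k + 2 - 2 * d -> over_strip N D (depth_box k.+1 d1).
Proof.
move=> kD kN E; split; first by rewrite /depth_box /=; lia.
exists (depth_box k d) => //; rewrite !inE /box_NE /depth_box.
by apply/orP; right; apply/orP; right; apply/eqP; congr pair; rewrite ?E //=; lia.
Qed.

Section Configuration.
Variable pi : {fset {fset box}}.
Hypothesis conf : confII m alpha beta pi.

Lemma conf_region D c : D \in pi -> c \in D -> c \in rg.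
Proof. by case: conf => -[<- _] _ _ _ _ Dpi cD; apply/bigfcupP; exists D; rewrite ?Dpi. Qed.

Lemma conf_cover c : c \in rg -> exists2 D, D \in pi & c \in D.
Proof.
by case: conf => -[<- _] _ _ _ _ /bigfcupP [D /andP[Dpi _] cD]; exists D.
Qed.

Lemma conf_disjoint D D' c : D \in pi -> D' \in pi -> c \in D -> c \in D' -> D = D'.
Proof.
case: conf => -[_ /trivIfsetP tI] _ _ _ _ Dpi D'pi cD cD'.
apply/eqP; apply/negPn/negP => ne; have := tI D D' Dpi D'pi ne.
by move=> /fdisjointP /(_ c cD); rewrite cD'.
Qed.

Lemma box_in_strip D (c : box) : D \in pi -> c \in D ->
  exists (k : nat) (d : int), [/\ (0 < k <= N)%N, 0 < d <= gp k & c = depth_box k d].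
Proof. by move=> Dpi cD; apply/mem_region; apply: conf_region cD. Qed.

Lemma strip_column D k d d1 : D \in pi -> depth_box k d \in D -> depth_box k d1 \in D -> d = d1.
Proof.
case: conf => _ cs _ _ _ Dpi; have [l [l' /ballot_stripE [x [f [_ _ _ mem]]]]] := cs D Dpi.
move=> /mem [j1 _ [E1 E2]] /mem [j2 _ [E3 E4]].
by have E : j1 = j2 by [lia]; subst j2; lia.
Qed.

(** The columns of [D] form an arch: a wrong letter of [beta] at either end would put an NW or NE
    box of the same depth [n] into the region outside [D], against the last hypothesis. *)
Lemma layer_of_depth D n : D \in pi -> 0 < n ->
  (forall k d, depth_box k d \in D -> d = n) ->
  (forall c, over_strip N D c -> c \in rg -> c \notin D -> exists k, c = depth_box k (n - 1)) ->
  exists i e, is_layer D i e n.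
Proof.
move=> Dpi n0 dn ov.
have [_ cs _ _ _] := conf; have [l [l' /ballot_stripE [x [f sh]]]] := cs D Dpi.
have [_ _ _ mem0] := sh.
have [k0 [d0 [k0N _ [xk0 _]]]] :
    exists (k : nat) (d : int), [/\ (0 < k <= N)%N, 0 < d <= gp k & (x + 0%:Z,
      f 0%N) = depth_box k d].
  by apply: box_in_strip Dpi _; apply/mem0; exists 0%N.
set i := k0.-1; set e := (i.+1 + 2 * l + l')%N.
have ix : i.+1%:Z = x by lia.
have Dn c : c \in D <-> exists2 k : nat, (i < k <= e)%N & c = depth_box k n.
  split=> [cD|[k1 k1e ->]].
    have [k1 [d1 [k1N _ E]]] := box_in_strip Dpi cD.
    have d1n : d1 = n by apply: (dn k1); rewrite -E.
    by subst d1; exists k1 => //; have /mem0 [j jn] := cD; rewrite E => -[]; lia.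
  have D1 : (x + (k1 - k0)%N%:Z, f (k1 - k0)%N) \in D.
    by apply/mem0; exists (k1 - k0)%N => //; lia.
  have [k2 [d2 [k2N _ E]]] := box_in_strip Dpi D1.
  have E2 : k2 = k1 by case: E; lia.
  by move: D1; rewrite E => D1; have E3 := dn _ _ D1; rewrite -E2 -E3.
exists i, e; split=> //.
have inD k : (i < k <= e)%N -> depth_box k n \in D by move=> ke; apply/Dn; exists k.
have inR k : (i < k <= e)%N -> (0 < k <= N)%N /\ 0 < n <= gp k.
  by move=> ke; apply/dbox_region; apply: conf_region (inD k ke).
have notD k : ~~ (i < k <= e)%N -> depth_box k n \notin D.
  by move=> ke; apply/negP => /Dn [k1 k1e /dbox_inj[E _]]; rewrite E k1e in ke.
case: (sh) => st ge0 fend mem.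
have fE j : (j <= 2 * l + l')%N -> f j = ht (i.+1 + j)%N + 1 - 2 * n.
  move=> jn; have : (x + j%:Z, f j) \in D by apply/mem; exists j.
  move=> /Dn [k ke [E1 E2]]; have Ek : k = (i.+1 + j)%N by lia.
  by rewrite E2 Ek.
have iN : (0 < i.+1 <= N)%N by case: (inR i.+1) => //; lia.
have eN : (e <= N)%N by case: (inR e) => //; lia.
have hge k : (i < k <= e)%N -> ht i.+1 <= ht k.
  move=> ke; have kn : (k - i.+1 <= 2 * l + l')%N by lia.
  by have := ge0 _ kn; rewrite fE // fE // addn0 subnKC; lia.
(* If letter [i] were a 1, the NW box of the first box would have depth [n] too. It lies in the
   region, as the gap does not grow at a 1; column 0 is excluded by its zero gap. *)
have bi : b i.
  apply: contraT => nbi; have gi := gapS_down a nbi; have hi := heightS_down nbi.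
  have [|_] := inR i.+1; first by lia.
  move=> gi1; have := @over_NW D i n n (inD _ _); rewrite hi.
  have le_iN : (i <= N)%N by lia.
  move=> H; have {H}/ov H : over_strip N D (depth_box i n) by apply: H => //; lia.
  have := H; case=> [||k /dbox_inj]; last by lia.
    apply/dbox_region; split; last by lia.
    have [E|] := eqVneq i 0%N; last by lia.
    by move: gi1 gi; rewrite E /=; case: (a 0%N); lia.
  by apply: notD; lia.
have hi := heightS_up bi.
have He : (e < N)%N -> ht e.+1 = ht i.
  move=> lt_eN.
  have nbe : ~~ b e.
    apply/negP => be; have ge := gapS_up a be; have he := heightS_up be.
    have [|_ gi1] := inR e; first by lia.
    have := @over_NE D e n n (inD e _) lt_eN; rewrite he.
    move=> H; have {H}/ov H : over_strip N D (depth_box e.+1 n) by apply: H => //; lia.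
    have := H; case=> [||k /dbox_inj]; last by lia.
      by apply/dbox_region; split; lia.
    by apply: notD; lia.
  (* By Rule 0 a strip that stops before column [N] has [l' = 0], so it ends at its initial
     height. *)
  have l'0 : l' = 0%N.
    apply/eqP; rewrite -leqn0 leqNgt; apply/negP => l'1.
    case: conf => _ _ r0 _ _; have := r0 D l l' Dpi.
    have bs : ballot_strip D l l' by apply/ballot_stripE; exists x, f.
    move=> /(_ bs l'1 (depth_box e n)) H.
    have : (depth_box e n).1 = N%:Z; last by rewrite /depth_box /=; lia.
    apply: H; first by apply: inD; lia.
    by move=> c /Dn [k ke ->]; rewrite /depth_box /=; lia.
  have := fend; rewrite fE // fE // addn0 (_ : i.+1 + (2 * l + l') = e)%N; last by lia.
  by rewrite (heightS_down nbe) l'0; lia.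
split=> //; first by lia.
by move=> k ke; have := hge k ke; lia.
Qed.

(* By Rule IIa, a box of the strip [D'] just above a box of depth n + 1 of [D] *)
(* forces all boxes just above [D] into [D'], which has constant depth n.      *)
Lemma conf_layer n D k : D \in pi -> depth_box k n.+1%:Z \in D ->
  (exists i e, is_layer D i e n.+1%:Z) /\
   ((0 < n)%N -> exists2 D', D' \in pi & (exists i' e', is_layer D' i' e' n%:Z) /\
        forall c, over_strip N D c -> c \in D \/ c \in D').
Proof.
elim: n D k => [|n IH] D k Dpi kD; have [_ _ _ r2a _] := conf.
  have [kN dk] := (dbox_region k 1).1 (conf_region Dpi kD).
  split=> //.
  (* Depth 1: by Rule IIa another strip above [D] would force the position of depth 0 above [D] into
     one of the two strips, yet it lies outside the region. *)
  have nov c : over_strip N D c -> c \in rg -> c \in D.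
    move=> oc cR; apply: contraT => cnD; have [D' D'pi cD'] := conf_cover cR.
    have neD : D' != D by apply/negP => /eqP E; rewrite -E cD' in cnD.
    have kN1 : (k <= N)%N by lia.
    have := r2a D D' Dpi D'pi neD (ex_intro2 _ _ c cD' oc) (depth_box k (1 - 1))
      (over_above kD kN1).
    by rewrite in_fsetU => /orP[/(conf_region Dpi)|/(conf_region D'pi)] /dbox_region [_]; lia.
  apply: layer_of_depth => // [k1 d k1D|c oc cR]; last by rewrite nov.
  have [k1N d1] := (dbox_region k1 d).1 (conf_region Dpi k1D).
  have [//|ne] := eqVneq d 1.
  have k1N1 : (k1 <= N)%N by lia.
  have /(strip_column Dpi k1D) : depth_box k1 (d - 1) \in D; last by lia.
  by apply: nov; [apply: over_above|apply/dbox_region; split; lia].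
have [kN dk] := (dbox_region k n.+2).1 (conf_region Dpi kD).
have [D' D'pi kD'] : exists2 D', D' \in pi & depth_box k n.+1 \in D'.
  by apply: conf_cover; apply/dbox_region; split; lia.
have neD : D' != D.
  by apply/negP => /eqP E; move: kD'; rewrite E => /(strip_column Dpi kD); lia.
have [[i' [e' lD']] _] := IH _ _ D'pi kD'.
have kN1 : (k <= N)%N by lia.
have ov c : over_strip N D c -> c \in D \/ c \in D'.
  move=> oc; apply/orP; rewrite -in_fsetU.
  apply: (r2a D D' Dpi D'pi neD _ c oc); exists (depth_box k n.+1) => //.
  by rewrite (_ : n.+1%:Z = n.+2%:Z - 1); [apply: over_above|lia].
split; last by move=> _; exists D' => //; split=> //; exists i', e'.
have [_ memD'] := lD'.
apply: layer_of_depth => // [k1 d k1D|c oc cR cnD].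
  have [k1N d1] := (dbox_region k1 d).1 (conf_region Dpi k1D).
  have k1N1 : (k1 <= N)%N by lia.
  have [/(strip_column Dpi k1D)|/memD' [k2 _ /dbox_inj]] := ov _ (over_above k1D k1N1); lia.
have [cD|/memD' [k2 _ ->]] := ov _ oc; first by rewrite cD in cnD.
by exists k2; congr depth_box; lia.
Qed.

End Configuration.
End Region.

Section Configurations.
Variables (N m : nat) (alpha beta : word N).
Local Notation a := (letter alpha).
Local Notation b := (letter beta).
Local Notation ht := (height b).
Local Notation gp := (gap a b).
Local Notation rg := (region alpha beta).
Local Notation dbox := (depth_box beta).
Local Notation is_layer := (is_layer beta).

(** Consecutive unpaired 2's, [i'] being the left one: unpaired 2's start at successive heights, so
    a difference of 1 leaves none between them. *)
Definition linked (i i' : nat) : Prop :=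
  [/\ arch N b i N, arch N b i' N, (i' < i)%N & ht i = ht i' + 1].

(* In terms of archs: the letters in which [alpha] and [beta] differ form 21   *)
(* pairs, unpaired 2's with a mark, and 22-pairs.                              *)
Definition flip_compatible : Prop :=
  [/\ forall i e, arch N b i e -> (e < N)%N -> (~~ a i) = a e,
      forall j, ~~ b j -> a j -> (j < N)%N -> exists i, arch N b i j
    & forall i (l' : nat), arch N b i N -> ~~ a i -> l'%:Z = ht N - ht i.+1 -> (m <= l')%N ->
        exists2 i', ~~ a i' & if odd (l' - m) then linked i' i else linked i i'].

(** At constant depth the strip is a translate of a piece of the path. Thus [l'] is 0 for a paired 2
    and counts the unpaired 2's to the right of [i] when [e = N]. *)
Lemma layer_shape (D : {fset box}) i e n : is_layer D i e n -> exists l l' : nat,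
  [/\ strip_shape D i.+1 (fun j => ht (i.+1 + j)%N + 1 - 2 * n) l l',
      l'%:Z = ht e - ht i.+1 & (2 * l + l')%N = (e - i.+1)%N].
Proof.
move=> [A mem]; have lt := arch_lt A.
have [z Ez] := height_parity b e; have [z1 Ez1] := height_parity b i.+1.
have hi : ht i.+1 = ht i + 1 by apply: heightS_up; case: A.
have ge : ht i.+1 <= ht e by have := arch_gt (k := e) A; rewrite lt leqnn => /(_ isT); lia.
have le : ht e - ht i.+1 <= (e - i.+1)%N%:Z.
  have H j : ht (i.+1 + j)%N - ht i.+1 <= j%:Z.
    elim: j => [|j IH]; first by rewrite addn0 subrr.
    by rewrite addnS; have := heightS b (i.+1 + j); case: (b (i.+1 + j)%N); lia.
  by have := H (e - i.+1)%N; rewrite subnKC.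
have [l' El'] : exists l' : nat, l'%:Z = ht e - ht i.+1 by exists (absz (ht e - ht i.+1)); lia.
have [l El] : exists l : nat, (2 * l + l')%N = (e - i.+1)%N.
  by exists (absz (z - z1 - l'%:Z)%R); lia.
exists l, l'; split=> //; split.
- move=> j _; rewrite addnS; have := heightS b (i.+1 + j).
  by case: (b (i.+1 + j)%N); [left|right]; lia.
- move=> j jn; rewrite addn0.
  have kn : (i < i.+1 + j <= e)%N by lia.
  by have := arch_gt A kn; lia.
- by rewrite El addn0 subnKC //; lia.
move=> c; split.
  move=> /mem [k ke ->]; exists (k - i.+1)%N; first by lia.
  by rewrite subnKC; [rewrite /depth_box; congr pair; lia|lia].
move=> [j jn ->]; apply/mem; exists (i.+1 + j)%N; first by lia.
by rewrite /depth_box; congr pair; lia.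
Qed.

Lemma layer_unpaired (D : {fset box}) i e n x f l l' :
  is_layer D i e n -> strip_shape D x f l l' -> (0 < l')%N ->
  e = N /\ l'%:Z = ht N - ht i.+1.
Proof.
move=> lD sh l'0; have [l1 [l1' [sh1 E1 E2]]] := layer_shape lD.
have [_ El El'] := strip_shape_uniq sh sh1; subst l1 l1'.
have [A _] := lD; have hi : ht i.+1 = ht i + 1 by apply: heightS_up; case: A.
have eN : e = N.
  have := arch_le A; rewrite leq_eqVlt => /orP[/eqP //|eN].
  by have := arch_end_height A eN; lia.
by split=> //; have := E1; rewrite eN.
Qed.

Lemma layer_start (D : {fset box}) i e d : is_layer D i e d -> dbox i.+1 d \in D.
Proof. by move=> [A mem]; apply/mem; exists i.+1 => //; have := arch_lt A; lia. Qed.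

Lemma layer_end (D : {fset box}) i e d : is_layer D i e d -> dbox e d \in D.
Proof. by move=> [A mem]; apply/mem; exists e => //; have := arch_lt A; lia. Qed.

Lemma layer_mem (D : {fset box}) i e d k d1 : is_layer D i e d ->
  dbox k d1 \in D <-> (i < k <= e)%N /\ d1 = d.
Proof.
move=> [A mem]; split=> [/mem [k1 ke /dbox_inj [-> ->]]//|[ke ->]].
by apply/mem; exists k.
Qed.

Lemma layer_uniq (D : {fset box}) i e d i' e' d' :
  is_layer D i e d -> is_layer D i' e' d' -> [/\ i = i', e = e' & d = d'].
Proof.
move=> l1 l2; have := layer_start l1; have := layer_start l2.
move=> /(layer_mem _ _ l1) [h1 E] /(layer_mem _ _ l2) [h2 _].
have Ei : i = i' by lia.
by split=> //; subst i'; case: l1 l2 => A1 _ [A2 _]; apply: arch_uniq A1 A2.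
Qed.

Definition arch_end (i : nat) : nat := xget 0%N [set e | arch N b i e]%classic.

(** The depth [gp i.+1] is that of the lowest box in the first column of the strip. *)
Definition arch_strip (i : nat) : {fset box} :=
  [fset dbox k (gp i.+1) | k in iota i.+1 (arch_end i - i)]%fset.

Lemma arch_endE i e : arch N b i e -> arch_end i = e.
Proof.
move=> A; rewrite /arch_end; case: xgetP => [e' _ /= A'|/(_ e)] //.
exact: arch_uniq A' A.
Qed.

Lemma arch_strip_layer i e : arch N b i e -> is_layer (arch_strip i) i e (gp i.+1).
Proof.
move=> A; split=> // c; rewrite /arch_strip (arch_endE A); have lt := arch_lt A; split.
  by case/imfsetP => k /=; rewrite mem_iota => ke ->; exists k => //; lia.
by move=> [k ke ->]; apply/imfsetP; exists k => //=; rewrite mem_iota; lia.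
Qed.

Definition flipped2 : seq nat := [seq i <- iota 0 N | b i && ~~ a i].

Definition flip_strips : {fset {fset box}} := [fset arch_strip i | i in flipped2]%fset.

Lemma flipped2P i : reflect [/\ (i < N)%N, b i & ~~ a i] (i \in flipped2).
Proof. by rewrite mem_filter mem_iota /= add0n; apply: (iffP andP) => [[/andP[]]|[-> -> ->]]. Qed.

Hypothesis m_gt0 : (0 < m)%N.
Hypothesis le_ab : bruhat alpha beta.

Lemma gap_ge0 k : (k <= N)%N -> 0 <= gp k.
Proof.
move=> kN; have := height_gap a b k; rewrite -!path_heightE //.
have /forallP /(_ (Ordinal (n := N.+1) (m := k) kN)) /= := le_ab.
have := count_predC (pred1 false) (take k alpha); have := count_predC (pred1 false) (take k beta).
rewrite !size_takel ?size_tuple // /path_height.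
have C (s : seq bool) : count (predC (pred1 false)) s = count_mem true s by apply: eq_count; case.
rewrite !C; move: (count_mem false (take k beta)) (count_mem true (take k beta))
  (count_mem false (take k alpha)) (count_mem true (take k alpha)) => x1 x2 x3 x4. lia.
Qed.

(** * At most one configuration, and only if the flips are compatible *)

Section Unique.
Variable pi : {fset {fset box}}.
Hypothesis conf : confII m alpha beta pi.

Lemma conf_layer_box D k d : D \in pi -> dbox k d \in D -> exists i e, is_layer D i e d.
Proof.
move=> Dpi kD; have [_ d0] := (dbox_region alpha beta k d).1 (conf_region conf Dpi kD).
case: d d0 kD => [[|n]|n] d0 kD; [lia| |lia].
by have [[i [e lD]] _] := conf_layer conf Dpi kD; exists i, e.
Qed.

(** Rule IIa puts all boxes just above [D] into one strip of depth [d - 1]. The NW box of the first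
    column gives [i' < i], the NE box of the last one [e < e']. *)
Lemma conf_parent D i e d : D \in pi -> is_layer D i e d -> 1 < d ->
  exists D' i' e', [/\ D' \in pi, is_layer D' i' e' (d - 1), (i' < i)%N, (e <= e')%N
    & (e < N)%N -> (e < e')%N].
Proof.
case: d => [[|[|n]]|n] Dpi lD dgt; try lia.
have sD := layer_start lD; have eD := layer_end lD.
have [_ /(_ isT) [D' D'pi [[i' [e' lD']] ov]]] := conf_layer conf Dpi sD.
have [A _] := lD; have iN := arch_lt A; have eN := arch_le A.
have E : n.+1%:Z = n.+2%:Z - 1 by lia.
have inD' k : over_strip N D (dbox k n.+1) -> (i' < k <= e')%N.
  move=> /ov [/(layer_mem _ _ lD)|/(layer_mem _ _ lD')] []; lia.
exists D', i', e'; split=> //; rewrite -?E //.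
- have /inD' : over_strip N D (dbox i n.+1); last by lia.
  apply: (over_NW sD); first by lia.
  by rewrite (@heightS_up b i); [lia|case: A].
- have /inD' : over_strip N D (dbox e n.+1); last by lia.
  by rewrite E; apply: over_above.
move=> lt_eN; have /inD' : over_strip N D (dbox e.+1 n.+1); last by lia.
apply: (over_NE eD lt_eN).
by rewrite (heightS_down (arch_down A lt_eN)); lia.
Qed.

(** The strip of the lower box has a parent by [conf_parent], and disjointness identifies this
    parent with [D]. *)
Lemma conf_below D i e d k : D \in pi -> is_layer D i e d -> (i < k <= e)%N ->
  dbox k (d + 1) \in rg -> exists i' e', [/\ arch N b i' e', (i < i' < k)%N, (k <= e' <= e)%N
    & (e' < N)%N -> (e' < e)%N].
Proof.
move=> Dpi lD ke kR.
have [D1 D1pi kD1] := conf_cover conf kR; have [i1 [e1 lD1]] := conf_layer_box D1pi kD1.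
have d0 : 0 < d.
  have kD : dbox k d \in D by apply/(layer_mem _ _ lD).
  by have [_] := (dbox_region alpha beta k d).1 (conf_region conf Dpi kD); lia.
have d1 : 1 < d + 1 by lia.
have [D2 [i2 [e2 [D2pi lD2 i21 e12 e12']]]] := conf_parent D1pi lD1 d1.
have := (layer_mem _ _ lD1).1 kD1 => -[ke1 _].
have E : D2 = D.
  apply: (conf_disjoint conf D2pi Dpi (c := dbox k d)); last by apply/(layer_mem _ _ lD).
  by apply/(layer_mem _ _ lD2); split; lia.
subst D2; have [E1 E2 _] := layer_uniq lD lD2; subst i2 e2.
by exists i1, e1; split; [case: lD1|lia|lia|].
Qed.

(** Strips beneath [D] start further right, so [D] is lowest in its first column. If [alpha] had a 2
    at [i], column [i] would have a box of the same depth, whose strip cannot end at a 2 of [beta]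
    and would run into [D]. *)
Lemma conf_depth D i e d : D \in pi -> is_layer D i e d -> d = gp i.+1 /\ ~~ a i.
Proof.
move=> Dpi lD; have sD := layer_start lD; have [A _] := lD.
have [iN d0] := (dbox_region alpha beta _ _).1 (conf_region conf Dpi sD).
have dE : d = gp i.+1.
  apply/eqP; rewrite eq_le; apply/andP; split; first by lia.
  rewrite leNgt; apply/negP => lt.
  have ke : (i < i.+1 <= e)%N by have := arch_lt A; lia.
  have R : dbox i.+1 (d + 1) \in rg by apply/dbox_region; split; lia.
  by have [i' [e' [_ lt1 _ _]]] := conf_below Dpi lD ke R; lia.
split=> //; apply/negP => ai.
have bi : b i by case: A.
have gi : gp i = d by rewrite dE (gapS_up _ bi) ai; lia.
have i0 : (0 < i)%N by case: (i) gi => [|//] /=; lia.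
have R : dbox i d \in rg by apply/dbox_region; split; lia.
have [E Epi iE] := conf_cover conf R; have [i1 [e1 lE]] := conf_layer_box Epi iE.
have [ie _] := (layer_mem _ _ lE).1 iE.
have [e1i|ne] := eqVneq e1 i.
  have [A1 _] := lE; subst e1; have := arch_down A1; rewrite bi.
  by have -> : (i < N)%N; [lia|move=> /(_ isT)].
have sE : dbox i.+1 d \in E by apply/(layer_mem _ _ lE); split; lia.
have ED := conf_disjoint conf Epi Dpi sE sD; subst E.
by have [] := (layer_mem _ _ lD).1 iE; lia.
Qed.

(** At a flipped 2 the gap grows by one, so the lowest box of column [i.+1] has no companion of its
    depth in column [i], and its strip starts there. *)
Lemma conf_start i : (i < N)%N -> b i -> ~~ a i ->
  exists2 D, D \in pi & exists e, is_layer D i e (gp i.+1).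
Proof.
move=> iN bi ai; have gi := gapS_up a bi; have g0 := gap_ge0 (ltnW iN).
rewrite ai in gi.
have R : dbox i.+1 (gp i.+1) \in rg by apply/dbox_region; split; lia.
have [D Dpi sD] := conf_cover conf R; have [i1 [e1 lD]] := conf_layer_box Dpi sD.
have [ie _] := (layer_mem _ _ lD).1 sD.
exists D => //; exists e1; have [E|ne] := eqVneq i1 i; first by rewrite -{1}E.
have /(conf_region conf Dpi) /dbox_region [] : dbox i (gp i.+1) \in D; last by lia.
by apply/(layer_mem _ _ lD); split; lia.
Qed.

Lemma conf_stop j : (j < N)%N -> ~~ b j -> a j ->
  exists2 D, D \in pi & exists i, is_layer D i j (gp j).
Proof.
move=> jN bj aj; have gj := gapS_down a bj; have g0 := gap_ge0 jN.
rewrite aj in gj.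
have j0 : (0 < j)%N by case: (j) gj g0 => [|//] /=; case: (b 0%N) (a 0%N) => [] []; lia.
have R : dbox j (gp j) \in rg by apply/dbox_region; split; lia.
have [D Dpi sD] := conf_cover conf R; have [i1 [e1 lD]] := conf_layer_box Dpi sD.
have [ie _] := (layer_mem _ _ lD).1 sD.
exists D => //; exists i1; have [E|ne] := eqVneq e1 j; first by rewrite -{1}E.
have /(conf_region conf Dpi) /dbox_region [] : dbox j.+1 (gp j) \in D; last by lia.
by apply/(layer_mem _ _ lD); split; lia.
Qed.

Lemma conf_compatible : flip_compatible.
Proof.
split.
- move=> i e A eN; have bi : b i by case: (A).
  have be := arch_down A eN.
  have iN : (i < N)%N by have := arch_lt A; lia.
  apply/idP/idP => [ai|ae]; last first.
    have [D Dpi [i1 lD]] := conf_stop eN be ae; have [A1 _] := lD.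
    by have Ei := arch_inj A A1 eN; subst i1; have [] := conf_depth Dpi lD.
  have [D Dpi [e1 lD]] := conf_start iN bi ai; have [A1 _] := lD.
  have Ee := arch_uniq A A1; subst e1; apply: contraT => ae.
  have eD := layer_end lD.
  have [eNN d0] := (dbox_region alpha beta _ _).1 (conf_region conf Dpi eD).
  (* Strips beneath [D] stop strictly earlier, so [D] is also lowest in its last column. *)
  have ge : gp e = gp i.+1.
    apply/eqP; rewrite eq_le; apply/andP; split; last by lia.
    rewrite leNgt; apply/negP => lt.
    have ke : (i < e <= e)%N by have := arch_lt A; lia.
    have R : dbox e (gp i.+1 + 1) \in rg by apply/dbox_region; split; lia.
    by have [i' [e' [_ _ lt1 lt2]]] := conf_below Dpi lD ke R; lia.
  (* An unflipped 1 at [e] would keep the gap. The box of this depth in column [e.+1] would then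
     belong to a strip that cannot start at the 1 and so meets [D] in column [e]. *)
  have ge1 : gp e.+1 = gp e by rewrite (gapS_down a be) (negbTE ae) subr0.
  have R : dbox e.+1 (gp i.+1) \in rg by apply/dbox_region; split; lia.
  have [E Epi sE] := conf_cover conf R; have [i1 [e1 lE]] := conf_layer_box Epi sE.
  have [ie _] := (layer_mem _ _ lE).1 sE.
  have [Ei|ne] := eqVneq i1 e; first by subst i1; case: lE => -[be1]; rewrite be1 in be.
  have eE : dbox e (gp i.+1) \in E by apply/(layer_mem _ _ lE); split; lia.
  have ED := conf_disjoint conf Epi Dpi eE eD; subst E.
  by have [] := (layer_mem _ _ lD).1 sE; lia.
- by move=> j bj aj jN; have [D _ [i [A _]]] := conf_stop jN bj aj; exists i.
move=> i l' A ai El' ml'.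
have [bi] : b i /\ (i < N)%N by case: (A) => -> /andP[].
move=> iN; have [D Dpi [e lD]] := conf_start iN bi ai; have [A1 _] := lD.
have Ee := arch_uniq A A1; subst e.
have [l [l1' [sh E1 E2]]] := layer_shape lD.
have El : l1' = l' by lia.
subst l1'; have [_ cs _ _ r2b] := conf.
have bs : ballot_strip D l l' by apply/ballot_stripE; eexists; eexists; exact: sh.
have hi := heightS_up bi.
(* A strip with [l1' > 0] starts at a flipped unpaired 2 having [l1'] unpaired 2's to its right;
   this turns Rule IIb into a statement on neighbouring unpaired 2's. *)
have nb (D' : {fset box}) l1 l1' (c : box) : D' \in pi -> ballot_strip D' l1 l1' -> (0 < l1')%N ->
    c \in D' -> exists i', [/\ ~~ a i', arch N b i' N & l1'%:Z = ht N - ht i' - 1].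
  move=> D'pi /ballot_stripE [x [f sh']] l1'0 cD'.
  have [k [d [_ _ E]]] := box_in_strip conf D'pi cD'; rewrite {}E in cD'.
  have [i' [e' lD']] := conf_layer_box D'pi cD'.
  have [Ee El] := layer_unpaired lD' sh' l1'0; subst e'.
  have [_ ai'] := conf_depth D'pi lD'; exists i'; split=> //; first by case: lD'.
  by rewrite El (@heightS_up b i'); [lia|case: lD' => -[]].
have := r2b D l l' Dpi bs ml'; case od: (odd (l' - m)) => /=.
  have l'm : (0 < l' - m)%N by case: (l' - m)%N od.
  move=> [D' [l'' [D'pi bs' _ [c cD cD']]]].
  have [|i' [ai' A' El]] := nb _ _ _ _ D'pi bs' _ cD'; first by lia.
  by exists i' => //; split=> //; [apply: (arch_order A A')|]; lia.
move=> [D' [l'' [D'pi bs' _ [c cD cD']]]].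
have [|i' [ai' A' El]] := nb _ _ _ _ D'pi bs' _ cD'; first by lia.
by exists i' => //; split=> //; [apply: (arch_order A' A)|]; lia.
Qed.

End Unique.

Lemma flip_stripsP D : D \in flip_strips <-> exists i e,
  [/\ ~~ a i, arch N b i e, is_layer D i e (gp i.+1) & D = arch_strip i].
Proof.
split=> [/imfsetP /= [i /flipped2P [iN bi ai] ->]|[i [e [ai A lD E]]]].
  by have [e A] := arch_ex bi iN; exists i, e; split=> //; apply: arch_strip_layer.
apply/imfsetP; exists i => //=; apply/flipped2P.
by case: (A) => bi ? _ _; split=> //; lia.
Qed.

Lemma conf_flip_strips pi : confII m alpha beta pi -> pi = flip_strips.
Proof.
move=> conf.
have eqD (D D' : {fset box}) i e n : is_layer D i e n -> is_layer D' i e n -> D = D'.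
  by move=> [_ m1] [_ m2]; apply/fsetP => c; apply/idP/idP => [/m1 /m2|/m2 /m1].
apply/fsetP => D; apply/idP/idP => [Dpi|/flip_stripsP [i [e [ai A lD _]]]].
  have [_ cs _ _ _] := conf; have [l [l' /ballot_stripE [x [f [_ _ _ mem0]]]]] := cs D Dpi.
  have [c cD] : exists c, c \in D by exists (x + 0%N%:Z, f 0%N); apply/mem0; exists 0%N.
  have [k [d [_ _ E]]] := box_in_strip conf Dpi cD; rewrite {}E in cD.
  have [i [e lD]] := conf_layer_box conf Dpi cD.
  have [E ai] := conf_depth conf Dpi lD; subst d; have [A _] := lD.
  by apply/flip_stripsP; exists i, e; split=> //; apply: eqD lD (arch_strip_layer A).
have [bi iN] : b i /\ (i < N)%N by case: (A) => ? ? _ _; split=> //; lia.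
have [D' D'pi [e' lD']] := conf_start conf iN bi ai.
have E : e = e' by case: lD' => A' _; apply: arch_uniq A A'.
by subst e'; rewrite (eqD _ _ _ _ _ lD lD').
Qed.

(** * Compatible flips give a configuration *)

Section Exists.
Hypothesis compat : flip_compatible.

Let flip_pair i e : arch N b i e -> (e < N)%N -> (~~ a i) = a e.
Proof. by case: compat => H _ _; apply: H. Qed.

(** The start is the last [i < k] whose column has fewer than [d] boxes. Its arch reaches [k]: after
    an arch that ended earlier, [arch_gap_end] would bring the gap back to [gp i < d]. *)
Lemma region_strip (k : nat) (d : int) : (0 < k <= N)%N -> 0 < d <= gp k ->
  exists i e, [/\ ~~ a i, arch N b i e, gp i.+1 = d & (i < k <= e)%N].
Proof.
move=> kN dk.
pose p i := (i < k)%N && (gp i < d).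
have [i /andP[ik gi] maxi] : exists2 i, p i & forall i', p i' -> (i' <= i)%N.
  have p0 : p 0%N by rewrite /p /=; lia.
  have ub i : p i -> (i <= k)%N by case/andP; lia.
  by have [i pi maxi] := ex_maxnP (ex_intro (fun i => p i) _ p0) ub; exists i.
have ge i' : (i < i' <= k)%N -> d <= gp i'.
  move=> /andP[ii' i'k]; have [->|ne] := eqVneq i' k; first by lia.
  rewrite leNgt; apply/negP => lt.
  by have := maxi i'; rewrite /p lt andbT; lia.
have gi1 : d <= gp i.+1 by apply: ge; lia.
have bi : b i.
  by apply: contraT => nbi; have := gapS_down a nbi; lia.
have ai : ~~ a i by apply/negP => ai; have := gapS_up a bi; rewrite ai; lia.
have gE : gp i.+1 = d by have := gapS_up a bi; lia.
have iN : (i < N)%N by lia.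
have [e A] := arch_ex bi iN; exists i, e; split=> //.
rewrite ik leqNgt; apply/negP => ek.
have eN : (e < N)%N by lia.
have := arch_gap_end flip_pair A eN; have := ge e.+1.
by have := arch_lt A; lia.
Qed.

(** If [i < i'], then [gp i.+1 <= gp i'] by [arch_gap], and the flipped 2 at [i'] raises the gap
    once more, so the depths differ. *)
Lemma strip_disjoint i e i' e' k : arch N b i e -> arch N b i' e' -> ~~ a i -> ~~ a i' ->
  (i < k <= e)%N -> (i' < k <= e')%N -> gp i.+1 = gp i'.+1 -> i = i'.
Proof.
wlog le_ii' : i e i' e' / (i <= i')%N.
  move=> IH A A' ai ai' h h' E; case/orP: (leq_total i i') => le.
    exact: (IH i e i' e').
  by symmetry; apply: (IH i' e' i e).
move=> A A' ai ai' h h' E; apply/eqP; rewrite eqn_leq le_ii' leqNgt; apply/negP => lt.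
have := arch_gap flip_pair A (k := i'); have := @gapS_up a b i'.
by case: (A') => -> _ _ _ /(_ isT); rewrite ai' E; lia.
Qed.

(** The strip wanted is the one through the lowest box of column [i]; it contains the arch of [i]
    because archs do not cross. *)
Lemma flip_strips_over i e : arch N b i e -> ~~ a i -> 1 < gp i.+1 ->
  exists i' e', [/\ arch N b i' e', ~~ a i', gp i'.+1 = gp i.+1 - 1, (i' < i)%N
     & (e <= e')%N /\ ((e < N)%N -> (e < e')%N)].
Proof.
move=> A ai gt; have iN := arch_le A; have lt := arch_lt A.
have bi : b i by case: (A).
have gi := gapS_up a bi; rewrite ai in gi.
have i0 : (0 < i)%N by case: (i) gi gt => [|//] /=; lia.
have [||i' [e' [ai' A' gi' ie']]] := @region_strip i (gp i.+1 - 1); [lia|lia|].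
have lt' : (i' < i)%N by lia.
exists i', e'; split=> //.
have [/esym E|ne] := eqVneq i e'.
  have := arch_down A'; rewrite E bi.
  by have -> : (i < N)%N; [lia|move=> /(_ isT)].
have lt2 : (i < e')%N by lia.
have := arch_nested A A' lt' lt2; have := arch_le A'; lia.
Qed.

(** NW and NE boxes have depth [d] or [d - 1] according to the letter of [beta] between the two
    columns; at the ends of the arch that letter leaves only [d - 1]. *)
Lemma strip_over (D : {fset box}) i e d c : is_layer D i e d -> over_strip N D c ->
  c \in D \/ exists2 k, [&& (i <= k)%N, (k <= e.+1)%N & (k <= N)%N] & c = dbox k (d - 1).
Proof.
move=> lD [cN [c0 cD oc]]; have [A mem] := lD; have eN := arch_le A.
have bi : b i by case: A.
have [k ke E] := (mem c0).1 cD; move: oc; rewrite {}E !inE.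
case/or3P => /eqP E; subst c.
- right; exists k; first by lia.
  by rewrite /box_above /depth_box /=; congr pair; lia.
- case: k ke {cD} cN => // k ke _; case: (boolP (b k)) => bk.
    right; exists k; first by lia.
    by rewrite /box_NW /depth_box /fst /snd (heightS_up bk); congr pair; lia.
  left; apply/mem; exists k.
    have [E|] := eqVneq i k; last by lia.
    by rewrite -E bi in bk.
  by rewrite /box_NW /depth_box /fst /snd (heightS_down bk); congr pair; lia.
have kN : (k < N)%N by move: cN; rewrite /box_NE /depth_box /fst; lia.
case: (boolP (b k)) => bk; last first.
  right; exists k.+1; first by lia.
  by rewrite /box_NE /depth_box /fst /snd (heightS_down bk); congr pair; lia.
left; apply/mem; exists k.+1.
  have [E|] := eqVneq e k; last by lia.
  by have := arch_down A; rewrite E bk; lia.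
by rewrite /box_NE /depth_box /fst /snd (heightS_up bk); congr pair; lia.
Qed.

(** Only 21 pairs lie between consecutive unpaired 2's, and their flips cancel in the gap. *)
Lemma linked_gap i i' : linked i i' -> gp i = gp i'.+1.
Proof.
move=> [A A' lt E]; have bi' : b i' by case: (A').
have hi' := heightS_up bi'; have := arch_lt A.
have H k : (i'.+1 <= k <= i)%N -> ht i'.+1 <= ht k.
  by move=> ke; have := arch_gt (k := k) A'; have -> : (i' < k <= N)%N by [have := arch_lt A;
    lia]; move=> /(_ isT); lia.
move=> iN; have [|||_] := @gap_mono N a b flip_pair i'.+1 i; [lia|lia|exact: H|].
by move=> ->; lia.
Qed.

Lemma flip_strips_conf : confII m alpha beta flip_strips.
Proof.
have reg i e : arch N b i e -> ~~ a i -> forall k, (i < k <= e)%N -> dbox k (gp i.+1) \in rg.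
  move=> A ai k ke; apply/dbox_region.
  have := arch_gap flip_pair A ke; have le := arch_le A.
  have bi : b i by case: (A).
  have := gapS_up a bi; rewrite ai; have := @gap_ge0 i; lia.
have memU c : (c \in fcover flip_strips) = (c \in rg).
  apply/bigfcupP/idP => [[D /andP[/flip_stripsP [i [e [ai A [_ mem] _]]] _]]|].
    by move=> /mem [k ke ->]; apply: reg A ai k ke.
  move/mem_region => [k [d [kN dk ->]]].
  have [i [e [ai A E ke]]] := region_strip kN dk.
  have lD := arch_strip_layer A.
  exists (arch_strip i); last by apply/(layer_mem _ _ lD).
  by rewrite andbT; apply/flip_stripsP; exists i, e.
have disj D D' c : D \in flip_strips -> D' \in flip_strips -> c \in D -> c \in D' -> D = D'.
  move=> /flip_stripsP [i [e [ai A lD ->]]] /flip_stripsP [i' [e' [ai' A' lD' ->]]].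
  move=> /(arch_strip_layer A).2 [k ke ->] /(layer_mem _ _ (arch_strip_layer A')) [ke' E].
  by congr arch_strip; apply: strip_disjoint A A' ai ai' ke ke' E.
split.
- split; first by apply/fsetP => c; rewrite memU.
  apply/trivIfsetP => D D' Dp D'p ne; apply/fdisjointP => c cD.
  by apply/negP => cD'; rewrite (disj _ _ _ Dp D'p cD cD') eqxx in ne.
- move=> D /flip_stripsP [i [e [_ _ lD _]]].
  have [l [l' [sh _ _]]] := layer_shape lD.
  by exists l, l'; apply/ballot_stripE; eexists; eexists; exact: sh.
- move=> D l l' /flip_stripsP [i [e [_ _ lD _]]] /ballot_stripE [x [f sh]] l'0 c cD cmax.
  have [E _] := layer_unpaired lD sh l'0; subst e.
  have := cmax _ (layer_end lD); move: cD => /lD.2 [k ke ->].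
  by rewrite /depth_box /=; have := arch_lt lD.1; lia.
(* Rule IIa: the strip given by [flip_strips_over] holds every box of depth [gp i.+1 - 1] next to
   [D]; it shares [c] with [D'], hence is [D']. *)
- move=> D D' Dp D'p ne [c cD' oc].
  have ncD : c \notin D by apply/negP => cD; rewrite (disj _ _ _ D'p Dp cD' cD) eqxx in ne.
  have [i [e [ai A lD ED]]] := (flip_stripsP D).1 Dp.
  have [i' [e' [ai' A' lD' ED']]] := (flip_stripsP D').1 D'p.
  have [cD|[k ke E]] := strip_over lD oc; first by rewrite cD in ncD.
  subst c; have [ke' d1] := (layer_mem _ _ lD').1 cD'.
  have /dbox_region [kN d2] := reg _ _ A' ai' k ke'.
  have d0 : 1 < gp i.+1 by lia.
  have [i2 [e2 [A2 ai2 g2 lt [le1 le2]]]] := flip_strips_over A ai d0.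
  have E2 : i2 = i' by apply: (strip_disjoint A2 A' ai2 ai' (k := k)) => //; lia.
  subst i2; have E2 := arch_uniq A2 A'; subst e2.
  move=> c oc1; rewrite in_fsetU; apply/orP.
  have [cD|[k1 ke1 E]] := strip_over lD oc1; [by left|right].
  by rewrite E; apply/(layer_mem _ _ lD'); lia.
(* Rule IIb: the 2 linked to [i] is flipped as well, and by [linked_gap] the two depths differ by
   exactly 1. *)
move=> D l l' Dp /ballot_stripE [x [f sh]] ml'.
have [i [e [ai A lD ED]]] := (flip_stripsP D).1 Dp.
have l'0 : (0 < l')%N by lia.
have [E El] := layer_unpaired lD sh l'0; subst e.
have [l1 [l1' [sh1 E1 E2]]] := layer_shape lD.
have [_ E3 E4] := strip_shape_uniq sh sh1; subst l1 l1'; clear sh1 E1.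
have [_ _ /(_ i l' A ai El ml') [i' ai' lk]] := compat.
case od: (odd (l' - m)) lk => /= lk.
  have l'm : (0 < l' - m)%N by case: (l' - m)%N od.
  have g := linked_gap lk; have [A' _ lt E] := lk; have lD' := arch_strip_layer A'.
  have := @gapS_up a b i'; case: (A') => bi' iN' _ _ /(_ bi'); rewrite ai' => g'.
  have [l1 [l1' [sh1 E1 E3]]] := layer_shape lD'.
  have hi' := heightS_up bi'; have hi : ht i.+1 = ht i + 1 by apply: heightS_up; case: (A).
  have E4 : l1' = (l' - 1)%N by lia.
  subst l1'; exists (arch_strip i'), l1; split; [| |lia|].
  - by apply/flip_stripsP; exists i', N.
  - by apply/ballot_stripE; eexists; eexists; exact: sh1.
  exists (dbox i'.+1 (gp i.+1)); first by apply/(layer_mem _ _ lD); lia.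
  have -> : box_below (dbox i'.+1 (gp i.+1)) = dbox i'.+1 (gp i'.+1).
    by rewrite /box_below /depth_box /fst /snd; congr pair; lia.
  exact: layer_start lD'.
have g := linked_gap lk; have [_ A' lt E] := lk; have lD' := arch_strip_layer A'.
have := @gapS_up a b i; case: (A) => bi iN _ _ /(_ bi); rewrite ai => g'.
have [l1 [l1' [sh1 E1 E3]]] := layer_shape lD'.
have hi' := heightS_up bi; have hi : ht i'.+1 = ht i' + 1 by apply: heightS_up; case: (A').
have E4 : l1' = (l' + 1)%N by lia.
subst l1'; exists (arch_strip i'), l1; split; [| |lia|].
- by apply/flip_stripsP; exists i', N.
- by apply/ballot_stripE; eexists; eexists; exact: sh1.
exists (dbox i.+1 (gp i.+1)); first exact: layer_start lD.
have -> : box_above (dbox i.+1 (gp i.+1)) = dbox i.+1 (gp i'.+1).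
  by rewrite /box_above /depth_box /fst /snd; congr pair; lia.
by apply/(layer_mem _ _ lD'); lia.
Qed.

End Exists.
End Configurations.

(** * The weight of a configuration *)

Section Weights.
Variables (C : comNzRingType) (N m : nat) (alpha beta : word N).
Hypothesis m_gt0 : (0 < m)%N.
Hypothesis le_ab : bruhat alpha beta.
Local Notation a := (letter alpha).
Local Notation b := (letter beta).
Local Notation ht := (height b).
Local Notation L := (laurent C).
Local Notation tq := (@tpow C).

(* The factor of a flipped unpaired 2 having [l] unpaired 2's to its right;    *)
(* the factor t^-1 of a 22-pair is carried by its left letter.                *)
Definition unpaired_factor (l : nat) : L :=
  if (l < m)%N then (-1) ^+ l * tq (l%:Z - m%:Z)
  else if odd (l - m) then tq (-1) else 1.

Definition rank2 (i : nat) : nat := absz (ht N - ht i.+1)%R.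

Definition flipped1 : seq nat := [seq j <- iota 0 N | ~~ b j && a j].

Local Notation fl2 := (flipped2 alpha beta).

Lemma flipped1P j : reflect [/\ (j < N)%N, ~~ b j & a j] (j \in flipped1).
Proof. by rewrite mem_filter mem_iota /= add0n; apply: (iffP andP) => [[/andP[]]|[-> -> ->]]. Qed.

Lemma tdiff_flips : tdiff C m alpha beta =
  (\prod_(j <- flipped1) tq (N - j.+1 + m)%N) * \prod_(i <- fl2) tq (- (N - i.+1 + m)%N%:Z).
Proof.
rewrite -!tpow_sum -tpowD /tdiff; congr tq.
have E (w : word N) : (wt_word m w)%:Z = \sum_(i <- iota 0 N | letter w i) (N - i.+1 + m)%N%:Z.
  rewrite /wt_word -(big_mkord (letter w) (fun k => (N - k.+1 + m)%N)) /index_iota subn0.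
  by rewrite (big_morph Posz PoszD (erefl 0%:Z)).
rewrite !E /flipped1 /flipped2 !big_filter big_mkcond [X in _ - X = _]big_mkcond.
rewrite [X in _ = X + _]big_mkcond [X in _ = _ + X]big_mkcond -sumrB -big_split /=.
by apply: eq_bigr => i _; case: (a i) (b i) => [] [] /=; lia.
Qed.

Lemma prod_strip_weight : \prod_(D <- flip_strips alpha beta)
    strip_weight m C (strip_length D).1 (strip_length D).2
  = \prod_(i <- fl2) strip_weight m C (strip_length (arch_strip alpha beta i)).1
      (strip_length (arch_strip alpha beta i)).2.
Proof.
rewrite /flip_strips big_imfset /=.
  by rewrite undup_id // /flipped2 filter_uniq ?iota_uniq.
move=> i i' /flipped2P [iN bi ai] /flipped2P [iN' bi' ai'].
have [e A] := arch_ex bi iN; have [e' A'] := arch_ex bi' iN'.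
have l1 := arch_strip_layer alpha A; have l2 := arch_strip_layer alpha A'.
by move=> E; rewrite E in l1; have [] := layer_uniq l1 l2.
Qed.

(** Since [2 * l = e - i - 1], the strip replaces the weight of position [i] by that of [e], up to
    t^-1; the power left over cancels against the flipped 1 at [e] in [tdiff]. *)
Lemma strip_factor_paired i e : arch N b i e -> (e < N)%N ->
  strip_weight m C (strip_length (arch_strip alpha beta i)).1
      (strip_length (arch_strip alpha beta i)).2 * tq (- (N - i.+1 + m)%N%:Z)
    = tq (-1) * tq (- (N - e.+1 + m)%N%:Z).
Proof.
move=> A eN; have lD := arch_strip_layer alpha A.
have [l [l' [sh E1 E2]]] := layer_shape lD; rewrite (strip_lengthE sh) /=.
have l'0 : l' = 0%N.
  by have := arch_end_height A eN; have := @heightS_up b i; case: (A) => -> _ _ _ /(_ isT); lia.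
have lt := arch_lt A.
by subst l'; rewrite /strip_weight m_gt0 expr0 mul1r -!tpowD; congr tpow; lia.
Qed.

(** Since [2 * l + l' = N - i - 1], the exponent depends on [l'] and [m] only. *)
Lemma strip_factor_unpaired i : arch N b i N ->
  strip_weight m C (strip_length (arch_strip alpha beta i)).1
      (strip_length (arch_strip alpha beta i)).2 * tq (- (N - i.+1 + m)%N%:Z)
    = unpaired_factor (rank2 i).
Proof.
move=> A; have lD := arch_strip_layer alpha A.
have [l [l' [sh E1 E2]]] := layer_shape lD; rewrite (strip_lengthE sh) /=.
have -> : rank2 i = l' by rewrite /rank2; lia.
have lt := arch_lt A.
rewrite /unpaired_factor /strip_weight; case: ltnP => lm.
  by rewrite -mulrA -tpowD; congr (_ * tpow _ _); lia.
by case: (odd _) => /=; rewrite -tpowD -?tpow0; congr tpow; lia.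
Qed.

Lemma tdiff_Q_minus : tdiff C m alpha beta * Q_minus m C alpha beta =
  if `[< flip_compatible m alpha beta >] then
    (\prod_(j <- flipped1) tq (-1)) *
    \prod_(i <- fl2 | arch_end beta i == N) unpaired_factor (rank2 i)
  else 0.
Proof.
rewrite /Q_minus; case: asboolP => [compat|ncompat]; last first.
  rewrite big1 ?mulr0 // => pi /asboolP conf; case: ncompat.
  exact: conf_compatible conf.
have conf := flip_strips_conf m_gt0 le_ab compat.
rewrite big_mkcond (bigD1_seq (flip_strips alpha beta)) ?fset_uniq //=; last first.
  rewrite fpowersetE; apply/fsubsetP => D Dpi; rewrite fpowersetE; apply/fsubsetP => c.
  exact (conf_region conf Dpi).
rewrite (asboolT conf) [X in _ + X]big1 ?addr0 => [|pi npi]; last first.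
  case: asboolP => // cpi.
  by rewrite (conf_flip_strips m_gt0 le_ab cpi) eqxx in npi.
rewrite prod_strip_weight tdiff_flips -mulrA [X in _ * X]mulrC -big_split /=.
rewrite [in X in _ * X](bigID (fun i => arch_end beta i == N)) /= mulrCA mulrC.
congr (_ * _); last first.
  rewrite big_seq_cond [RHS]big_seq_cond; apply: eq_bigr => i /andP[/flipped2P [iN bi ai] /eqP E].
  have [e A] := arch_ex bi iN; apply: strip_factor_unpaired.
  have EN : e = N by rewrite -(arch_endE A) E.
  by move: A; rewrite EN.
have [pr _ _] := compat; have [_ un _] := compat.
have -> : \prod_(i <- fl2 | arch_end beta i != N) (strip_weight m C (strip_length
  (arch_strip alpha beta i)).1
      (strip_length (arch_strip alpha beta i)).2 * tq (- (N - i.+1 + m)%N%:Z))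
   = \prod_(j <- flipped1) (tq (-1) * tq (- (N - j.+1 + m)%N%:Z)).
  (* By compatibility the flipped 1's are exactly the ends of the archs of the flipped paired
     2's. *)
  have pe : perm_eq flipped1 [seq arch_end beta i | i <- [seq i <- fl2 | arch_end beta i != N]].
    apply: uniq_perm.
    - by apply: filter_uniq; apply: iota_uniq.
    - rewrite map_inj_in_uniq; first by do 2! apply: filter_uniq; apply: iota_uniq.
      move=> i i'; rewrite !mem_filter !mem_iota =>
        /and3P[eN /andP[bi _] iN] /and3P[eN' /andP[bi' _] iN'].
      have [|e A] := arch_ex bi (N := N); first by lia.
      have [|e' A'] := arch_ex bi' (N := N); first by lia.
      rewrite (arch_endE A) (arch_endE A') => E; subst e'.
      apply: (arch_inj A A'); rewrite (arch_endE A) in eN.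
      by have := arch_le A; lia.
    move=> j; apply/flipped1P/mapP => [[jN bj aj]|[i memi ->] ].
      have [i A] := un j bj aj jN; exists i; last by rewrite (arch_endE A).
      rewrite mem_filter (arch_endE A); apply/andP; split; first by lia.
      apply/flipped2P; rewrite (pr _ _ A jN); split=> //; last by case: A.
      by have := arch_lt A; lia.
    move: memi; rewrite mem_filter => /andP[eN /flipped2P [iN bi ai]].
    have [e A] := arch_ex bi iN; rewrite (arch_endE A) in eN *.
    have lt : (e < N)%N by have := arch_le A; lia.
    by split=> //; [exact: arch_down A lt|rewrite -(pr _ _ A lt)].
  rewrite (perm_big _ pe) /= big_map big_filter big_seq_cond [RHS]big_seq_cond.
  apply: eq_bigr => i /andP[/flipped2P [iN bi ai] eN].
  have [e A] := arch_ex bi iN; rewrite (arch_endE A) in eN *.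
  by apply: strip_factor_paired => //; have := arch_le A; lia.
rewrite -big_split /=; apply: eq_bigr => j _.
by rewrite mulrCA tpowK mulr1.
Qed.

End Weights.

(** * The coefficients of C_beta *)

Section Scan.
Variables (C : comNzRingType) (m : nat).
Local Notation L := (laurent C).
Local Notation tq := (@tpow C).

Definition flip_factor (f : bool) : L := if f then tq (-1) else 1.

(** A single last flag is that of the unclassified 2, which must not be flipped. *)
Fixpoint pairs22_value (st : seq bool) : L :=
  match st with
  | [::] => 1
  | [:: f] => if f then 0 else 1
  | f :: g :: st' => if f == g then flip_factor f * pairs22_value st' else 0
  end.

(* The flags tell which unpaired 2's are flipped, from right to left; [k] is   *)
(* the mark of the first one.                                                  *)
Fixpoint unpaired_value (k : nat) (st : seq bool) : L :=
  match k, st with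
  | 0%N, _ => pairs22_value st
  | _, [::] => 1
  | k'.+1, f :: st' =>
      (if f then (-1) ^+ (m - k) * tq (- k%:Z) else 1) * unpaired_value k' st'
  end.

(* [scan [::] (zip beta alpha)] is the coefficient of m_alpha in C_beta.  The  *)
(* stack holds, for each 2 of beta still waiting for its partner, whether it   *)
(* is flipped in alpha.                                                        *)
Fixpoint scan (st : seq bool) (s : seq (bool * bool)) : L :=
  match s with
  | [::] => unpaired_value m st
  | (true, x) :: s' => scan (~~ x :: st) s'
  | (false, x) :: s' =>
      if st is f :: st' then if x == f then flip_factor f * scan st' s' else 0
      else if x then 0 else scan [::] s'
  end.

(* The 21 pair contributes m_21 + t^-1 m_12. *)
Definition pair_coef (x y : bool) : L := if y == ~~ x then flip_factor (~~ x) else 0.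

(** An adjacent 21 pushes a flag and pops it at once, so the rest of the scan sees the same stack;
    pairs may thus be removed in any order. *)
Lemma scan_cut st (X Y : seq (bool * bool)) x y : scan st (X ++ (true, x) :: (false, y) :: Y) =
  pair_coef x y * scan st (X ++ Y).
Proof.
rewrite /pair_coef; elim: X st => [|[[] z] X IH] st //=.
  by case: ifP => //; rewrite mul0r.
case: st => [|f st]; first by case: z; [rewrite mulr0|exact: IH].
by case: ifP => _; [rewrite IH mulrCA|rewrite mulr0].
Qed.

Lemma prod_flags_cons (f : bool) (st : seq bool) (F : nat -> L) :
  \prod_(0 <= j < size (f :: st) | nth false (f :: st) j) F j =
  (if f then F 0%N else 1) * \prod_(0 <= j < size st | nth false st j) F j.+1.
Proof. by rewrite big_mkcond [size _]/= big_nat_recl // -big_mkcond. Qed.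

Lemma all_iotaS (p : nat -> bool) n : all p (iota 0 n.+1) = p 0%N && all (fun j =>
  p j.+1) (iota 0 n).
Proof. by rewrite /= -[1%N]/(1 + 0)%N iotaDl all_map; congr (_ && _); apply: eq_all. Qed.

(** The default [false] of [nth] matters: in a list of odd length the last flag has its partner out
    of range and is forced to be [false]. *)
Lemma pairs22_valueE st : pairs22_value st =
  if all (fun j => nth false st j ==> nth false st (if odd j then j.-1 else j.+1))
       (iota 0 (size st))
  then \prod_(0 <= j < size st | nth false st j) (if odd j then tq (-1) else 1)
  else 0.
Proof.
have [n] := ubnP (size st); elim: n st => // n IH [|f [|g st]].
- by move=> _; rewrite big_nil.
- by move=> _; rewrite prod_flags_cons big_nil mulr1; case: f.
rewrite ltnS => sn; rewrite !prod_flags_cons [size _]/= !all_iotaS.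
rewrite [pairs22_value _]/= IH; last exact: leq_trans (leqnSn _) sn.
have -> : all (fun j =>
  nth false [:: f, g & st] j.+2 ==> nth false [:: f,
  g & st] (if odd j.+2 then j.+2.-1 else j.+3)) (iota 0 (size st))
   = all (fun j => nth false st j ==> nth false st (if odd j then j.-1 else j.+1)) (iota 0
     (size st)).
  by apply: eq_all => -[|j] //=; rewrite negbK; case: (odd j).
under [in RHS]eq_bigr => j _ do rewrite /= negbK.
case: (all _ _); rewrite ?andbT ?andbF ?mulr0 ?if_same //.
by clear; case: f g => [] [] //=; rewrite ?mul1r ?mulr1.
Qed.

Lemma unpaired_valueE st : unpaired_value m st =
  if all (fun j => [&& nth false st j & (m <= j)%N] ==>
            nth false st (if odd (j - m) then j.-1 else j.+1)) (iota 0 (size st))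
  then \prod_(0 <= j < size st | nth false st j) unpaired_factor C m j
  else 0.
Proof.
(* [k] is the mark of the head of [st1], so index [j] of [st1] has rank [m - k + j] in the whole
   stack. *)
have gen k st1 : (k <= m)%N -> unpaired_value k st1 =
  if all (fun j => [&& nth false st1 j & (k <= j)%N] ==>
            nth false st1 (if odd (j - k) then j.-1 else j.+1)) (iota 0 (size st1))
  then \prod_(0 <= j < size st1 | nth false st1 j) unpaired_factor C m (m - k + j)
  else 0.
  elim: k st1 => [|k IH] st1 km.
    have -> : unpaired_value 0 st1 = pairs22_value st1 by case: st1.
    rewrite pairs22_valueE;
      under eq_all => j do rewrite -[j in odd j]subn0 -[nth _ st1 j]andbT -[true in _ &&
      true](leq0n j).
    case: ifP => // _; apply: eq_bigr => j _.
    by rewrite /unpaired_factor subn0 ltnNge leq_addr /= addKn.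
  case: st1 => [|f st1]; first by rewrite big_nil.
  rewrite [size _]/= all_iotaS prod_flags_cons andbF /= IH; last exact: ltnW.
  have -> : all (fun j =>
    (nth false st1 j && (k < j.+1)%N) ==> nth false (f :: st1) (if odd
    (j.+1 - k.+1) then j else j.+2)) (iota 0 (size st1))
    = all (fun j => (nth false st1 j && (k <= j)%N) ==> nth false st1 (if odd
      (j - k) then j.-1 else j.+1)) (iota 0 (size st1)).
    by apply: eq_all => -[|j]; rewrite ltnS subSS //; case: ifP.
  case: (all _ _); last by rewrite mulr0.
  rewrite addn0; congr (_ * _).
    case: f => //; rewrite /unpaired_factor (_ : (m - k.+1 < m)%N); last by lia.
    by congr (_ * tpow _ _); lia.
  by apply: eq_bigr => j _; rewrite (_ : m - k + j = m - k.+1 + j.+1)%N; last by lia.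
rewrite gen //; case: (all _ _) => //; apply: eq_bigr => j _.
by rewrite subnn.
Qed.
End Scan.

(** * The scan in terms of archs *)

Section ScanPositions.
Variables (C : comNzRingType) (N m : nat) (alpha beta : word N).
Local Notation a := (letter alpha).
Local Notation b := (letter beta).
Local Notation ht := (height b).
Local Notation tq := (@tpow C).

(* The indices of the 2's among the first [k] letters still waiting for their  *)
(* partner, from right to left.                                               *)
Fixpoint waiting (k : nat) : seq nat :=
  if k is k'.+1 then if b k' then k' :: waiting k' else behead (waiting k') else [::].

(** Each waiting 2 starts one level below the next one to its right, so its place in the stack can
    be read off from heights. *)
Lemma waiting_nth k j : (j < size (waiting k))%N ->
  [/\ b (nth 0%N (waiting k) j), (nth 0%N (waiting k) j < k)%N,
      forall k', (nth 0%N (waiting k) j < k' <= k)%N -> ht (nth 0%N (waiting k) j) < ht k'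
    & ht (nth 0%N (waiting k) j) = ht k - 1 - j%:Z].
Proof.
elim: k j => // k IH j; rewrite [waiting _]/=; case: ifPn => bk.
  case: j => [_|j js] /=.
    split=> // [k' ke|]; last by rewrite bk; lia.
    by have -> : k' = k.+1; [lia|rewrite (heightS_up bk); lia].
  have [b1 lt gt E] := IH j js; split=> //; [lia| |by rewrite bk E; lia].
  move=> k' ke; have [Ek|ne] := eqVneq k' k.+1; last by apply: gt; lia.
  by rewrite Ek (heightS_up bk) E; lia.
rewrite size_behead nth_behead => js.
have [|b1 lt gt E] := IH j.+1; first by lia.
have hk := heightS_down bk.
split=> //; [lia| |by rewrite E hk; lia].
move=> k' ke; have [Ek|ne] := eqVneq k' k.+1; last by apply: gt; lia.
by rewrite Ek hk E; lia.
Qed.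

Lemma mem_waiting k i : b i -> (i < k)%N -> (forall k', (i < k' <= k)%N -> ht i < ht k') ->
  i \in waiting k.
Proof.
elim: k => // k IH bi ik gt; rewrite [waiting _]/=.
have W : (i < k)%N -> i \in waiting k by move=> lt; apply: IH => // k' ?; apply: gt; lia.
case: ifPn => bk.
  by rewrite inE; have [//|ne] := eqVneq i k; apply: W; lia.
have lt : (i < k)%N.
  by have [E|] := eqVneq i k; [rewrite -E bi in bk|lia].
have := W lt; have hk := heightS_down bk; have gk : ht i < ht k.+1 by apply: gt; lia.
have := @waiting_nth k 0; case: (waiting k) => [|i0 s] //= /(_ isT) [_ _ _ E].
by rewrite inE => /orP[/eqP Ei|//]; move: gk; rewrite Ei hk E; lia.
Qed.

Lemma waiting_head k i s : (k < N)%N -> ~~ b k -> waiting k = i :: s -> arch N b i k.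
Proof.
move=> kN bk E; have := @waiting_nth k 0; rewrite E => /(_ isT) /= [bi ik gt hi].
by split=> //; [lia|move=> _; rewrite (heightS_down bk) hi; lia].
Qed.

Lemma arch_waiting i k : arch N b i k -> i \in waiting k.
Proof. by case=> bi /andP[ik _] gt _; apply: mem_waiting. Qed.

Lemma waiting_arch i : i \in waiting N -> arch N b i N.
Proof.
move=> /(nthP 0%N) [j js <-]; have [bi lt gt _] := waiting_nth js.
by split=> //; rewrite ?lt ?leqnn ?ltnn.
Qed.

Lemma waiting_rank j : (j < size (waiting N))%N -> rank2 beta (nth 0%N (waiting N) j) = j.
Proof.
move=> js; have [bi lt _ E] := waiting_nth js.
by rewrite /rank2 (heightS_up bi) E; lia.
Qed.

Lemma nth_waiting_rank i : i \in waiting N ->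
  (rank2 beta i < size (waiting N))%N /\ nth 0%N (waiting N) (rank2 beta i) = i.
Proof. by move=> /(nthP 0%N) [j js <-]; rewrite waiting_rank. Qed.

Lemma uniq_waiting : uniq (waiting N).
Proof.
apply/(uniqP 0%N) => j j' js js' E.
by rewrite -(waiting_rank js) -(waiting_rank js') E.
Qed.

Definition scan_ok (j : nat) : bool :=
  b j || (if waiting j is i :: _ then a j == ~~ a i else ~~ a j).

(** Induction on the length of the suffix still to be read: the stack reached there holds the flags
    of [waiting (N - n)]. *)
Lemma scan_waiting n : (n <= N)%N ->
  scan C m [seq ~~ a i | i <- waiting (N - n)] (drop (N - n) (zip beta alpha)) =
  if all scan_ok (iota (N - n) n) then
    \prod_(j <- iota (N - n) n | ~~ b j && a j) tq (-1)
    * unpaired_value C m m [seq ~~ a i | i <- waiting N]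
  else 0.
Proof.
have sz : size (zip beta alpha) = N by rewrite size_zip !size_tuple minnn.
elim: n => [|n IH] nN.
  by rewrite subn0 drop_oversize ?sz // big_nil mul1r.
have [k Ek] : exists k, k = (N - n.+1)%N by exists (N - n.+1)%N.
have Ek1 : (N - n)%N = k.+1 by lia.
have kN : (k < N)%N by lia.
rewrite -Ek; rewrite Ek1 in IH; have {}IH := IH (ltnW nN).
rewrite (drop_nth (false, false)) ?sz // nth_zip ?size_tuple //.
rewrite -[nth false beta k]/(b k) -[nth false alpha k]/(a k).
rewrite [iota _ _]/= big_cons [all _ _]/= {1}/scan_ok.
case bk : (b k) => /=.
  by rewrite -IH /= bk.
have E1 : waiting k.+1 = behead (waiting k) by rewrite /= bk.
rewrite {}E1 in IH; case: (waiting k) IH => [|i s] /= IH.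
  by case: (a k) => //=.
case: eqP => //= ->; rewrite {}IH; case: (all _ _); last by rewrite mulr0.
by case: (a i); rewrite /= ?mul1r ?mulrA.
Qed.

(** The right-hand side is that of [tdiff_Q_minus], so the tiling side and C_beta meet here.
    [waiting N] lists the unpaired 2's by rank, which matches the tests of [scan] with
    [flip_compatible]. *)
Lemma scanE : scan C m [::] (zip beta alpha) =
  if `[< flip_compatible m alpha beta >] then
    (\prod_(j <- flipped1 alpha beta) tq (-1)) *
    \prod_(i <- flipped2 alpha beta | arch_end beta i == N) unpaired_factor C m (rank2 beta i)
  else 0.
Proof.
have := scan_waiting (leqnn N); rewrite subnn drop0 => ->.
rewrite unpaired_valueE size_map.
have pe : perm_eq [seq i <- waiting N | ~~ a i] [seq i <- flipped2 alpha beta | arch_end beta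
  i == N].
  apply: uniq_perm.
  - by apply: filter_uniq; apply: uniq_waiting.
  - by do 2! apply: filter_uniq; apply: iota_uniq.
  move=> i; rewrite !mem_filter mem_iota add0n; apply/idP/idP.
    move=> /andP[-> /waiting_arch A]; rewrite (arch_endE A) eqxx /=.
    by case: (A) => -> /andP[-> _].
  move=> /and3P[/eqP eN /andP[bi ->] iN] /=.
  have [e A] := arch_ex bi iN; rewrite (arch_endE A) in eN.
  by apply: arch_waiting; rewrite -[X in arch _ _ _ X]eN.
rewrite -[\prod_(i <- _ | arch_end _ _ == N) _]big_filter -(perm_big _ pe) big_filter /=.
rewrite /flipped1 big_filter.
have E : \prod_(0 <= j < size
  (waiting N) | nth false [seq ~~ a i | i <- waiting N] j) unpaired_factor C m j
   = \prod_(i <- waiting N | ~~ a i) unpaired_factor C m (rank2 beta i).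
  rewrite [RHS](big_nth 0%N) big_nat_cond [RHS]big_nat_cond;
    apply: eq_big => [j|j /andP[/andP[_ js] _]].
    by case: (ltnP j (size (waiting N))) => js //=; rewrite (nth_map 0%N).
  by rewrite waiting_rank.
rewrite {}E.
suff : all scan_ok (iota 0 N) && all
           (fun j : nat => nth false [seq ~~ a i | i <- waiting N] j && (m <= j)%N ==>
            nth false [seq ~~ a i | i <- waiting N] (if odd (j - m) then j.-1 else j.+1))
           (iota 0 (size (waiting N))) = `[< flip_compatible m alpha beta >].
  move=> <-; case: (all scan_ok _) => //=.
  by case: (all _ _) => //=; rewrite mulr0.
apply/idP/asboolP.
  move=> /andP[/allP ok /allP ok2]; split.
  - move=> i e A eN; have := ok e; rewrite mem_iota add0n eN => /(_ isT).
    rewrite /scan_ok (negbTE (arch_down A eN)) /=.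
    have := arch_waiting A; case W : (waiting e) => [|i0 s] // _ /eqP ->.
    by rewrite (arch_inj A (waiting_head eN (arch_down A eN) W) eN).
  - move=> j bj aj jN; have := ok j; rewrite mem_iota add0n jN => /(_ isT).
    rewrite /scan_ok (negbTE bj) /=; case W : (waiting j) => [|i s]; first by rewrite aj.
    by move=> _; exists i; apply: waiting_head W.
  move=> i l' A ai El' ml'.
  have [sz nE] := nth_waiting_rank (arch_waiting A).
  have El : rank2 beta i = l' by rewrite /rank2 -El'.
  rewrite El in sz nE.
  have := ok2 l'; rewrite mem_iota add0n sz => /(_ isT).
  rewrite (nth_map 0%N) // nE ai ml' /=.
  have [bi _ _ hi] := waiting_nth sz; rewrite nE in bi hi.
  have key j : nth false [seq ~~ a i | i <- waiting N] j ->
     [/\ ~~ a (nth 0%N (waiting N) j),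
       arch N b (nth 0%N (waiting N) j) N & ht (nth 0%N (waiting N) j) = ht N - 1 - j%:Z].
    case: (ltnP j (size (waiting N))) => js; last by rewrite nth_default // size_map.
    rewrite (nth_map 0%N) // => aj; have [_ _ _ E] := waiting_nth js.
    by split=> //; apply/waiting_arch/mem_nth.
  case: ifP => od /key [aj Aj Ej].
    have l'm : (0 < l' - m)%N by case: (l' - m)%N od.
    by eexists; [exact: aj|split=> //; [apply: (arch_order A Aj)|]; lia].
  by eexists; [exact: aj|split=> //; [apply: (arch_order Aj A)|]; lia].
move=> [pr un lk]; apply/andP; split; apply/allP.
  move=> j; rewrite mem_iota add0n /= => jN; rewrite /scan_ok; case: (boolP (b j)) => //= bj.
  case W : (waiting j) => [|i s].
    by apply/negP => aj; have [i /arch_waiting] := un j bj aj jN; rewrite W.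
  by rewrite (pr _ _ (waiting_head jN bj W) jN).
move=> j; rewrite mem_iota add0n /= => js; apply/implyP => /andP[].
rewrite (nth_map 0%N) // => ai mj; set i := nth _ _ _ in ai.
have iW : i \in waiting N by apply: mem_nth.
have A := waiting_arch iW; have [bi iN _ hi] := waiting_nth js; rewrite -/i in bi iN hi.
have [|i' ai' L] := lk i j A ai _ mj; first by rewrite (heightS_up bi) hi; lia.
have mem i1 : arch N b i1 N -> ~~ a i1 -> nth false [seq ~~ a i | i <- waiting N] (rank2 beta i1).
  by move=> /arch_waiting /nth_waiting_rank [sz E] ai1; rewrite (nth_map 0%N) // E.
case: (odd _) L => -[A1 A2 lt hE].
  have -> : j.-1 = rank2 beta i'; last exact: mem.
  have := arch_gt (k := N) A1; rewrite (arch_lt A1) leqnn => /(_ isT).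
  by rewrite /rank2 (@heightS_up b i'); [lia|case: A1].
have -> : j.+1 = rank2 beta i'; last exact: mem.
by rewrite /rank2 (@heightS_up b i'); [lia|case: A2].
Qed.

End ScanPositions.

(** * The set F^B(beta) *)

Section FlipSets.
Variables (C : comNzRingType) (N m : nat) (alpha beta : word N).
Local Notation a := (letter alpha).
Local Notation b := (letter beta).
Local Notation L := (laurent C).
Local Notation tq := (@tpow C).

Lemma find_pair_cons2 (x y : nat * bool) s : find_pair (x :: y :: s) =
  if x.2 && ~~ y.2 then Some ((x.1, y.1), s)
  else if find_pair (y :: s) is Some (p, r) then Some (p, x :: r) else None.
Proof. by []. Qed.

Lemma find_pairP (s : seq (nat * bool)) p r : find_pair s = Some (p, r) ->
  exists X Y, s = X ++ (p.1, true) :: (p.2, false) :: Y /\ r = X ++ Y.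
Proof.
elim: s p r => [//|x s IH] p r.
case: s IH => [//|y s] IH; rewrite find_pair_cons2; case: ifP => [/andP[x2 y2]|_].
  move=> [<- <-]; exists [::], s; split=> //=.
  by clear IH; case: x y x2 y2 => [i []] [j []].
case E : (find_pair (y :: s)) => [[p1 r1]|] // [<- <-].
by have [X [Y [-> ->]]] := IH _ _ E; exists (x :: X), Y.
Qed.

Lemma find_pair_none (s : seq (nat * bool)) : find_pair s = None ->
  exists u1 u2, s = [seq (i, false) | i <- u1] ++ [seq (i, true) | i <- u2].
Proof.
elim: s => [_|[i x] s IH]; first by exists [::], [::].
case: s IH => [|[j y] s] IH.
  by move=> _; case: x; [exists [::], [:: i]|exists [:: i], [::]].
rewrite find_pair_cons2; case: ifP => // xy.
case E : (find_pair ((j, y) :: s)) => [[]|] // _.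
have [u1 [u2 Es]] := IH E; rewrite Es.
case: x xy => /= xy; last by exists (i :: u1), u2.
case: u1 Es => [|k u1] Es; first by exists [::], (i :: u2).
by case: Es xy => _ ->.
Qed.

Definition scan_list (st : seq bool) (s : seq (nat * bool)) : L :=
  scan C m st [seq (x.2, a x.1) | x <- s].

Lemma scan_list_cut st X i j Y : scan_list st (X ++ (i, true) :: (j, false) :: Y) =
  pair_coef C (a i) (a j) * scan_list st (X ++ Y).
Proof. by rewrite /scan_list !map_cat /= scan_cut. Qed.

Lemma scan_unpaired u1 u2 :
  scan_list [::] ([seq (i, false) | i <- u1] ++ [seq (i, true) | i <- u2]) =
  if all (fun i => ~~ a i) u1 then unpaired_value C m m [seq ~~ a i | i <- rev u2] else 0.
Proof.
elim: u1 => [|i u1 IH]; last first.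
  have -> : scan_list [::] ([seq (i, false) | i <- i :: u1] ++ [seq (i, true) | i <- u2])
    = if a i then 0 else scan_list [::] ([seq (i, false) | i <- u1] ++ [seq (i,
      true) | i <- u2]) by [].
  by rewrite IH /=; case: (a i).
have -> : [seq ~~ a i | i <- rev u2] = catrev [seq ~~ a i | i <- u2] [::] by rewrite map_rev.
by rewrite /scan_list /=; elim: u2 [::] => [|i u2 IH] st //=.
Qed.

(** Every removal is an instance of [scan_cut]; fuel [size s] suffices because each removal shortens
    the list. *)
Lemma pair_upP n s : (size s <= n)%N ->
  exists u1 u2, [/\ (pair_up n s).2 = [seq (i, false) | i <- u1] ++ [seq (i, true) | i <- u2],
    perm_eq s ([seq (x.1, true) | x <- (pair_up n s).1] ++ [seq (x.2,
      false) | x <- (pair_up n s).1]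
               ++ (pair_up n s).2)
    & scan_list [::] s = (\prod_(x <- (pair_up n s).1)
        pair_coef C (a x.1) (a x.2))
        * scan_list [::] (pair_up n s).2].
Proof.
elim: n s => [|n IH] s sn.
  case: s sn => // _; exists [::], [::]; split=> //=.
  by rewrite big_nil mul1r.
rewrite /=; case E : (find_pair s) => [[[i j] r]|]; last first.
  have [u1 [u2 Es]] := find_pair_none E; exists u1, u2; split=> //=.
  by rewrite big_nil mul1r.
have [X [Y [/= Es Er]]] := find_pairP E.
have sr : (size r <= n)%N by move: sn; rewrite Es Er !size_cat /=; lia.
have [u1 [u2 [Eu pe sc]]] := IH r sr.
case: (pair_up n r) Eu pe sc => [ps u] /= Eu pe sc; exists u1, u2; split=> //.
  move/permP: pe => pe; apply/permP => q; have := pe q.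
  by rewrite Es Er !count_cat /= !count_cat /= !count_cat; lia.
by rewrite Es scan_list_cut -Er sc big_cons mulrA.
Qed.

Definition object_value (o : flip_object) : L :=
  if o is FlipMarked q _ then (-1) ^+ (m - q) * tq (- q%:Z) else tq (-1).

Definition mark_ok (o : flip_object) : bool :=
  if o is FlipMarked q _ then (0 < q <= m)%N else true.

Lemma sum_mark (q : nat) (F : nat -> nat) : (0 < q <= m)%N ->
  (\sum_(1 <= p < m.+1) F p * (q == p) = F q)%N.
Proof.
move=> qm; rewrite (bigD1_seq q) ?iota_uniq //=; last by rewrite mem_index_iota; lia.
rewrite eqxx muln1 big1 ?addn0 // => p; rewrite eq_sym => /negbTE ->.
by rewrite muln0.
Qed.

Definition mark_count (p : nat) (s : seq flip_object) : nat :=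
  count (fun o => flipped alpha beta o &&
    match o with FlipMarked q _ => q == p | _ => false end) s.

Definition unmarked_count (s : seq flip_object) : nat :=
  count (fun o => flipped alpha beta o &&
    match o with FlipMarked _ _ => false | _ => true end) s.

(** Turns the exponents, which are sums over marks, into a product over objects; [mark_ok] makes
    each mark occur exactly once in the range of summation. *)
Lemma objects_value (s : seq flip_object) : all mark_ok s ->
  (-1) ^+ (\sum_(1 <= p < m.+1) (m - p) * mark_count p s) *
    tq (- (unmarked_count s + \sum_(1 <= p < m.+1) p * mark_count p s)%N%:Z)
  = \prod_(o <- s | flipped alpha beta o) object_value o.
Proof.
elim: s => [_|o s IH].
  have S0 (F : nat -> nat) : (\sum_(1 <= p < m.+1) F p * 0 = 0)%N.
    by rewrite big1 // => p _; rewrite muln0.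
  by rewrite big_nil (S0 (fun p => (m - p)%N)) (S0 id) mul1r.
move=> /andP[mo /IH {}IH]; rewrite big_cons -{}IH.
set c := mark_count^~ s; set d := unmarked_count s.
have sum F : (\sum_(1 <= p < m.+1) F p * mark_count p (o :: s) =
    (if flipped alpha beta o then if o is FlipMarked q _ then F q else 0 else 0)
    + \sum_(1 <= p < m.+1) F p * mark_count p s)%N.
  under eq_bigr => p _ do rewrite [mark_count _ _]/= mulnDr.
  rewrite big_split /=; congr (_ + _)%N; case: (flipped alpha beta o); last first.
    by rewrite big1 // => p _; rewrite muln0.
  by case: o mo => [i j|q i|i j] mo; [|exact: sum_mark|]; rewrite big1 // => p _; rewrite muln0.
rewrite (sum (fun p => (m - p)%N)) (sum id) exprD.
rewrite /unmarked_count /= -/(unmarked_count s) -/d.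
case: (flipped alpha beta o); last by rewrite mul1r !add0n.
case: o mo {sum} => [i j|q i|i j] mo; rewrite /= ?expr0 ?mul1r.
- by rewrite mulrCA -tpowD; congr (_ * tpow _ _); lia.
- by rewrite mulrACA -tpowD; congr (_ * tpow _ _); lia.
by rewrite mulrCA -tpowD; congr (_ * tpow _ _); lia.
Qed.

Lemma mem_flatten_map (T : Type) (f : T -> seq nat) (s : seq T) k :
  (k \in flatten [seq f o | o <- s]) = has (fun o => k \in f o) s.
Proof. by elim: s => //= o s IH; rewrite mem_cat IH. Qed.

Lemma has_all (T : Type) (p q : pred T) (s : seq T) : has p s -> all q s -> has (fun o =>
  p o && q o) s.
Proof. by elim: s => //= o s IH /orP[-> /andP[-> //]|/IH h /andP[_ /h ->]]; rewrite orbT. Qed.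

Lemma all_flatten_map (T : Type) (f : T -> seq nat) (s : seq T) (r : seq nat) :
  {subset flatten [seq f o | o <- s] <= r} -> all (fun o => all (fun i => i \in r) (f o)) s.
Proof.
elim: s => //= o s IH sub; rewrite IH ?andbT; last by move=> i h; apply: sub;
  rewrite mem_cat h orbT.
by apply/allP => i h; apply: sub; rewrite mem_cat h.
Qed.

(** A changed letter lies in a selected object, and all letters of a selected object are in [idx],
    hence changed. *)
Lemma FB_flipped k : FB m alpha beta ->
  all (fun o => all (fun i => (i < N)%N) (flip_indices o)) (flip_objects m beta) ->
  a k != b k ->
  has (fun o => (k \in flip_indices o) && flipped alpha beta o) (flip_objects m beta).
Proof.
move=> /existsP [sel /eqP E] bnd.
set idx := flatten _ in E.
have aE i : (i < N)%N -> a i = if i \in idx then ~~ b i else b i.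
  move=> iN; rewrite {1}E /letter /change_letters -(tnth_nth false _ (Ordinal iN)) tnth_mktuple.
  by [].
case: (ltnP k N) => kN; last by rewrite /letter !nth_default ?size_tuple.
rewrite aE //; case: ifP => [kx _|]; last by rewrite eqxx.
have {}kx : has (fun o => k \in flip_indices o) (mask sel (flip_objects m beta)).
  by rewrite -mem_flatten_map.
have H := has_all kx (all_flatten_map (f := flip_indices) (fun i h => h)).
have {}bnd : all (fun o => all (fun i =>
  (i < N)%N) (flip_indices o)) (mask sel (flip_objects m beta)).
  elim: (flip_objects m beta) (tval sel) bnd => [|o s IH] [|[] sl] //= /andP[os /IH H1] //.
  by rewrite os H1.
have := has_all H bnd; move/has_mask; apply: sub_has => o /andP[/andP[-> /allP o1] /allP o2].
by apply/allP => i io; rewrite aE ?o1 ?o2 //; case: (b i).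
Qed.

Lemma uniq_map_inj (T : eqType) (f : T -> nat) (s : seq T) (x y : T) :
  uniq (map f s) -> x \in s -> y \in s -> f x = f y -> x = y.
Proof.
elim: s => // z s IH /= /andP[zs us]; rewrite !inE.
case/orP=> [/eqP ->|xs] /orP[/eqP ->|ys] E //; last exact: IH.
  by move: zs; rewrite E map_f.
by move: zs; rewrite -E map_f.
Qed.

Lemma matching_data : exists (ps : seq (nat * nat)) (u1 r : seq nat),
  [/\ pairs21 beta = ps, unpaired2 beta = r,
    scan C m [::] (zip beta alpha) =
      \prod_(x <- ps) pair_coef C (a x.1) (a x.2) *
      (if all (fun i => ~~ a i) u1 then unpaired_value C m m [seq ~~ a i | i <- r] else 0),
    [/\ {in ps, forall x, [/\ b x.1, ~~ b x.2, (x.1 < N)%N & (x.2 < N)%N]},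
        {in u1, forall i, ~~ b i} & {in r, forall i, b i /\ (i < N)%N}]
   & [/\ uniq [seq x.1 | x <- ps], uniq [seq x.2 | x <- ps], uniq r,
       {in ps, forall x, x.1 \notin r} & {in u1, forall i, i \notin [seq x.2 | x <- ps]}]].
Proof.
set s := zip (iota 0 N) beta.
have ss : size s = N by rewrite size_zip size_iota size_tuple minnn.
have mem_s i x : (i, x) \in s -> (i < N)%N /\ x = b i.
  move=> /(nthP (0%N, false)) [j]; rewrite ss => jN.
  by rewrite nth_zip ?size_iota ?size_tuple // nth_iota // => -[<- <-].
have -> : scan C m [::] (zip beta alpha) = scan_list [::] s.
  rewrite /scan_list; congr scan; apply: (@eq_from_nth _ (false, false)).
    by rewrite size_map ss size_zip !size_tuple minnn.
  rewrite size_zip !size_tuple minnn => j jN.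
  rewrite (nth_map (0%N, false)) ?ss // !nth_zip ?size_iota ?size_tuple //=.
  by rewrite nth_iota.
have [|u1 [u2 [Eu pe ->]]] := @pair_upP N s; first by rewrite ss.
have Eps : pairs21 beta = (pair_up N s).1 by [].
have Eu2 : unpaired2 beta = rev u2.
  rewrite /unpaired2 /matching -/s Eu filter_cat map_cat.
  have F1 u : [seq x <- [seq (i, false) | i : nat <- u] | x.2] = [::] by elim: u.
  have F2 u : [seq x <- [seq (i, true) | i : nat <- u] | x.2] = [seq (i, true) | i <- u].
    by elim: u => //= i u ->.
  by rewrite F1 F2 -map_comp map_id_in.
rewrite Eu scan_unpaired; move: Eps pe; rewrite Eu; move: (pair_up N s).1 => ps Eps pe {Eu}.
have pn : perm_eq (iota 0 N) ([seq x.1 | x <- ps] ++ [seq x.2 | x <- ps] ++ u1 ++ u2).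
  have := perm_map fst pe; rewrite -[map fst s]/(unzip1 s) unzip1_zip ?size_iota ?size_tuple //.
  by rewrite !map_cat -!map_comp /= !map_id.
have un : uniq ([seq x.1 | x <- ps] ++ [seq x.2 | x <- ps] ++ u1 ++ u2).
  by rewrite -(perm_uniq pn) iota_uniq.
have ltN i : i \in [seq x.1 | x <- ps] ++ [seq x.2 | x <- ps] ++ u1 ++ u2 -> (i < N)%N.
  by rewrite -(perm_mem pn) mem_iota.
have bps x : x \in ps -> b x.1 /\ ~~ b x.2.
  move=> xp; have [|_ <-] := mem_s x.1 true.
    by rewrite (perm_mem pe) mem_cat; apply/orP; left; apply/mapP; exists x.
  split=> //; have [|_ <-] := mem_s x.2 false => //.
  by rewrite (perm_mem pe) !mem_cat; apply/orP; right; apply/orP; left; apply/mapP; exists x.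
have bu1 i : i \in u1 -> ~~ b i.
  move=> iu; have [|_ <-] := mem_s i false => //.
  by rewrite (perm_mem pe) !mem_cat map_f ?orbT.
have bu2 i : i \in u2 -> b i.
  move=> iu; have [|_ <-] := mem_s i true => //.
  by rewrite (perm_mem pe) !mem_cat (map_f (fun i => (i, true))) ?orbT.
move: un; rewrite !cat_uniq; case/and3P => un1 dis1 /and3P[un2 dis2 /and3P[_ dis3 un3]].
exists ps, u1, (rev u2); split=> //; split.
- by move=> x xp; have [b1 b2] := bps x xp;
  rewrite b1 b2 !ltN // !mem_cat map_f ?orbT // (map_f fst).
- exact: bu1.
- by move=> i; rewrite mem_rev => iu; rewrite bu2 // ltN // !mem_cat iu !orbT.
- exact: un1.
- exact: un2.
- by rewrite rev_uniq.
- move=> x xp; rewrite mem_rev; apply/negP => h.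
  by move/hasPn: dis1 => /(_ x.1); rewrite !mem_cat h !orbT => /(_ isT) /=; rewrite (map_f fst).
by move=> i iu; move/hasPn: dis2 => /(_ i); rewrite !mem_cat iu => /(_ isT).
Qed.

Lemma FB_scan : (0 < m)%N -> FB m alpha beta ->
  scan C m [::] (zip beta alpha) =
  (-1) ^+ flip_sign_exp m alpha beta * tq (- (flip_deg m alpha beta)%:Z).
Proof.
move=> m_gt0 fb.
have [ps [u1 [r [Eps Er -> [bps bu1 br] [un1 un2 runiq dis1 dis2]]]]] := matching_data.
have [n sz] : exists n, size r = n by exists (size r).
have br1 j : (j < n)%N -> b (nth 0%N r j) by rewrite -sz => /(mem_nth 0%N) /br [].
have rN j : (j < n)%N -> (nth 0%N r j < N)%N by rewrite -sz => /(mem_nth 0%N) /br [].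
have split_objects : flip_objects m beta = [seq Flip21 x.1 x.2 | x <- ps]
    ++ [seq FlipMarked (m + 1 - j)%N (nth 0%N r j.-1) | j <- iota 1 n & (j <= m)%N]
    ++ [seq Flip22 (nth 0%N r j.-1) (nth 0%N r j)
       | j <- iota 1 n & [&& (m + 1 <= j)%N, ~~ odd (j - m + 1)%N & (j.+1 <= n)%N]].
  by rewrite /flip_objects Eps Er sz.
have bnd : all (fun o => all (fun i => (i < N)%N) (flip_indices o)) (flip_objects m beta).
  rewrite split_objects !all_cat !all_map; apply/and3P; split; apply/allP => x /=.
  - by move=> /bps [_ _ -> ->].
  - rewrite mem_filter mem_iota => /and3P[_ x1 x2]; rewrite rN //.
    by clear -x1 x2; lia.
  rewrite mem_filter mem_iota => /andP[/and3P[_ _ x2] /andP[x1 _]].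
  by rewrite !rN //; clear -x1 x2; lia.
have fl21 x : x \in ps -> flipped alpha beta (Flip21 x.1 x.2) = ~~ a x.1 && a x.2.
  by move=> /bps [b1 b2 _ _]; rewrite /flipped /= b1 (negbTE b2) andbT;
    case: (a x.1) (a x.2) => [] [].
have flr j : (j < n)%N -> (a (nth 0%N r j) != b (nth 0%N r j)) = ~~ a (nth 0%N r j).
  by move=> /br1 ->; case: (a _).
(* Every changed letter belongs to a flipped object. Excluding objects of the wrong kind by
   disjointness yields the conditions that [scan] tests. *)
have cases k : a k != b k ->
  [\/ exists2 x, x \in ps & [/\ (k == x.1) || (k == x.2), ~~ a x.1 & a x.2],
      exists2 j, (j < n)%N & (j < m)%N && (k == nth 0%N r j)
    | exists j, [/\ [&& (m <= j)%N, ~~ odd (j - m) & (j.+1 < n)%N],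
        (k == nth 0%N r j) || (k == nth 0%N r j.+1), ~~ a (nth 0%N r j) & ~~ a (nth 0%N r j.+1)]].
  move=> /(FB_flipped fb bnd); rewrite split_objects !has_cat !has_map.
  case/or3P=> /hasP /=.
  - move=> [x xp /andP[kx]]; rewrite /= fl21 // => /andP[x1 x2]; constructor 1; exists x => //.
    by move: kx; rewrite !inE.
  - move=> [j]; rewrite mem_filter mem_iota inE => /and3P[jm j0 jn] /andP[kx _].
    by constructor 2; exists j.-1; rewrite ?kx ?andbT; clear -jm j0 jn; lia.
  move=> [j]; rewrite mem_filter mem_iota => /andP[/and3P[mj od jn] /andP[j0 _]] /andP[kx].
  have [j1 Ej] : exists j1, j = j1.+1 by exists j.-1; rewrite prednK.
  subst j; rewrite /flipped /= !flr ?(ltnW jn) // andbT => /andP[a1 a2].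
  constructor 3; exists j1; split=> //; last by move: kx; rewrite !inE.
  rewrite jn andbT -ltnS -addn1 mj /=.
  by move: od; rewrite subSn; [rewrite addn1 /= negbK|clear -mj; lia].
have rb j x : (j < n)%N -> x.2 = nth 0%N r j -> x \in ps -> False.
  by move=> jn E /bps [_]; rewrite E br1.
have r1 j x : (j < n)%N -> x.1 = nth 0%N r j -> x \in ps -> False.
  by move=> jn E /dis1; rewrite E mem_nth ?sz.
have pair_ok x : x \in ps -> a x.2 = ~~ a x.1.
  move=> xp; have [bx1 bx2 _ _] := bps x xp.
  apply/idP/idP => h.
    have fx : a x.2 != b x.2 by rewrite h (negbTE bx2).
    case: (cases x.2 fx) =>
      [[y yp [/orP[] /eqP E a1 a2]]|[j jn /andP[_ /eqP E]]|[j [/and3P[_ _ jn] kx _ _]]].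
    - by move: bx2; rewrite E; have [-> _] := bps y yp.
    - by rewrite (uniq_map_inj un2 xp yp E).
    - by case: (rb j x jn E xp).
    by case/orP: kx => /eqP E; [case: (rb j x (ltnW jn) E xp)|case: (rb _ x jn E xp)].
  have fx : a x.1 != b x.1 by rewrite bx1; case: (a _) h.
  case: (cases x.1 fx) =>
    [[y yp [/orP[] /eqP E a1 a2]]|[j jn /andP[_ /eqP E]]|[j [/and3P[_ _ jn] kx _ _]]].
  - by rewrite (uniq_map_inj un1 xp yp E).
  - by move: bx1; rewrite E; have [_ /negbTE ->] := bps y yp.
  - by case: (r1 j x jn E xp).
  by case/orP: kx => /eqP E; [case: (r1 j x (ltnW jn) E xp)|case: (r1 _ x jn E xp)].
have u1_ok : all (fun i => ~~ a i) u1.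
  apply/allP => i iu; apply/negP => ai; have bi := bu1 i iu.
  have fx : a i != b i by rewrite ai (negbTE bi).
  case: (cases i fx) => [[y yp [/orP[] /eqP E a1 a2]]|[j jn /andP[_ /eqP E]]|[j [/and3P[_ _
    jn] kx _ _]]].
  - by move: bi; rewrite E; have [-> _] := bps y yp.
  - by have := dis2 i iu; rewrite E (map_f snd).
  - by move: bi; rewrite E br1.
  by case/orP: kx => /eqP E; move: bi; rewrite E br1 // ltnW.
pose g j := ~~ a (nth 0%N r j).
have pair22_ok j : (j < n)%N -> g j -> (m <= j)%N ->
    if odd (j - m) then g j.-1 else (j.+1 < n)%N && g j.+1.
  move=> jn gj mj; have fx : a (nth 0%N r j) != b (nth 0%N r j) by rewrite flr.
  case: (cases _ fx) => [[y yp [/orP[] /eqP E a1 a2]]|[j1 jn1 /andP[jm /eqP E]]|[j1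
    [/and3P[mj1 od jn1] kx a1 a2]]].
  - by case: (r1 j y jn (esym E) yp).
  - by case: (rb j y jn (esym E) yp).
  - by move/eqP: E; rewrite nth_uniq ?sz // => /eqP E; rewrite -E ltnNge mj in jm.
  case/orP: kx; rewrite nth_uniq ?sz //; try exact: ltnW.
    by move=> /eqP ->; rewrite (negbTE od) jn1 /g a2.
  by move=> /eqP ->; rewrite subSn //= od /g a1.
have GE j : nth false [seq ~~ a i | i <- r] j = (j < n)%N && g j.
  by case: ltnP => jn; [rewrite (nth_map 0%N) ?sz|rewrite nth_default // size_map sz].
have marks : all mark_ok (flip_objects m beta).
  rewrite split_objects !all_cat !all_map; apply/and3P; split; apply/allP => x //=.
  rewrite mem_filter mem_iota => /and3P[x1 x2 _]; clear -x1 x2; lia.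
rewrite u1_ok unpaired_valueE size_map sz.
have -> : all (fun j : nat =>
       nth false [seq ~~ a i | i <- r] j && (m <= j)%N ==>
       nth false [seq ~~ a i | i <- r] (if odd (j - m) then j.-1 else j.+1))
      (iota 0 n).
  apply/allP => j; rewrite mem_iota /= add0n => jn; apply/implyP; rewrite !GE jn => /andP[gj mj].
  have := pair22_ok j jn gj mj; case: ifP => // _ ->.
  by rewrite andbT (leq_ltn_trans (leq_pred j) jn).
transitivity (\prod_(o <- flip_objects m beta | flipped alpha beta o) object_value o); last first.
  by rewrite -objects_value.
rewrite split_objects !big_cat !big_map !big_filter_cond /=; congr (_ * _).
  rewrite [RHS]big_mkcond /= big_seq [RHS]big_seq; apply: eq_bigr => x xp.
  by rewrite fl21 // /pair_coef (pair_ok x xp) eqxx andbb.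
have -> : \prod_(0 <= j < n | nth false [seq ~~ a i | i <- r] j) unpaired_factor C m j
   = \prod_(0 <= j < n | (j < m)%N && g j) unpaired_factor C m j
     * \prod_(0 <= j < n | [&& (m <= j)%N, odd (j - m) & g j]) tq (-1).
  rewrite ![\prod_(0 <= _ < _ | _ && _) _]big_mkcond [LHS]big_mkcond -big_split.
  apply: eq_big_nat => j /andP[_ jn]; rewrite GE jn /unpaired_factor /=.
  by case: (g j); case: (odd _); case: (ltnP j m) => _; rewrite /= ?mulr1 ?mul1r.
congr (_ * _).
  rewrite -[1%N]/(1 + 0)%N iotaDl big_map /index_iota subn0 big_mkcond [RHS]big_mkcond /=.
  rewrite big_seq [RHS]big_seq; apply: eq_bigr => j; rewrite mem_iota /= add0n add1n /= => jn.
  rewrite /flipped /= flr // andbT -/(g j); case: ltnP => //= jm; case: (g j) => //.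
  by rewrite /unpaired_factor jm /=; congr (_ ^+ _ * tpow _ _); clear -jm; lia.
(* A 22-pair is indexed by the 1-based number [j] of its right letter, which is the 0-based rank of
   its left letter, where [unpaired_factor] puts t^-1. Rank 0 drops out as [m > 0], and [j = n]
   because no left letter is available. *)
case En : n => [|n1]; first by rewrite !big_nil.
have Ei : iota 1 n1.+1 = iota 1 n1 ++ [:: n1.+1] by rewrite -[in LHS](addn1 n1) iotaD add1n.
rewrite Ei /index_iota subn0 big_cat /= [X in _ = _ * X]big_cons ltnn !andbF /= big_nil mulr1.
rewrite big_cons leqn0 eqn0Ngt m_gt0 /= big_mkcond [RHS]big_mkcond.
rewrite big_seq [RHS]big_seq; apply: eq_bigr => j; rewrite mem_iota => /andP[j0 jn].
have {}jn : (j < n)%N by rewrite En; clear -jn; lia.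
have jn' : (j.-1 < n)%N by apply: leq_ltn_trans (leq_pred j) jn.
rewrite -En jn andbT /flipped /= !flr // andbT -/(g j) -/(g j.-1).
have := pair22_ok j jn.
case: (ltngtP m j) => [lt|lt|<-]; last 2 first.
- have {}lt : (j < m)%N by [].
  by rewrite addn1 (ltnNge m j) (ltnW lt).
- by rewrite subnn /= addn1 ltnn.
rewrite !addn1 lt /= negbK => ok; case: (boolP (odd _)) ok => //= _ ok.
by case: (g j) ok => [/(_ isT isT) ->|_]; rewrite ?andbF.
Qed.

End FlipSets.

(** * Action of the Hecke generators on coefficients *)

Section Coefficients.
Variables (C : comNzRingType) (m : nat).
Local Notation L := (laurent C).
Local Notation tq := (@tpow C).
Implicit Types (f g : seq bool -> L) (s X Y : seq bool).

Definition kl_coef (beta : seq bool) (alpha : seq bool) : L := scan C m [::] (zip beta alpha).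

Definition insert_pair (i : nat) g s : L :=
  pair_coef C (nth false s i) (nth false s i.+1) * g (take i s ++ drop i.+2 s).

(* The action of T_{i+1} + t^-1 on coefficient functions. *)
Definition act_swap (i : nat) f s : L :=
  let x := nth false s i in let y := nth false s i.+1 in
  if x == y then 0
  else tq (if x then 1 else -1) * f s + f (take i s ++ y :: x :: drop i.+2 s).

Definition act_last f s : L :=
  tq (if last false s then m%:Z else - m%:Z) * f s
  + f (rcons (take (size s).-1 s) (~~ last false s)).

Definition tensor (p : nat) (u g : seq bool -> L) s : L := u (take p s) * g (drop p s).

Definition delta (w s : seq bool) : L := if s == w then 1 else 0.

Lemma drop_two X x y Y : drop (size X).+2 (X ++ x :: y :: Y) = Y.
Proof. by rewrite -cat_rcons -cat_rcons drop_size_cat // !size_rcons. Qed.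

Lemma insert_pairE X x y Y g : insert_pair (size X) g (X ++ x :: y :: Y) =
  pair_coef C x y * g (X ++ Y).
Proof.
by rewrite /insert_pair !nth_cat ltnn subnn ltnNge leqnSn /= subSnn /= take_size_cat // drop_two.
Qed.

Lemma act_swapE X x y Y f : act_swap (size X) f (X ++ x :: y :: Y) =
  if x == y then 0 else tq (if x then 1 else -1) * f (X ++ x :: y :: Y) + f (X ++ y :: x :: Y).
Proof.
by rewrite /act_swap !nth_cat ltnn subnn ltnNge leqnSn /= subSnn /= take_size_cat // drop_two.
Qed.

Lemma act_lastE A x f : act_last f (rcons A x) =
  tq (if x then m%:Z else - m%:Z) * f (rcons A x) + f (rcons A (~~ x)).
Proof. by rewrite /act_last last_rcons size_rcons -cats1 take_size_cat. Qed.

Lemma tensorE A s u g : tensor (size A) u g (A ++ s) = u A * g s.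
Proof. by rewrite /tensor take_size_cat // drop_size_cat. Qed.

Lemma split_two i s : (i.+2 <= size s)%N ->
  exists X x y Y, [/\ s = X ++ x :: y :: Y, size X = i & size Y = (size s - i.+2)%N].
Proof.
move=> h; exists (take i s), (nth false s i), (nth false s i.+1), (drop i.+2 s).
have h1 : (i < size s)%N by lia.
by rewrite -!drop_nth // cat_take_drop size_takel ?size_drop; [|lia].
Qed.

Lemma kl_coef_pair X Y s : size s = (size X + size Y).+2 ->
  kl_coef (X ++ true :: false :: Y) s = insert_pair (size X) (kl_coef (X ++ Y)) s.
Proof.
move=> ss; have [|X' [x [y [Y' [-> sX sY]]]]] := @split_two (size X) s; first by lia.
rewrite -sX insert_pairE /kl_coef !zip_cat // [zip (_ :: _) _]/=.
exact: scan_cut.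
Qed.

Lemma kl_coef_unpaired1 Y x s : kl_coef (false :: Y) (x :: s) = if x then 0 else kl_coef Y s.
Proof. by []. Qed.

Lemma scan_twos st s r : scan C m st (zip (nseq (size s) true) s ++ r) =
  scan C m (rev [seq ~~ x | x <- s] ++ st) r.
Proof.
elim: s st => //= x s IH st; rewrite IH rev_cons cat_rcons //.
Qed.

Lemma kl_coef_twos s : kl_coef (nseq (size s) true) s =
  unpaired_value C m m (rev [seq ~~ x | x <- s]).
Proof. by rewrite /kl_coef -[zip _ _]cats0 scan_twos /= cats0. Qed.

(** The outer letter agrees with the adjacent letter in one of the two terms of the pair vector,
    which is killed; in the other term the powers of t combine to those of the moved pair. *)
Lemma insert_move_left i g s : (i.+3 <= size s)%N ->
  act_swap i (insert_pair i.+1 g) s = insert_pair i g s.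
Proof.
move=> h; have [|X [x [y [Y [E0 sX sY]]]]] := @split_two i s; first by lia.
case: Y E0 sY => [|z Y] E0 /= sY; first by lia.
rewrite {}E0 -sX.
have E b1 b2 b3 : insert_pair (size X).+1 g (X ++ [:: b1, b2,
  b3 & Y]) = pair_coef C b2 b3 * g (X ++ b1 :: Y).
  by rewrite -cat_rcons -(size_rcons X b1) insert_pairE cat_rcons.
rewrite act_swapE !E insert_pairE /pair_coef /flip_factor.
by case: x y z => [] [] [] /=; rewrite ?mul0r ?mulr0 ?mul1r ?addr0 ?add0r // mulrA tpowK mul1r.
Qed.

Lemma insert_move_right i g s : (i.+3 <= size s)%N ->
  act_swap i.+1 (insert_pair i g) s = insert_pair i.+1 g s.
Proof.
move=> h; have [|X [x [y [Y [E0 sX sY]]]]] := @split_two i s; first by lia.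
case: Y E0 sY => [|z Y] E0 /= sY; first by lia.
rewrite {}E0 -sX.
have E b1 b2 b3 : insert_pair (size X).+1 g (X ++ [:: b1, b2,
  b3 & Y]) = pair_coef C b2 b3 * g (X ++ b1 :: Y).
  by rewrite -cat_rcons -(size_rcons X b1) insert_pairE cat_rcons.
have E1 f b1 b2 b3 : act_swap (size X).+1 f (X ++ [:: b1, b2, b3 & Y]) =
   if b2 == b3 then 0 else tq (if b2 then 1 else -1) * f (X ++ [:: b1, b2,
     b3 & Y]) + f (X ++ [:: b1, b3, b2 & Y]).
  by rewrite -cat_rcons -(size_rcons X b1) act_swapE !cat_rcons.
rewrite E E1 !insert_pairE /pair_coef /flip_factor.
by case: x y z => [] [] [] /=; rewrite ?mul0r ?mulr0 ?mul1r ?addr0 ?add0r // mulrA tpowK mul1r.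
Qed.

Lemma insert_tensor p i u g s : (p <= i)%N -> (i.+2 <= size s)%N ->
  insert_pair i (tensor p u g) s = tensor p u (insert_pair (i - p) g) s.
Proof.
move=> pi h; have [X [x [y [Y [-> sX sY]]]]] := split_two h.
have [A [B [EX sA]]] : exists A B, X = A ++ B /\ size A = p.
  by exists (take p X), (drop p X); rewrite cat_take_drop size_takel // sX.
rewrite -sX insert_pairE EX -!catA -sA !tensorE size_cat addKn insert_pairE.
by rewrite mulrCA.
Qed.

Lemma swap_tensor p i u g s : (p <= i)%N -> (i.+2 <= size s)%N ->
  act_swap i (tensor p u g) s = tensor p u (act_swap (i - p) g) s.
Proof.
move=> pi h; have [X [x [y [Y [-> sX sY]]]]] := split_two h.
have [A [B [EX sA]]] : exists A B, X = A ++ B /\ size A = p.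
  by exists (take p X), (drop p X); rewrite cat_take_drop size_takel // sX.
rewrite -sX act_swapE EX -!catA -sA !tensorE size_cat addKn act_swapE.
by case: ifP; rewrite ?mulr0 // mulrDr mulrCA.
Qed.

Lemma pairs22_prefix F : ~~ odd (size F) ->
  exists c, forall R, pairs22_value C (F ++ R) = c * pairs22_value C R.
Proof.
have [n] := ubnP (size F); elim: n F => // n IH [|f [|g F]] //=.
  by move=> _ _; exists 1 => R; rewrite mul1r.
rewrite !ltnS negbK => sF od; have [|c H] := IH F _ od; first exact: leq_trans (leqnSn _) sF.
exists ((if f == g then flip_factor C f else 0) * c) => R; rewrite H.
by case: ifP => _; rewrite ?mul0r // mulrA.
Qed.

Lemma unpaired_prefix k F : (size F <= k)%N ->
  exists c, forall R, unpaired_value C m k (F ++ R) = c * unpaired_value C m (k - size F) R.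
Proof.
elim: k F => [|k IH] [|f F] //= sF; try by exists 1 => R; rewrite mul1r ?subn0.
have [c H] := IH F sF; eexists => R; rewrite H mulrA subSS; reflexivity.
Qed.

Lemma unpaired_value0 F : unpaired_value C m 0 F = pairs22_value C F.
Proof. by case: F. Qed.

Lemma unpaired_prefix_pairs F : (m <= size F)%N -> ~~ odd (size F - m) ->
  exists c, forall R, unpaired_value C m m (F ++ R) = c * pairs22_value C R.
Proof.
move=> mF od; have [|c H] := @unpaired_prefix m (take m F);
  first by rewrite size_take_min geq_minl.
have [|c' H'] := @pairs22_prefix (drop m F); first by rewrite size_drop.
exists (c * c') => R;
  rewrite -{1}(cat_take_drop m F) -catA H size_takel // subnn unpaired_value0 H'.
by rewrite mulrA.
Qed.

Definition flags s := rev [seq ~~ x | x <- s].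

Lemma flags_cat X Y : flags (X ++ Y) = flags Y ++ flags X.
Proof. by rewrite /flags map_cat rev_cat. Qed.

Lemma size_flags s : size (flags s) = size s.
Proof. by rewrite /flags size_rev size_map. Qed.

(** The image is a multiple of the pair vector in [x], [y], with the scalar read off at the letters
    21. Flags run from the right, so [true :: false] is the word 21. *)
Lemma swap_twos_value X x y Y :
  act_swap (size X) (fun s => unpaired_value C m m (flags s)) (X ++ x :: y :: Y) =
  pair_coef C x y * (tq 1 * unpaired_value C m m (flags Y ++ true :: false :: flags X)
     + unpaired_value C m m (flags Y ++ false :: true :: flags X)).
Proof.
have E b1 b2 : flags (X ++ [:: b1, b2 & Y]) = flags Y ++ ~~ b2 :: ~~ b1 :: flags X.
  by rewrite flags_cat /flags /= !rev_cons -!cats1 -!catA.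
rewrite act_swapE !E /pair_coef /flip_factor.
case: x y => [] [] /=; rewrite ?mul0r ?mul1r // mulrDr mulrA -tpowD addNr tpow0 mul1r addrC //.
Qed.

Lemma act_swap_twos i n : (0 < m)%N -> (i.+2 <= n)%N ->
  (forall s, size s = n -> act_swap i (kl_coef (nseq n true)) s = 0) \/
  exists e X' Y', (size X' + size Y').+2 = n /\ forall s, size s = n ->
    act_swap i (kl_coef (nseq n true)) s = (-1) ^+ e * kl_coef (X' ++ true :: false :: Y') s.
Proof.
move=> m_gt0 h; set l := (n - i.+2)%N.
have valE s : size s = n -> exists X x y Y, [/\ s = X ++ x :: y :: Y, size X = i, size Y = l &
    act_swap i (kl_coef (nseq n true)) s =
    pair_coef C x y * (tq 1 * unpaired_value C m m (flags Y ++ true :: false :: flags X)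
     + unpaired_value C m m (flags Y ++ false :: true :: flags X))].
  move=> sn; have [|X [x [y [Y [E sX sY]]]]] := @split_two i s; first by rewrite sn.
  exists X, x, y, Y; split=> //; first by rewrite sY sn.
  rewrite -swap_twos_value -E -sX E !act_swapE.
  have E1 b1 b2 : size (X ++ [:: b1, b2 & Y]) = n.
    by rewrite -sn E !size_cat.
  by rewrite -{1}(E1 x y) kl_coef_twos -(E1 y x) kl_coef_twos.
(* [l] is the rank of the right letter [y]. Both letters marked: the signs are opposite and the
   exponents differ by one, so the two terms cancel. *)
case: (ltnP l.+1 m) => lm.
  left=> s /valE [X [x [y [Y [-> sX sY ->]]]]].
  have [|c H] := @unpaired_prefix m (flags Y); first by rewrite size_flags; lia.
  rewrite !H size_flags sY; have [k Ek] : exists k, (m - l = k.+2)%N by exists (m - l - 2)%N; lia.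
  rewrite Ek /= !mul1r.
  have E1 : (m - k.+1 = (m - k.+2).+1)%N by lia.
  have E2 : - k.+1%:Z = 1 + - k.+2%:Z by lia.
  rewrite E1 exprS E2 tpowD /=; ring.
have T1 c a z : tq 1 * (c * (a * tq (- 1%:Z) * z)) = c * (a * z).
  by transitivity (c * (a * z) * (tq 1 * tq (- 1%:Z))); [ring|rewrite tpowK mulr1].
(* The right letter has mark 1 and the left one has none; the sign is that of the factor with mark
   1. *)
case: (ltnP l m) => lm1.
  have El : (m - l)%N = 1%N by lia.
  right; exists (m - 1)%N, (nseq i true), (nseq l true); rewrite !size_nseq.
  split=> [|s sn]; first by lia.
  have [X [x [y [Y [E sX sY ->]]]]] := valE s sn.
  rewrite kl_coef_pair ?size_nseq ?sn; last by lia.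
  rewrite E -sX insert_pairE sX -nseqD -sX -sY -size_cat kl_coef_twos -/(flags _) flags_cat.
  have [|c H] := @unpaired_prefix m (flags Y); first by rewrite size_flags; lia.
  rewrite !H size_flags sY El [unpaired_value _ _ 1 (_ :: _)]/= [X in _ + _ * X]/= T1.
  rewrite [RHS]mulrCA; congr (_ * _); case: (flags X) => [|[] G] /=.
  - by ring.
  - rewrite /flip_factor ?unpaired_value0 mulr0 mulr0 add0r.
    transitivity (((-1) ^+ (m - 1) * (-1) ^+ (m - 1)) * (c * (tq (- 1%:Z) * pairs22_value C G))).
      by rewrite -exprMn mulrNN mulr1 expr1n !mul1r.
    by ring.
  by rewrite ?unpaired_value0 /flip_factor; ring.
(* For even [l - m] both letters belong to one 22-pair, and in both terms their flags differ. *)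
case od : (odd (l - m)); last first.
  left=> s /valE [X [x [y [Y [-> sX sY ->]]]]].
  have [||c H] := @unpaired_prefix_pairs (flags Y); rewrite ?size_flags ?sY ?od //.
  by rewrite !H /= !mulr0 addr0 mulr0.
have [l1 El] : exists l1, l = l1.+1 by exists l.-1; case: (l) od => //; rewrite sub0n.
(* The letters belong to different objects. In the new word the former partner of [y] is a 1, paired
   with the former partner of [x], or unpaired if [x] was unclassified. *)
right; exists 0%N, (nseq i true), (false :: nseq l1 true); rewrite /= !size_nseq.
split=> [|s sn]; first by lia.
have [X [x [y [Y [E sX sY ->]]]]] := valE s sn.
rewrite mul1r kl_coef_pair /= ?size_nseq ?sn; last by lia.
rewrite E -sX insert_pairE sX; congr (_ * _).
case: Y E sY => [|z Y] E /= sY; first by rewrite El in sY.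
have sY1 : size Y = l1 by lia.
rewrite /kl_coef -sX -sY1 zip_cat ?size_nseq // scan_twos cats0 -/(flags X) [zip (_ :: _) _]/=.
have Ef : flags (z :: Y) = flags Y ++ [:: ~~ z] by rewrite /flags /= rev_cons cats1.
rewrite Ef -!catA /=.
have ml1 : (m <= l1)%N by move: od; rewrite El; case: (ltngtP m l1.+1) lm1; lia.
have [||c H] := @unpaired_prefix_pairs (flags Y); rewrite ?size_flags ?sY1 //.
  by move: od; rewrite El subSn //= => ->.
have S st : scan C m st (zip (nseq l1 true) Y) = c * pairs22_value C st.
  by rewrite -sY1 -[zip _ _]cats0 scan_twos /= -/(flags Y) H.
have T2 d w : tq 1 * (d * (tq (-1) * w)) = d * w.
  by transitivity (d * w * (tq 1 * tq (-1))); [ring|rewrite tpowK mulr1].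
rewrite !H; case: (flags X) => [|g G] /=; rewrite !S /flip_factor.
  by case: z {E Ef} => /=; rewrite ?T2 ?mulr0 ?addr0.
by case: z g {E Ef} => [] [] /=; rewrite ?T2 ?mulr0 ?addr0 ?add0r ?mul1r //; ring.
Qed.

Lemma kl_coef_diag w : kl_coef w w = 1 :> L.
Proof.
have pairs1 k : pairs22_value C (nseq k false) = 1.
  by have [d] := ubnP k; elim: d k => // d IH [|[|k]] //= kd; rewrite mul1r IH //; lia.
have unp1 j k : unpaired_value C m j (nseq k false) = 1.
  elim: j k => [|j IH] [|k] //=; [exact: pairs1 k.+1|by rewrite mul1r].
suff H k : scan C m (nseq k false) (zip w w) = 1 by exact: (H 0%N).
elim: w k => [|[] w IH] k /=; [exact: unp1|exact: (IH k.+1)|].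
by case: k => [|k] /=; [exact: (IH 0%N)|rewrite mul1r].
Qed.

Definition negative_monomial (b : bool) (x : L) : Prop :=
  x = 0 \/ exists e k, x = (-1) ^+ e * tq (- k%:Z) /\ (b -> 0 < k)%N.

Lemma negative_monomialM b1 b2 x y : negative_monomial b1 x -> negative_monomial b2 y ->
  negative_monomial (b1 || b2) (x * y).
Proof.
move=> [->|[e [k [-> h]]]]; first by left; rewrite mul0r.
move=> [->|[e' [k' [-> h']]]]; first by left; rewrite mulr0.
right; exists (e + e')%N, (k + k')%N; rewrite mulrACA -exprD -tpowD; split.
  by congr (_ * tpow _ _); lia.
by case: b1 b2 h h' => [] [] //=; lia.
Qed.

Lemma negative_monomial1 : negative_monomial false 1.
Proof. by right; exists 0%N, 0%N; rewrite mul1r. Qed.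

Lemma negative_monomial_flip (f : bool) : negative_monomial f (flip_factor C f).
Proof. by case: f; [right; exists 0%N, 1%N; rewrite mul1r|exact: negative_monomial1]. Qed.

Lemma negative_monomial_pairs st : negative_monomial (has id st) (pairs22_value C st).
Proof.
have [n] := ubnP (size st); elim: n st => // n IH [|f [|g st]] /=.
- by move=> _; exact: negative_monomial1.
- by move=> _; case: f; [left|exact: negative_monomial1].
rewrite ltnS => sn; case: eqP => [->|_]; last by left.
have := negative_monomialM (negative_monomial_flip g) (IH st (ltnW sn)).
by case: g.
Qed.

Lemma negative_monomial_unpaired k st : negative_monomial (has id st) (unpaired_value C m k st).
Proof.
elim: k st => [|k IH] st; first by rewrite unpaired_value0; exact: negative_monomial_pairs.
case: st => [|f st] /=; first exact: negative_monomial1.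
apply: negative_monomialM (IH st); case: f; last exact: negative_monomial1.
by right; exists (m - k.+1)%N, k.+1.
Qed.

(** A nonzero value pays for each true flag with a negative power of t, either when its 1 arrives or
    at the end of the scan. *)
Lemma negative_monomial_scan st (s : seq (bool * bool)) : negative_monomial (has id st || has
  (fun x => x.1 != x.2) s)
  (scan C m st s).
Proof.
elim: s st => [|[[] x] s IH] st /=.
- by rewrite orbF; exact: negative_monomial_unpaired.
- by have := IH (~~ x :: st) => /=; case: x => /=; rewrite ?orbT.
case: st => [|f st]; first by case: x => /=; [left|exact: (IH [::])].
case: (x =P f) => [->|_]; last by left.
have := negative_monomialM (negative_monomial_flip f) (IH st).
by case: f.
Qed.

Lemma kl_coef_negative w s k : size w = size s -> s != w -> 0 <= k -> (kl_coef w s)@_k = 0.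
Proof.
move=> sz ne k0.
have h : has (fun x => x.1 != x.2) (zip w s).
  elim: w s sz ne => [|x w IH] [|y s] //= [sz]; rewrite eqseq_cons negb_and eq_sym.
  by case/orP=> [->//|/(IH _ sz) ->]; rewrite orbT.
case: (negative_monomial_scan [::] (zip w s)) => [E|[e [j [E]]]].
  by rewrite /kl_coef E mcoeff0.
rewrite h => /(_ isT) j0; rewrite /kl_coef E -signr_odd.
have T : (tq (- j%:Z))@_k = 0 by rewrite tpowE; case: eqP => //; lia.
by case: (odd e); rewrite ?mul1r ?mulN1r ?mcoeffN ?T ?oppr0.
Qed.

End Coefficients.

(** * Bar invariance of C_beta *)

(* The Coxeter length of the coset representative of a word. *)
Fixpoint word_length (s : seq bool) : nat :=
  if s is x :: s' then (x * (size s').+1 + word_length s')%N else 0%N.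

Lemma word_length_cat X Y Y' : size Y = size Y' ->
  (word_length (X ++ Y) + word_length Y' = word_length (X ++ Y') + word_length Y)%N.
Proof. by move=> E; elim: X => [|x X IH] /=; [rewrite addnC|rewrite !size_cat E; lia]. Qed.

Lemma word_length_swap X Y :
  word_length (X ++ true :: false :: Y) = (word_length (X ++ false :: true :: Y)).+1.
Proof. by have := @word_length_cat X (true :: false :: Y) (false :: true :: Y) erefl;
  rewrite /=; lia. Qed.

Lemma word_length_last X : word_length (rcons X true) = (word_length (rcons X false)).+1.
Proof. by rewrite -!cats1; have := @word_length_cat X [:: true] [:: false] erefl; rewrite /=;
  lia. Qed.

Lemma word_length_max s : (word_length s <= word_length (nseq (size s) true))%N.
Proof. by elim: s => //= x s IH; rewrite size_nseq; case: x; lia. Qed.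

Lemma word_decomp s : [\/ s = nseq (size s) false, exists X, s = rcons X true
  | exists X Y, s = X ++ true :: false :: Y].
Proof.
elim: s => [|x s [E|[X ->]|[X [Y ->]]]]; first by constructor 1.
- case: x; last by constructor 1; rewrite /= -E.
  case: s E => [|y s] /= E; first by constructor 2; exists [::].
  by case: E => -> _; constructor 3; exists [::], s.
- by constructor 2; exists (x :: X).
by constructor 3; exists (x :: X), Y.
Qed.

Section BarInvariance.
Variables (C : comNzRingType) (N m : nat).
Hypothesis m_gt0 : (0 < m)%N.
Local Notation L := (laurent C).
Local Notation tq := (@tpow C).
Local Notation fn := (seq bool -> L).

(* [Bar f g] means that the bar involution maps the element with coefficients  *)
(* [f] to the one with coefficients [g].                                      *)
Variable Bar : fn -> fn -> Prop.
Hypothesis Bar_ext : forall f f' g g', (forall s, size s = N -> f s = f' s) ->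
  (forall s, size s = N -> g s = g' s) -> Bar f g -> Bar f' g'.
Hypothesis Bar_fun : forall f g g', Bar f g -> Bar f g' -> forall s, size s = N -> g s = g' s.
Hypothesis Bar_ex : forall f, exists g, Bar f g.
Hypothesis Bar_0 : Bar (fun=> 0) (fun=> 0).
Hypothesis Bar_lin : forall c f f' g g', Bar f g -> Bar f' g' ->
  Bar (fun s => c * f s + f' s) (fun s => lbar c * g s + g' s).
Hypothesis Bar_swap : forall i f g, (i.+1 < N)%N -> Bar f g -> Bar (act_swap i f) (act_swap i g).
Hypothesis Bar_last : forall f g, (0 < N)%N -> Bar f g -> Bar (act_last m f) (act_last m g).
Hypothesis Bar_one : Bar (delta C (nseq N false)) (delta C (nseq N false)).

Definition bar_fixed f := Bar f f.

Lemma bar_fixed_ext f f' : (forall s, size s = N -> f s = f' s) -> bar_fixed f -> bar_fixed f'.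
Proof. by move=> E; apply: Bar_ext. Qed.

Lemma bar_fixed_sign e f : bar_fixed f -> bar_fixed (fun s => (-1) ^+ e * f s).
Proof.
move=> H; elim: e => [|e IH].
  by apply: bar_fixed_ext H => s _; rewrite expr0 mul1r.
have := Bar_lin (-1) IH Bar_0; rewrite lbarN1 => H1.
by apply: bar_fixed_ext H1 => s _; rewrite addr0 exprS mulrA.
Qed.

(** A pair moves one place, either way, by a bar-invariant generator, so its place is immaterial for
    invariance. *)
Lemma bar_fixed_insert i j g : (i.+2 <= N)%N -> (j.+2 <= N)%N ->
  bar_fixed (insert_pair i g) -> bar_fixed (insert_pair j g).
Proof.
have right k : (k.+3 <= N)%N -> bar_fixed (insert_pair k g) -> bar_fixed (insert_pair k.+1 g).
  move=> kN H; apply: bar_fixed_ext (Bar_swap kN H) => s sN.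
  by apply: insert_move_right; rewrite sN.
have left k : (k.+3 <= N)%N -> bar_fixed (insert_pair k.+1 g) -> bar_fixed (insert_pair k g).
  move=> kN H; apply: bar_fixed_ext (Bar_swap (ltnW kN) H) => s sN.
  by apply: insert_move_left; rewrite sN.
have to0 k : (k.+2 <= N)%N -> bar_fixed (insert_pair k g) -> bar_fixed (insert_pair 0 g).
  by elim: k => // k IH kN H; apply: IH (ltnW kN) (left _ kN H).
have from0 k : (k.+2 <= N)%N -> bar_fixed (insert_pair 0 g) -> bar_fixed (insert_pair k g).
  by elim: k => // k IH kN H; apply: right (kN) (IH (ltnW kN) H).
by move=> iN jN /(to0 _ iN) /(from0 _ jN).
Qed.

Lemma Bar_sum (T : Type) (r : seq T) (c : T -> L) (f g : T -> fn) : (forall i, Bar (f i) (g i)) ->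
  Bar (fun s => \sum_(i <- r) c i * f i s) (fun s => \sum_(i <- r) lbar (c i) * g i s).
Proof.
move=> H; elim: r => [|i r IH]; first by apply: Bar_ext Bar_0 => s _; rewrite big_nil.
by apply: Bar_ext (Bar_lin (c i) (H i) IH) => s _; rewrite big_cons.
Qed.

Section Tensor.
Variables (p n : nat) (u : fn).
Hypothesis pn : (p + n)%N = N.
Hypothesis fixed_one : bar_fixed (tensor p u (delta C (nseq n false))).

(** Unitriangularity with respect to length. With [w0] shorter by one, m_w is (T_i + t_i^-1) m_w0 -
    t_i^-1 m_w0, and at words at least as long as [w] the generator sees only the leading term of
    the image of m_w0. *)
Lemma Bar_triangular g w : size w = n -> Bar (tensor p u (delta C w)) g ->
  forall A w', size A = p -> size w' = n -> (word_length w <= word_length w')%N ->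
  g (A ++ w') = if w' == w then u A else 0.
Proof.
have [k] := ubnP (word_length w); elim: k g w => // k IH g w wk sw Bg A w' sA sw' lw.
have sAw : size (A ++ w') = N by rewrite size_cat sA sw'.
have [Ew|[X Ew]|[X [Y Ew]]] := word_decomp w.
- rewrite Ew sw in Bg *; rewrite (Bar_fun Bg fixed_one sAw) -sA tensorE /delta.
  by case: eqP; rewrite ?mulr1 ?mulr0.
- have sX : (size X).+1 = n by rewrite -sw Ew size_rcons.
  have N0 : (0 < N)%N by lia.
  have [g0 Bg0] := Bar_ex (tensor p u (delta C (rcons X false))).
  have lX : word_length w = (word_length (rcons X false)).+1 by rewrite Ew word_length_last.
  have IH0 v : size v = n -> (word_length (rcons X false) <= word_length v)%N ->
      g0 (A ++ v) = if v == rcons X false then u A else 0.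
    by move=> sv lv; apply: IH Bg0 _ _ sA sv lv; rewrite ?size_rcons; lia.
  have B1 := Bar_lin (- tq (- m%:Z)) Bg0 (Bar_last N0 Bg0).
  have /Bar_fun := Bg => /(_ (fun s => lbar (- tq (- m%:Z)) * g0 s + act_last m g0 s)) -> //;
    last first.
    apply: Bar_ext B1 => // s ss.
    case/lastP: s ss => [|s x] ss; first by rewrite -ss in N0.
    have [B [D [E sB sD]]] : exists B D, [/\ s = B ++ D, size B = p & (size D).+1 = n].
      exists (take p s), (drop p s); rewrite cat_take_drop; rewrite size_rcons in ss.
      by rewrite size_takel ?size_drop; [split=> //; lia|lia].
    rewrite act_lastE E !rcons_cat -sB !tensorE /delta Ew !eqseq_rcons.
    by case: x {ss} => /=; case: eqP => _ /=; rewrite ?mulr0 ?mulr1 ?addr0 ?add0r ?mul0r //; ring.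
  have -> : g0 (A ++ w') = 0.
    rewrite IH0 //; last by lia.
    by case: eqP => // E; move: lw; rewrite E lX ltnn.
  rewrite mulr0 add0r.
  case/lastP: w' sw' lw sAw => [|Z z] sw' lw sAw; first by rewrite -sw' in sX.
  rewrite -rcons_cat act_lastE !rcons_cat Ew eqseq_rcons; rewrite size_rcons in sw'.
  rewrite (IH0 (rcons Z z)) ?size_rcons //; last by lia.
  rewrite (IH0 (rcons Z (~~ z))) ?size_rcons //; last first.
    by move: lw; rewrite lX; case: (z); rewrite /= !word_length_last; lia.
  rewrite !eqseq_rcons; clear sAw; case: z lw => lw /=; rewrite ?andbT ?andbF ?mulr0 ?add0r //.
  rewrite addr0; case: eqP => // E; last by rewrite mulr0.
  by move: lw; rewrite E lX ltnn.
set w0 := X ++ false :: true :: Y.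
have sX : (size X + (size Y).+2 = n)%N by rewrite -sw Ew size_cat.
have sw0 : size w0 = n by rewrite size_cat.
have lX : word_length w = (word_length w0).+1 by rewrite Ew word_length_swap.
have [g0 Bg0] := Bar_ex (tensor p u (delta C w0)).
have IH0 v : size v = n -> (word_length w0 <= word_length v)%N ->
    g0 (A ++ v) = if v == w0 then u A else 0.
  by move=> sv lv; apply: IH Bg0 _ _ sA sv lv => //; lia.
have iN : ((p + size X).+1 < N)%N by lia.
have B1 := Bar_lin (- tq (-1)) Bg0 (Bar_swap iN Bg0).
have /Bar_fun := Bg => /(_ (fun s =>
  lbar (- tq (-1)) * g0 s + act_swap (p + size X) g0 s)) -> //; last first.
  apply: Bar_ext B1 => // s ss.
  rewrite swap_tensor ?leq_addr ?ss // addKn -(cat_take_drop p s).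
  have sp : size (take p s) = p by rewrite size_takel // ss; lia.
  have sd : size (drop p s) = n by rewrite size_drop ss; lia.
  move: (take p s) (drop p s) sp sd => B D sB sD; rewrite -sB !tensorE mulrCA -mulrDr;
    congr (_ * _).
  have [|X' [x [y [Y' [-> sX' _]]]]] := @split_two (size X) D; first by lia.
  rewrite -sX' act_swapE /delta Ew /w0 !eqseq_cat // !eqseq_cons.
  by case: x y => [] [] /=; rewrite ?andbF ?mulr0 ?addr0 ?add0r //; case: ifP => _ /=;
    rewrite ?mulr0 ?mulr1 ?addr0 ?add0r //; rewrite addrC subrr.
have -> : g0 (A ++ w') = 0.
  rewrite IH0 //; last by lia.
  by case: eqP => // E; move: lw; rewrite E lX ltnn.
rewrite mulr0 add0r.
have [|X' [x [y [Y' [E sX' _]]]]] := @split_two (size X) w'; first by lia.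
rewrite {}E in sw' lw *; rewrite catA -sA -sX' -size_cat act_swapE -!catA.
have neq Z Z' : (X' ++ true :: Z == X ++ false :: Z') = false.
  by rewrite eqseq_cat // eqseq_cons /= andbF.
clear sAw; rewrite Ew; case: x y sw' lw => [] [] sw' lw /=.
- by rewrite eqseq_cat // !eqseq_cons /= !andbF.
- rewrite !IH0 // ?neq ?mulr0 ?add0r; first by rewrite /w0 !eqseq_cat // !eqseq_cons.
  + by rewrite -sw' !size_cat.
  + by move: lw; rewrite lX word_length_swap ltnS.
  by lia.
- rewrite !IH0 // ?neq ?addr0.
  + rewrite [RHS]ifF; last by rewrite eqseq_cat // !eqseq_cons /= andbF.
    by case: eqP => E; [move: lw; rewrite E lX ltnn|rewrite mulr0].
  + by rewrite -sw' !size_cat.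
  + by move: lw; rewrite lX word_length_swap; lia.
  by lia.
by rewrite eqseq_cat // !eqseq_cons /= !andbF.
Qed.

Lemma tensor_expand h s : size s = N ->
  tensor p u h s = \sum_(w : n.-tuple bool) h w * tensor p u (delta C w) s.
Proof.
move=> ss; have sd : size (drop p s) == n by rewrite size_drop ss -pn addKn.
rewrite (bigD1 (Tuple sd)) //= big1 ?addr0 => [|w nw]; rewrite /tensor /delta.
  by rewrite eqxx mulr1 mulrC.
case: eqP => E; last by rewrite !mulr0.
by case/eqP: nw; apply: val_inj.
Qed.

(** 2...2 is the longest word, so by triangularity only its own term contributes. *)
Lemma Bar_top g A : Bar (tensor p u (kl_coef C m (nseq n true))) g -> size A = p ->
  g (A ++ nseq n true) = tensor p u (kl_coef C m (nseq n true)) (A ++ nseq n true).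
Proof.
move=> Bg sA; have sAn : size (A ++ nseq n true) = N by rewrite size_cat sA size_nseq.
have /choice [gw Hgw] (w : n.-tuple bool) := Bar_ex (tensor p u (delta C w)).
have B1 := Bar_sum (index_enum _) (fun w : n.-tuple bool => kl_coef C m (nseq n true) w) Hgw.
rewrite -[in RHS]sA tensorE kl_coef_diag mulr1.
have B2 : Bar (tensor p u (kl_coef C m (nseq n true)))
    (fun s => \sum_(w : n.-tuple bool) lbar (kl_coef C m (nseq n true) w) * gw w s).
  by apply: Bar_ext B1 => // s ss; rewrite tensor_expand.
rewrite (Bar_fun Bg B2 sAn).
have sn : size (nseq n true) == n by rewrite size_nseq.
rewrite (bigD1 (Tuple sn)) //= big1 => [|w nw].
  by rewrite addr0 kl_coef_diag lbar1 mul1r (Bar_triangular _ (Hgw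
    (Tuple sn))) ?eqxx //= size_nseq.
rewrite (Bar_triangular _ (Hgw w)) ?size_tuple ?size_nseq //; last first.
  by rewrite -{2}(size_tuple w) word_length_max.
case: eqP => E; last by rewrite mulr0.
by case/eqP: nw; apply: val_inj.
Qed.

(* The difference of this vector and its bar conjugate is killed by T_i + t^-1  *)
(* for p < i < N and is an eigenvector of T_N + t_N^-1, so that its coefficients *)
(* are determined by those at the words A 2...2, which are zero.              *)
Lemma fixed_twos : (0 < n)%N ->
  (forall i, (i.+2 <= n)%N -> bar_fixed (tensor p u (act_swap i (kl_coef C m (nseq n true))))) ->
  bar_fixed (tensor p u (kl_coef C m (nseq n true))).
Proof.
set f := tensor p u _ => n0 fixed_swap; have [g Bg] := Bar_ex f.
have N0 : (0 < N)%N by lia.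
have swapE i : (i.+2 <= n)%N -> forall s,
  size s = N -> act_swap (p + i) g s = act_swap (p + i) f s.
  move=> iN; have iN' : ((p + i).+1 < N)%N by lia.
  have B : bar_fixed (act_swap (p + i) f).
    apply: bar_fixed_ext (fixed_swap i iN) => s ss.
    by rewrite /f swap_tensor ?leq_addr ?ss // addKn.
  exact: Bar_fun (Bar_swap iN' Bg) B.
(* The last 2 has mark [m], and m_2 + t^-m m_1 is an eigenvector of T_N + t_N^-1. *)
have eig A x : size A = N.-1 ->
  act_last m f (rcons A x) = (tq m%:Z + tq (- m%:Z)) * f (rcons A x).
  move=> sA; have [B [D [-> sB sD]]] : exists B D, [/\ A = B ++ D, size B = p & (size D).+1 = n].
    exists (take p A), (drop p A); rewrite cat_take_drop size_takel ?size_drop ?sA; last by lia.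
    by split=> //; lia.
  rewrite act_lastE !rcons_cat /f -sB !tensorE.
  have vE y : kl_coef C m (nseq n true) (rcons D y) =
      (if y then 1 else tq (- m%:Z)) * unpaired_value C m m.-1 (flags D).
    rewrite -sD -(size_rcons D y) kl_coef_twos map_rcons rev_rcons.
    by case: (m) m_gt0 => // k _ /=; rewrite subnn expr0 mul1r; case: y.
  rewrite !vE; case: x => /=; first by ring.
  move: (tpowK C m%:Z) (u B) (unpaired_value C m m.-1 (flags D)).
  move: (tq m%:Z) (tq (- m%:Z)) => y y' yK v z.
  transitivity (y * y' * (v * z) + y' * (v * (y' * z))); last by ring.
  by rewrite yK; ring.
have lastE A x : size A = N.-1 ->
  act_last m g (rcons A x) = (tq m%:Z + tq (- m%:Z)) * g (rcons A x).
  move=> sA; have B1 := Bar_lin (tq m%:Z) Bg (Bar_lin (tq (- m%:Z)) Bg Bar_0).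
  have sAx : size (rcons A x) = N by rewrite size_rcons sA prednK.
  have B2 : Bar (act_last m f) (fun s => lbar (tq m%:Z) * g s + (lbar (tq (- m%:Z)) * g s + 0)).
    apply: Bar_ext B1 => // s; case/lastP: s => [|B y]; first by move=> E; rewrite -E in N0.
    by rewrite size_rcons => sB; rewrite eig; [ring|rewrite -sB].
  by rewrite (Bar_fun (Bar_last N0 Bg) B2 sAx) !lbar_tpow opprK; ring.
suff E s : size s = N -> f s = g s by apply: Bar_ext Bg => // s /E.
move=> ss; rewrite -(cat_take_drop p s).
have : size (take p s) = p by rewrite size_takel // ss; lia.
have : size (drop p s) = n by rewrite size_drop ss; lia.
move: (take p s) (drop p s) => A w sw sA {s ss}.
(* Induction on the number of 1's, then on the distance of the last 1 from the right end: swap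
   equations bring it to the end, where the eigenvalue equation turns it into a 2. *)
have [k] := ubnP (count negb w); elim: k w sw => // k IH w sw wk.
have [E|[X [Y Ew]]] : w = nseq n true \/ exists X Y, w = X ++ false :: nseq Y true.
  clear -sw; elim: w n sw => [|x w IH] n' /= <-; first by left.
  have [->|[X [Y ->]]] := IH _ erefl.
    by rewrite size_nseq; case: x; [left|right; exists [::], (size w)].
  by right; exists (x :: X), Y.
  by rewrite E (Bar_top Bg).
elim: Y X w sw wk Ew => [|Y IHY] X w sw wk Ew.
  have sX : size (A ++ X) = N.-1 by have := sw; rewrite Ew !size_cat /=; lia.
  have E : f (rcons (A ++ X) true) = g (rcons (A ++ X) true).
    rewrite rcons_cat; apply: IH; first by rewrite -sw Ew size_rcons size_cat addn1.
    by move: wk; rewrite Ew -cats1 !count_cat /=; lia.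
  have := eig _ true sX; have := lastE _ true sX; rewrite !act_lastE /= E => <- /addrI.
  by rewrite rcons_cat Ew cats1.
have iN : ((size X).+2 <= n)%N by rewrite -sw Ew size_cat /= size_nseq; lia.
have sAX b1 b2 : size (A ++ X ++ [:: b1, b2 & nseq Y true]) = N.
  by rewrite -pn -sA -sw Ew !size_cat /=.
have sz : (p + size X)%N = size (A ++ X) by rewrite size_cat sA.
have E : f (A ++ X ++ [:: true, false & nseq Y true]) = g (A ++ X ++ [:: true,
  false & nseq Y true]).
  rewrite -cat_rcons; apply: IHY erefl; first by rewrite -sw Ew !size_cat size_rcons /=; lia.
  by move: wk; rewrite Ew -cats1 !count_cat /=; lia.
have := swapE _ iN _ (sAX true false); rewrite sz !catA !act_swapE /= -!catA E => /addrI.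
by rewrite Ew.
Qed.

End Tensor.

Lemma tensor0 (g : fn) s : tensor 0 (fun=> 1) g s = g s.
Proof. by rewrite /tensor drop0 mul1r. Qed.

(** Descending induction on length: once the coefficients at longer words vanish, triangularity
    gives [f s = lbar (f s)], impossible for nonzero purely negative exponents. *)
Lemma fixed_negative (f : fn) : bar_fixed f ->
  (forall s, size s = N -> forall k, 0 <= k -> (f s)@_k = 0) -> forall s, size s = N -> f s = 0.
Proof.
move=> fx neg s ss.
have f1 : bar_fixed (tensor 0 (fun=> 1) (delta C (nseq N false))).
  by apply: bar_fixed_ext Bar_one => s1 _; rewrite tensor0.
have /choice [gw Hgw] (w : N.-tuple bool) := Bar_ex (tensor 0 (fun=> 1) (delta C w)).
have B1 := Bar_sum (index_enum _) (fun w : N.-tuple bool => f w) Hgw.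
have B2 : Bar f (fun s => \sum_(w : N.-tuple bool) lbar (f w) * gw w s).
  apply: Bar_ext B1 => // s1 ss1.
  by rewrite -(tensor_expand (p := 0) (n := N)) ?tensor0.
have fE s1 (ss1 : size s1 = N) := Bar_fun fx B2 ss1.
set M := word_length (nseq N true).
have [k] := ubnP (M - word_length s); elim: k s ss => // k IH s ss sk.
have sE : f s = lbar (f s).
  have sN : size s == N by rewrite ss.
  rewrite {1}fE // (bigD1 (Tuple sN)) //= big1 => [|w nw].
    rewrite addr0; have := Bar_triangular (p := 0) (n := N) erefl f1 _ (Hgw (Tuple sN)) (A :=
      [::]) (w' := s).
    by rewrite eqxx /= => -> //; rewrite mulr1.
  case: (leqP (word_length w) (word_length s)) => lw.
    have := Bar_triangular (p := 0) (n := N) erefl f1 _ (Hgw w) (A := [::]) (w' :=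
      s) => /= ->; rewrite ?size_tuple //.
    case: eqP => E; last by rewrite mulr0.
    by case/eqP: nw; apply: val_inj.
  rewrite (_ : f w = 0); first by rewrite -[lbar 0]/(lbar 0) /lbar msupp0 big_seq_fset0 mul0r.
  apply: IH; first by rewrite size_tuple.
  by have := word_length_max w; rewrite size_tuple -/M; lia.
apply/malgP => j; rewrite mcoeff0; case: (lerP 0 j) => j0; first by rewrite neg.
by rewrite sE lbarE neg //; lia.
Qed.

Lemma kl_coef_fixed n : forall p (u : fn), (p + n)%N = N ->
  bar_fixed (tensor p u (delta C (nseq n false))) ->
  forall w, size w = n -> bar_fixed (tensor p u (kl_coef C m w)).
Proof.
elim/ltn_ind: n => n IH p u pn f1 w sw.
have pair_case X Y : (size X + size Y).+2 = n ->
    bar_fixed (tensor p u (kl_coef C m (X ++ true :: false :: Y))).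
  move=> sXY.
  have sp (s : seq bool) : size s = N -> exists A D, [/\ s = A ++ D, size A = p & size D = n].
    move=> ss; exists (take p s), (drop p s); rewrite cat_take_drop size_takel ?size_drop ?ss;
      last by lia.
    by split=> //; lia.
  have iN : ((p + size X).+2 <= N)%N by lia.
  apply: (@bar_fixed_ext (insert_pair (p + size X) (tensor p u (kl_coef C m (X ++ Y))))).
    move=> s ss; rewrite insert_tensor ?leq_addr ?ss // addKn.
    have [A [D [-> sA sD]]] := sp s ss; rewrite -sA !tensorE kl_coef_pair //.
    by rewrite sD.
  have pN : (p.+2 <= N)%N by lia.
  apply: (bar_fixed_insert pN iN).
  (* The pair, moved to the front of the block, joins the prefix. *)
  pose u2 s := u (take p s) * pair_coef C (nth false s p) (nth false s p.+1).
  have u2E g s : size s = N -> insert_pair p (tensor p u g) s = tensor p.+2 u2 g s.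
    move=> ss; have [A [D [-> sA sD]]] := sp s ss.
    case: D sD => [|x [|y D]] sD; try by rewrite -sXY in sD.
    rewrite -sA insert_pairE tensorE.
    have -> : A ++ [:: x, y & D] = (A ++ [:: x; y]) ++ D by rewrite -catA.
    have s2 : (size A).+2 = size (A ++ [:: x; y]) by rewrite size_cat addn2.
    rewrite s2 tensorE /u2 -sA take_size_cat // !nth_cat ltnn subnn ltnNge leqnSn /= subSnn /=.
    by rewrite mulrCA mulrA.
  apply: (@bar_fixed_ext (tensor p.+2 u2 (kl_coef C m (X ++ Y)))); first by move=> s /u2E.
  apply: (IH (n - 2)%N); [by lia|by lia| |by rewrite size_cat; lia].
  (* Invariance for the new prefix: moved to the right end, the pair comes from 1...1 by [act_last]
     followed by [act_swap]. *)
  apply: (@bar_fixed_ext (insert_pair p (tensor p u (delta C (nseq (n - 2) false)))));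
    first by move=> s /u2E.
  have lN : ((N - 2).+2 <= N)%N by lia.
  apply: (bar_fixed_insert lN pN).
  have N0 : (0 < N)%N by lia.
  have lN1 : ((N - 2).+1 < N)%N by lia.
  apply: bar_fixed_ext (Bar_swap lN1 (Bar_last N0 f1)) => s ss.
  have [|Z [x [y [Y' [E sZ sY']]]]] := @split_two (N - 2) s; first by rewrite ss.
  case: Y' E sY' => [|? Y'] E sY'; last by rewrite ss /= in sY'; lia.
  rewrite E -sZ act_swapE insert_pairE -[[:: x; y]]/(rcons [:: x] y) -[[:: y;
    x]]/(rcons [:: y] x).
  rewrite -!rcons_cat !act_lastE cats0.
  have [A [D [-> sA sD]]] : exists A D, [/\ Z = A ++ D, size A = p & size D = (n - 2)%N].
    exists (take p Z), (drop p Z); rewrite cat_take_drop size_takel ?size_drop ?sZ; last by lia.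
    by split=> //; lia.
  have E2 b1 b2 : tensor p u (delta C (nseq n false)) (rcons ((A ++ D) ++ [:: b1]) b2) =
     u A * (if [&& D == nseq (n - 2) false, ~~ b1 & ~~ b2] then 1 else 0).
    rewrite -catA rcons_cat -sA tensorE /delta.
    have -> : nseq n false = nseq (n - 2) false ++ rcons [:: false] false.
      by rewrite -[rcons _ _]/(nseq 2 false) -nseqD; congr nseq; lia.
    by rewrite rcons_cat eqseq_cat ?size_nseq //; case: b1 b2 => [] [].
  rewrite !E2 -sA tensorE /delta /pair_coef /flip_factor.
  by case: (D == _); case: x y {E} => [] [] /=;
    rewrite ?(mulr0, mul0r, addr0, add0r, mulr1, mul1r).
case: w sw => [|[] w] sw.
- subst n; rewrite addn0 in pn; apply: bar_fixed_ext f1 => s ss.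
  by rewrite /tensor drop_oversize ?ss ?pn // kl_coef_diag.
- have [E|[X [Y E]]] : true :: w = nseq n true \/ exists X Y, true :: w = X ++ true :: false :: Y.
    rewrite -sw; elim: {sw} w => [|[] w IHw] /=; first by left.
      case: IHw => [[->]|[X [Y ->]]]; first by left; rewrite size_nseq.
      by right; exists (true :: X), Y.
    by right; exists [::], w.
    rewrite E; apply: fixed_twos => //; first by rewrite -sw.
    move=> i iN; case: (act_swap_twos C m_gt0 iN) => [H|[e [X' [Y' [sXY H]]]]].
      apply: bar_fixed_ext Bar_0 => s ss; rewrite /tensor H ?mulr0 //.
      by rewrite size_drop ss -pn addKn.
    apply: bar_fixed_ext (bar_fixed_sign e (pair_case _ _ sXY)) => s ss.
    have sd : size (drop p s) = n by rewrite size_drop ss -pn addKn.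
    by rewrite /tensor (H _ sd) mulrA mulrA [_ * u _]mulrC.
  rewrite E; apply: pair_case; rewrite E size_cat /= in sw; lia.
case: n sw pn f1 IH {pair_case} => [//|n] [sw] pn f1 IH.
(* A leading 1 is unpaired and joins the prefix unchanged. *)
pose u1 s := u (take p s) * (if nth false s p then 0 else 1).
have u1E g h s : size s = N -> (forall x t, g (x :: t) = if x then 0 else h t) ->
    tensor p.+1 u1 h s = tensor p u g s.
  move=> ss H; have [A [x [D [-> sA]]]] : exists A x D, s = A ++ x :: D /\ size A = p.
    exists (take p s), (nth false s p), (drop p.+1 s).
    by rewrite -drop_nth ?cat_take_drop ?size_takel ?ss //; lia.
  rewrite -sA tensorE H -cat_rcons -(size_rcons A x) tensorE /u1 -sA -cats1 take_size_cat //.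
  by rewrite nth_cat ltnn subnn /=; case: x; rewrite ?mulr0 ?mul0r ?mulr1.
apply: (@bar_fixed_ext (tensor p.+1 u1 (kl_coef C m w))) => [s ss|].
  by apply: u1E => // x t; rewrite kl_coef_unpaired1.
apply: (IH n) => //; first by rewrite addSnnS.
apply: bar_fixed_ext f1 => s ss; rewrite (u1E (delta C (nseq n.+1 false))) // => x t.
by rewrite /delta eqseq_cons; case: x.
Qed.

End BarInvariance.

(** * The Kazhdan-Lusztig basis *)

Section HeckeModule.
Variables (C : comNzRingType) (N m : nat).
Local Notation L := (laurent C).
Local Notation tq := (@tpow C).
Variables (H : algType L) (T : 'I_N -> H) (barH : {rmorphism H -> H}).
Variables (M : lmodType H) (mb : word N -> M) (barM : {additive M -> M}).
Hypothesis H_hecke : hecke_relations m T.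
Hypothesis barH_def : is_hecke_bar T barH.
Hypothesis M_minus : is_module_minus m T mb.
Hypothesis barM_def : is_module_bar mb barH barM.

Definition vec (f : seq bool -> L) : M := \sum_(w : word N) (f w)%:A *: mb w.

Definition bar_image (f g : seq bool -> L) : Prop := barM (vec f) = vec g.

Lemma vec_ext f g : (forall s, size s = N -> f s = g s) -> vec f = vec g.
Proof. by move=> E; apply: eq_bigr => w _; rewrite E ?size_tuple. Qed.

Lemma vec_inj f g s : vec f = vec g -> size s = N -> f s = g s.
Proof.
move=> E ss; have [uniq_coef _] := M_minus.
have [c [_ u]] := uniq_coef (vec f).
have cf : c = [ffun w : word N => f w].
  by apply: u; apply: eq_bigr => w _; rewrite ffunE.
have cg : c = [ffun w : word N => g w].
  by apply: u; rewrite E; apply: eq_bigr => w _; rewrite ffunE.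
have sN : size s == N by rewrite ss.
by have := congr1 (fun c : {ffun word N -> L} => c (Tuple sN)) (etrans (esym cf) cg);
  rewrite !ffunE.
Qed.

Lemma vec_surj v : exists f, v = vec f.
Proof.
have [uniq_coef _] := M_minus; have [c [-> _]] := uniq_coef v.
exists (fun s => if insub s is Some w then c w else 0).
by apply: eq_bigr => w _; rewrite valK.
Qed.

Lemma scale_algM (x y : L) (v : M) : (x * y)%:A *: v = x%:A *: (y%:A *: v).
Proof. by rewrite scalerA mulr_algl scalerA. Qed.

Lemma scale_algC (x : L) (h : H) (v : M) : h *: (x%:A *: v) = x%:A *: (h *: v).
Proof. by rewrite !scalerA mulr_algl mulr_algr. Qed.

Lemma vec_lin x f g : vec (fun s => x * f s + g s) = x%:A *: vec f + vec g.
Proof.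
rewrite /vec scaler_sumr -big_split /=; apply: eq_bigr => w _.
by rewrite scalerDl scalerDl scale_algM.
Qed.

Lemma vec0 : vec (fun=> 0) = 0.
Proof. by apply: big1 => w _; rewrite !scale0r. Qed.

Definition e_gen (i : 'I_N) : H := T i + (tq (- param_exp m i))%:A.

Lemma letter_s_act (i : 'I_N) (w : word N) k : (k < N)%N -> letter (s_act i w) k =
  if (i.+1 < N)%N then
    if k == i :> nat then letter w i.+1 else if k == i.+1 :> nat then letter w i else letter w k
  else if k == i :> nat then ~~ letter w k else letter w k.
Proof.
by move=> kN; rewrite {1}/letter /s_act -(tnth_nth false _ (Ordinal kN)) tnth_mktuple.
Qed.

Lemma word_eq (w w' : word N) : (forall k, (k < N)%N -> letter w k = letter w' k) -> w = w'.
Proof.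
move=> E; apply: val_inj; apply: (@eq_from_nth _ false); first by rewrite !size_tuple.
by move=> k; rewrite size_tuple => /E.
Qed.

Lemma s_actK (i : 'I_N) : involutive (s_act i).
Proof.
move=> w; apply: word_eq => k kN; have iN := ltn_ord i.
case iN1: (i.+1 < N)%N; last first.
  by rewrite letter_s_act // iN1 letter_s_act // iN1; case: (k == i :> nat); rewrite ?negbK.
rewrite !letter_s_act // ?iN1 // !eqxx (_ : (i.+1 == i :> nat) = false); last by lia.
by have [->|_] := eqVneq k i; [|have [->|] := eqVneq k i.+1].
Qed.

Lemma s_act_swap (i : 'I_N) (w : word N) : (i.+1 < N)%N ->
  s_act i w = take i w ++ letter w i.+1 :: letter w i :: drop i.+2 w :> seq bool.
Proof.
move=> iN; apply: (@eq_from_nth _ false).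
  rewrite size_tuple size_cat /= size_drop size_takel ?size_tuple; lia.
rewrite size_tuple => k kN; rewrite -[LHS]/(letter (s_act i w) k) letter_s_act // iN.
rewrite nth_cat size_takel ?size_tuple; last by lia.
case: ltngtP => [lt|gt|->].
- by rewrite ltn_eqF ?nth_take //; lia.
- have [E|ne] := eqVneq k i.+1; first by rewrite E subSn // subnn.
  have -> : (k - i = (k - i.+2).+2)%N by lia.
  by rewrite /= nth_drop subnKC //; lia.
by rewrite subnn.
Qed.

Lemma s_act_last (i : 'I_N) (w : word N) : (i.+1 = N)%N ->
  s_act i w = rcons (take (size w).-1 w) (~~ last false w) :> seq bool.
Proof.
move=> iN; apply: (@eq_from_nth _ false).
  by rewrite size_tuple size_rcons size_takel ?size_tuple; lia.
rewrite size_tuple => k kN; rewrite -[LHS]/(letter (s_act i w) k) letter_s_act //.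
rewrite iN ltnn nth_rcons size_takel size_tuple; last by lia.
have -> : N.-1 = i by lia.
rewrite -nth_last size_tuple; have -> : N.-1 = i by lia.
case: ltngtP => [lt|gt|->//]; first by rewrite nth_take.
by lia.
Qed.

Lemma hecke_inverse i : T i * (T i - (tq (param_exp m i))%:A + (tq (- param_exp m i))%:A) = 1.
Proof.
have [/(_ i) E _ _ _] := H_hecke.
move: E; rewrite mulrBl; set t := (tq (param_exp m i))%:A; set t' := (tq _)%:A.
have tt' : t * t' = 1 by rewrite mulr_algl scalerA tpowK scale1r.
have Tt : t * T i = T i * t by rewrite mulr_algl mulr_algr.
rewrite [t * _]mulrDr tt' Tt opprD addrA => /subr0_eq <-.
by rewrite -mulrBr addrAC.
Qed.

Lemma bar_gen i : barH (T i) = T i - (tq (param_exp m i))%:A + (tq (- param_exp m i))%:A.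
Proof.
have [_ /(_ i) [b1 _]] := barH_def.
by rewrite -[LHS]mulr1 -[X in _ * X = _](hecke_inverse i) mulrA b1 mul1r.
Qed.

(** By the quadratic relation T_i^-1 + t_i equals T_i + t_i^-1. *)
Lemma bar_e_gen i : barH (e_gen i) = e_gen i.
Proof.
have [bs _] := barH_def.
by rewrite /e_gen rmorphD bs bar_gen lbar_tpow opprK addrAC subrK.
Qed.

Lemma bar_e_gen_action i f g : bar_image f g -> barM (e_gen i *: vec f) = e_gen i *: vec g.
Proof. by have [_ bm] := barM_def; rewrite bm bar_e_gen => ->. Qed.

Lemma e_gen_vec i (k1 k2 : word N -> L) (f f' : seq bool -> L) :
  (forall w, e_gen i *: mb w = (k1 w)%:A *: mb w + (k2 w)%:A *: mb (s_act i w)) ->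
  (forall w : word N, f' w = k1 w * f w + k2 (s_act i w) * f (s_act i w)) ->
  e_gen i *: vec f = vec f'.
Proof.
move=> E1 E2; rewrite /vec scaler_sumr.
under eq_bigr => w _ do rewrite scale_algC E1 scalerDr -!scale_algM.
rewrite big_split /= [X in _ + X](reindex_inj (inv_inj (@s_actK i))) /= -big_split /=.
by apply: eq_bigr => w _; rewrite s_actK E2 !scalerDl ![_ * f _]mulrC.
Qed.

Lemma e_gen_swap (i : 'I_N) f : (i.+1 < N)%N -> e_gen i *: vec f = vec (act_swap i f).
Proof.
move=> iN; have [_ act] := M_minus.
apply: (@e_gen_vec i
  (fun w => if letter w i == letter w i.+1 then 0 else tq (if letter w i then 1 else -1))
  (fun w => if letter w i == letter w i.+1 then 0 else 1)) => w.
  rewrite scalerDl act /minus_action /param_exp iN.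
  case: (letter w i) (letter w i.+1) => [] [] /=.
  - by rewrite addNr !scale0r addr0.
  - by rewrite -addrA -scalerDl -scalerDl subrK scale1r scale1r addrC.
  - by rewrite scale1r scale1r addrC.
  by rewrite addNr !scale0r addr0.
rewrite /act_swap -/(letter w i) -/(letter w i.+1) -s_act_swap // !letter_s_act // iN !eqxx.
rewrite (_ : (i.+1 == i :> nat) = false); last by lia.
by rewrite eq_sym; case: eqP => _; rewrite ?mul0r ?addr0 ?mul1r.
Qed.

Lemma e_gen_last (i : 'I_N) f : (i.+1 = N)%N -> e_gen i *: vec f = vec (act_last m f).
Proof.
move=> iN; have [_ act] := M_minus.
apply: (@e_gen_vec i (fun w => tq (if letter w i then m%:Z else - m%:Z)) (fun=> 1)) => w.
  rewrite scalerDl act /minus_action /param_exp iN ltnn.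
  case: (letter w i) => /=.
    by rewrite -addrA -scalerDl -scalerDl subrK scale1r scale1r addrC.
  by rewrite scale1r scale1r addrC.
rewrite /act_last -(s_act_last w iN) mul1r.
by rewrite -nth_last size_tuple (_ : N.-1 = i) //; lia.
Qed.

Lemma vec_delta (w : word N) : vec (delta C w) = mb w.
Proof.
rewrite /vec (bigD1 w) //= big1 ?addr0 => [|w' nw].
  by rewrite /delta eqxx !scale1r.
by rewrite /delta -val_eqE in nw *; rewrite (negbTE nw) !scale0r.
Qed.

Lemma bar_image_ext f f' g g' : (forall s, size s = N -> f s = f' s) ->
  (forall s, size s = N -> g s = g' s) -> bar_image f g -> bar_image f' g'.
Proof. by move=> E1 E2; rewrite /bar_image (vec_ext E1) (vec_ext E2). Qed.

Lemma bar_image_fun f g g' : bar_image f g -> bar_image f g' ->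
  forall s, size s = N -> g s = g' s.
Proof. by move=> E E' s; apply: vec_inj; rewrite -E. Qed.

Lemma bar_image_ex f : exists g, bar_image f g.
Proof. exact: vec_surj. Qed.

Lemma bar_image0 : bar_image (fun=> 0) (fun=> 0).
Proof. by rewrite /bar_image vec0 raddf0. Qed.

Lemma bar_image_lin c f f' g g' : bar_image f g -> bar_image f' g' ->
  bar_image (fun s => c * f s + f' s) (fun s => lbar c * g s + g' s).
Proof.
rewrite /bar_image !vec_lin raddfD /= => <- <-.
by have [_ ->] := barM_def; have [-> _] := barH_def.
Qed.

Lemma bar_image_swap i f g : (i.+1 < N)%N -> bar_image f g ->
  bar_image (act_swap i f) (act_swap i g).
Proof.
move=> iN Bfg; have iN' := ltnW iN.
by rewrite /bar_image -!(@e_gen_swap (Ordinal iN') _ iN) (bar_e_gen_action _ Bfg).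
Qed.

Lemma bar_image_last f g : (0 < N)%N -> bar_image f g ->
  bar_image (act_last m f) (act_last m g).
Proof.
move=> N0 Bfg; have iN : (N.-1 < N)%N by rewrite prednK.
have iN1 : (Ordinal iN).+1 = N by exact: prednK.
by rewrite /bar_image -!(e_gen_last _ iN1) (bar_e_gen_action _ Bfg).
Qed.

Lemma bar_image_one : bar_image (delta C (nseq N false)) (delta C (nseq N false)).
Proof.
have E : nseq N false = [tuple false | _ < N] :> seq bool.
  apply: (@eq_from_nth _ false); first by rewrite size_nseq size_tuple.
  move=> k; rewrite size_nseq => kN.
  by rewrite nth_nseq kN -(tnth_nth false _ (Ordinal kN)) tnth_mktuple.
by rewrite /bar_image E vec_delta; have [] := barM_def.
Qed.

Lemma bruhat_refl (w : word N) : bruhat w w.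
Proof. by apply/forallP => k. Qed.

Lemma kl_polynomialE (P : word N -> word N -> L) : (0 < m)%N -> is_kl_family m mb barM P ->
  forall alpha beta, bruhat alpha beta ->
    tdiff C m alpha beta * P alpha beta = kl_coef C m beta alpha.
Proof.
move=> m_gt0 [fixedP P1 negP] alpha beta le_ab.
(* The given basis element, its coefficients extended by zero to all words, as the comparison takes
   place on all words. *)
pose h s : L := if insub s is Some w then
  if bruhat w beta then tdiff C m w beta * P w beta else 0 else 0.
have fh : bar_image h h.
  have E : vec h = kl_element m mb P beta.
    rewrite /vec /kl_element [RHS]big_mkcond; apply: eq_bigr => w _.
    by rewrite /h valK; case: ifP => // _; rewrite !scale0r.
  by rewrite /bar_image E fixedP.
have f1 : bar_image (tensor 0 (fun=> 1) (delta C (nseq N false))) (tensor 0 (fun=> 1)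
  (delta C (nseq N false))).
  by apply: bar_image_ext bar_image_one => s _; rewrite tensor0.
have fk := kl_coef_fixed m_gt0 bar_image_ext bar_image_fun bar_image_ex bar_image0 bar_image_lin
  bar_image_swap bar_image_last (erefl : (0 + N)%N = N) f1 (size_tuple beta).
have fd := bar_image_lin (-1) fk fh; rewrite lbarN1 in fd.
have hE (w : word N) : h w = if bruhat w beta then tdiff C m w beta * P w beta else 0.
  by rewrite /h valK.
have E0 : -1 * tensor 0 (fun=> 1) (kl_coef C m beta) alpha + h alpha = 0.
  (* At [beta] both coefficients are 1 and cancel; at every other word both have only negative
     exponents. *)
  apply: (fixed_negative m_gt0 bar_image_ext bar_image_fun bar_image_ex bar_image0 bar_image_lin
    bar_image_swap bar_image_last bar_image_one fd _ (size_tuple alpha)) => s ss k k0.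
  rewrite tensor0 mulN1r; have [w ->] : exists w : word N, s = w.
    by have sN : size s == N by [rewrite ss]; exists (Tuple sN).
  rewrite hE; have [->|ne] := eqVneq w beta.
    by rewrite bruhat_refl P1 /tdiff subrr tpow0 mulr1 kl_coef_diag addNr mcoeff0.
  rewrite mcoeffD mcoeffN kl_coef_negative ?size_tuple // oppr0 add0r.
  case: ifP => [le_w|_]; last by rewrite mcoeff0.
  by have [_ ->] := negP w beta le_w ne k.
by move: E0; rewrite tensor0 hE le_ab mulN1r addrC => /subr0_eq.
Qed.

End HeckeModule.

Theorem corollary20 (R : realType) (N m : nat) (m_gt0 : (0 < m)%N)
    (H : algType (laurent R[i])) (T : 'I_N -> H)
    (barH : {rmorphism H -> H})
    (M : lmodType H) (mb : word N -> M) (barM : {additive M -> M})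
    (P : word N -> word N -> laurent R[i])
    (H_hecke : is_hecke_algebra m T)
    (barH_def : is_hecke_bar T barH)
    (M_minus : is_module_minus m T mb)
    (barM_def : is_module_bar mb barH barM)
    (P_kl : is_kl_family m mb barM P)
    (alpha beta : word N) (le_alpha_beta : bruhat alpha beta) :
  tdiff R[i] m alpha beta * Q_minus m R[i] alpha beta
    = tdiff R[i] m alpha beta * P alpha beta
  /\ (FB m alpha beta ->
      tdiff R[i] m alpha beta * P alpha beta
        = (-1) ^+ flip_sign_exp m alpha beta
          * tpow R[i] (- (flip_deg m alpha beta)%:Z)).
Proof.
rewrite (kl_polynomialE H_hecke.1 barH_def M_minus barM_def m_gt0 P_kl le_alpha_beta).
by split; [rewrite tdiff_Q_minus // -scanE|apply: FB_scan].
Qed.
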